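(* Let $\mathrm{Diff}(S^2\times S^3)$ be the diffeomorphism group of the closed $5$-manifold $S^2\times S^3$. Then the fundamental group $\pi_1(\mathrm{Diff}(S^2\times S^3))$ (based at the identity) is infinite.
   Context: For a closed manifold $X$, $\mathrm{Diff}(X)$ denotes the group of diffeomorphisms of $X$. It is regarded as an open subset of the Banach manifold $\mathrm{Maps}(X,X)$ of maps $X\to X$ of Sobolev class $H^{s_0}$, for a fixed $s_0\gg 0$; that is, one works with diffeomorphisms of Sobolev class $H^{s_0}$, with the corresponding topology. *)

(* Defs.v *)
From HB Require Import structures.
From mathcomp Require Import all_boot all_order all_algebra.
From mathcomp Require Import all_classical all_reals all_analysis.
From mathcomp Require Import homotopy ring.

Set Implicit Arguments.
Unset Strict Implicit.
Unset Printing Implicit Defensive.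

Import Order.TTheory GRing.Theory Num.Theory.
Import numFieldNormedType.Exports.

Local Open Scope classical_set_scope.
Local Open Scope ring_scope.

(** * Fundamental group *)

Definition unit_interval (R : realType) : Type := set_type `[0 : R, 1]%classic.

Section UnitInterval.
Variable R : realType.

Lemma unit_interval0P : (0 : R) \in `[0 : R, 1]%classic.
Proof. by rewrite inE /= in_itv /= lexx ler01. Qed.

Lemma unit_interval1P : (1 : R) \in `[0 : R, 1]%classic.
Proof. by rewrite inE /= in_itv /= lexx ler01. Qed.

Definition ui0 : unit_interval R := exist _ 0 unit_interval0P.
Definition ui1 : unit_interval R := exist _ 1 unit_interval1P.

Lemma ui0_neq1 : ui0 != ui1.
Proof.
by apply/negP => /eqP [] /esym/eqP; rewrite (negbTE (oner_neq0 _)).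
Qed.

HB.instance Definition _ :=
  Topological.copy (unit_interval R) (set_type `[0 : R, 1]%classic).
HB.instance Definition _ := isBiPointed.Build (unit_interval R) ui0_neq1.

End UnitInterval.

Section FundamentalGroup.
Variables (R : realType) (T : topologicalType) (x : T).

Local Notation I := (unit_interval R).
Local Notation loop := {path I from x to x in T}.

Definition loop_homotopic (f g : loop) : Prop :=
  exists H : I * I -> T,
    [/\ continuous H,
        (forall t, H (t, zero) = f t),
        (forall t, H (t, one) = g t) &
        (forall u, H (zero, u) = x /\ H (one, u) = x)].

(** The underlying set of pi_1(T, x): the set of homotopy classes (rel
    endpoints) of loops, each class being a set of loops. *)
Definition pi1 : set (set loop) :=
  [set [set g | loop_homotopic f g] | f in [set: loop]].

End FundamentalGroup.

Arguments pi1 R {T} x.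

(** * Sobolev functions on R^5 *)

Section Sobolev.
Variable R : realType.

Definition R5 : Type := (R * R * R * R * R)%type.
HB.instance Definition _ := NormedModule.on R5.
HB.instance Definition _ := Measurable.on R5.

Definition lebesgue5 :=
  let mu := @lebesgue_measure R in (mu \x mu \x mu \x mu \x mu)%E.
HB.instance Definition _ := Measure.on lebesgue5.

Definition coord5 (x : R5) : seq R :=
  let: (x0, x1, x2, x3, x4) := x in [:: x0; x1; x2; x3; x4].

Definition basis5 (i : 'I_5) : R5 :=
  let d (k : nat) : R := (k == i :> nat)%:R in
  (d 0%N, d 1%N, d 2%N, d 3%N, d 4%N).

Definition partials (l : seq 'I_5) (phi : R5 -> R) : R5 -> R :=
  foldr (fun i g x => 'D_(basis5 i) g x) phi l.

Definition test_function (phi : R5 -> R) : Prop :=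
  (forall (l : seq 'I_5) (x : R5), differentiable (partials l phi) x) /\
  (exists2 K : set R5, compact K & forall x, ~ K x -> phi x = 0).

Definition L2loc (w : R5 -> R) : Prop :=
  measurable_fun [set: R5] w /\
  forall r : R, (\int[lebesgue5]_(x in ball (0%R : R5) r) (w x ^+ 2)%:E < +oo)%E.

Definition is_weak_derivative (l : seq 'I_5) (v w : R5 -> R) : Prop :=
  L2loc w /\
  forall phi, test_function phi ->
    (\int[lebesgue5]_(x in [set: R5]) (v x * partials l phi x) =
     (-1) ^+ size l * \int[lebesgue5]_(x in [set: R5]) (w x * phi x))%R.

(** Well defined only up to a null set; only meaningful when one exists. *)
Definition weak_derivative (l : seq 'I_5) (v : R5 -> R) : R5 -> R :=
  xget (fun=> 0) [set w | is_weak_derivative l v w].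

Definition Hloc (s : nat) (v : R5 -> R) : Prop :=
  forall l : seq 'I_5, (size l <= s)%N -> exists w, is_weak_derivative l v w.

(** The H^s norm on the sup-norm ball of radius [r]; partial derivatives are indexed by
    words rather than multi-indices, so mixed ones are counted repeatedly,
    which gives an equivalent norm. *)
Definition sobolev_norm (s : nat) (r : R) (v : R5 -> R) : \bar R :=
  ((\sum_(k < s.+1) \sum_(l : k.-tuple 'I_5)
      \int[lebesgue5]_(x in ball (0%R : R5) r) (weak_derivative l v x ^+ 2)%:E)
   `^ 2^-1)%E.

End Sobolev.

(** * The manifold S^2 x S^3 *)

Section Manifold.
Variable R : realType.

Definition sphere (n : nat) : set 'rV[R]_(n + 1) :=
  [set x | \sum_i x 0 i ^+ 2 = 1].
Arguments sphere : clear implicits.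

Definition S2xS3 : Type := (sphere 2 * sphere 3)%type.
HB.instance Definition _ := Topological.on S2xS3.

Definition sqnorm n (x : 'rV[R]_n) : R := \sum_i x 0 i ^+ 2.

(** Inverse stereographic projection R^n -> S^n, from the pole e_(n+1) for
    [b = false] and from the pole -e_(n+1) for [b = true]. *)
Definition stereo_fun n (b : bool) (x : 'rV[R]_n) : 'rV[R]_(n + 1) :=
  row_mx ((2 / (sqnorm x + 1)) *: x)
         (const_mx ((-1) ^+ b * (sqnorm x - 1) / (sqnorm x + 1))).

Lemma stereo_funP n b (x : 'rV[R]_n) : stereo_fun b x \in sphere n.
Proof.
rewrite inE /sphere /= big_split_ord /= big_ord1.
under eq_bigr do rewrite row_mxEl mxE exprMn.
rewrite row_mxEr mxE -mulr_sumr -/(sqnorm x).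
have q0 : 0 <= sqnorm x by apply: sumr_ge0 => i _; exact: sqr_ge0.
have q1 : sqnorm x + 1 != 0 by rewrite gt_eqF// ltr_wpDl.
by case: b => /=; rewrite ?expr0 ?expr1; field.
Qed.

Definition stereo n (b : bool) (x : 'rV[R]_n) : sphere n :=
  exist _ (stereo_fun b x) (stereo_funP b x).

(** The inverses of the four charts of the standard smooth atlas. *)
Definition param (c : bool * bool) (x : R5 R) : S2xS3 :=
  (stereo c.1 (\row_(i < 2) (coord5 x)`_i),
   stereo c.2 (\row_(i < 3) (coord5 x)`_(2 + i)%N)).

(** Coordinates of the embedding of S^2 x S^3 in R^3 x R^4. *)
Definition embed (j : 'I_(2 + 1) + 'I_(3 + 1)) (p : S2xS3) : R :=
  match j with
  | inl i => set_val p.1 0 i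
  | inr i => set_val p.2 0 i
  end.

Definition local_expr (f : S2xS3 -> S2xS3) (c : bool * bool)
    (j : 'I_(2 + 1) + 'I_(3 + 1)) (x : R5 R) : R :=
  embed j (f (param c x)).

(** Maps of Sobolev class H^s, for [s] above the Sobolev embedding threshold
    5/2: every such map has a unique continuous representative, which is the
    one chosen here.  Each chart is onto R^5 and S^2 x S^3 is covered by the
    images of balls, so being of class H^s is a local condition on R^5. *)
Record Maps (s : nat) : Type := MkMaps {
  map_fun :> S2xS3 -> S2xS3;
  map_continuous : continuous map_fun;
  map_Hloc : forall c j, Hloc s (local_expr map_fun c j)
}.

HB.instance Definition _ s := gen_eqMixin (Maps s).
HB.instance Definition _ s := gen_choiceMixin (Maps s).

Definition Maps_ball (s : nat) (f : Maps s) (r eps : R) : set (Maps s) :=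
  [set g | forall c j,
     (sobolev_norm s r
        (fun x => (local_expr f c j x - local_expr g c j x)%R) <
      eps%:E)%E].

(** The H^s topology: generated by the balls of the H^s norms of the local
    expressions over the balls of radius [r] in all four charts. *)
HB.instance Definition _ s :=
  isSubBaseTopological.Build (Maps s)
    [set B | exists f r eps, [/\ 0 < r, 0 < eps & B = Maps_ball f r eps]] id.

(** Bijections of class H^s with inverse of class H^s; for [s] above 7/2 these
    are the C^1-diffeomorphisms of class H^s, an open subset of [Maps s]. *)
Definition Diff (s : nat) : set (Maps s) :=
  [set f : Maps s | exists g : Maps s, cancel f g /\ cancel g f].

End Manifold.

Arguments Diff R s : clear implicits.

(* Main.v *)
Require Import Defs.
From HB Require Import structures.
From mathcomp Require Import finmap.
From mathcomp Require Import all_boot all_order all_algebra.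
From mathcomp Require Import all_classical all_reals all_analysis.
From mathcomp Require Import measurable_realfun continuous_path ring lra zify.

Set Implicit Arguments.
Unset Strict Implicit.
Unset Printing Implicit Defensive.
Import Order.TTheory GRing.Theory Num.Theory.
Import numFieldNormedType.Exports.
Local Open Scope classical_set_scope.
Local Open Scope ring_scope.

(** Let unit imaginary quaternions x in S^2 act on q in S^3 by multiplication.
    The loops f_k(t) : (x, q) |-> (x, (cos th + sin th x) q), th = 2 pi k t,
    are based at the identity.  Fix q = 1 and parametrise S^2 by spherical
    coordinates (a, b): the S^3-component of f_k(t)(x(a, b), 1) is a map
    S^1 x S^2 -> S^3, whose degree is 2k up to sign.  A homotopy of loops in
    Diff gives a homotopy of such maps because H^5 embeds in C^0 in dimension 5, so that evaluation is
    continuous.  The degree is computed simplicially: points of S^3 on a fine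
    grid are labelled by an index and the sign of a large coordinate, nearby
    points never receive antipodal labels, and one counts the positively
    labelled tetrahedra of the Freudenthal triangulation with sign.  The Sobolev
    embedding is obtained by integrating by parts against mollifiers that are
    themselves derivatives of step functions, up to a smooth remainder. *)

(** * Discrete degree *)

(** The degree is 2k and not 0 because S^2 has even dimension: on the second half turn cos th + sin
    th x covers S^3 again through th |-> 2 pi - th and x |-> - x, two reversals whose signs cancel.
    Infinitude is read off pairwise non-homotopic loops, [pi1] being a mere set of classes. The
    counting cocycle is a determinant of indicator functions of the positive vertices. Off one
    vertex of the cross-polytope it has an explicit primitive of the same shape in one variable
    fewer, so the degree of the model loops descends from S^3 to S^2, to a circle, to a single arc.
    The Sobolev norm is built from weak derivatives picked by choice, so nothing about it can be
    computed, not even that the norm of 0 is 0, before weak derivatives are known to be unique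
    almost everywhere. The embedding only has to say that a small norm forces small values; it
    spends one derivative in each of the five directions, whence the order 5. *)

(* [(i, true)] and [(i, false)] are the vertices [e_i] and [- e_i] of the cross-polytope. *)
Definition label : Type := (nat * bool)%type.

Section Labels.

Definition pos_ind (j : nat) (l : label) : int := ((l == (j, true))%:R).
Notation p j l := (pos_ind j l).

Definition antipodal (l l' : label) := (l.1 == l'.1) && (l.2 != l'.2).

(* [co4 a b c d] is the sign of the permutation when the labels are the four positive
   vertices, and 0 otherwise; it is a cocycle on simplices without antipodal labels. *)
Definition co1 (a : label) : int := p 0%N a.
Definition co2 (a b : label) : int := p 0%N a * p 1%N b - p 1%N a * p 0%N b.
Definition co3 (a b c : label) : int :=
  p 2 a * co2 b c - p 2 b * co2 a c + p 2 c * co2 a b.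
Definition co4 (a b c d : label) : int :=
  - p 3 a * co3 b c d + p 3 b * co3 a c d - p 3 c * co3 a b d + p 3 d * co3 a b c.

Definition valid (s : seq label) :=
  all (fun l => (l.1 < 4)%N) s && all (fun l => all (fun l' => ~~ antipodal l l') s) s.

(** This drives the cocycle identities below: the [co] functions are determinants in the indicators
    [p j]. A positive vertex missing among the first n makes a row vanish. If all are present, the
    absence of antipodes rules out the remaining negative labels and the four indicators sum to 1,
    which lets one row be replaced by a row of ones. *)
Lemma pos_dichotomy n (s : seq label) : (n <= 4)%N -> valid s ->
  (forall i, (n <= i < 4)%N -> (i, false) \notin s) ->
  (exists2 j, (j < n)%N & {in s, forall l, p j l = 0}) \/
  {in s, forall l, p 3 l = 1 - p 0%N l - p 1%N l - p 2 l}.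
Proof.
move=> n4 /andP[/allP s4 /allP sa] sn.
have [/allP h|/allPn[j jn hj]] := boolP (all (fun j => (j, true) \in s) (iota 0 n)); last first.
  left; exists j; first by move: jn; rewrite mem_iota.
  move=> l ls; rewrite /pos_ind; case: eqP => // e; move: ls.
  by rewrite e (negbTE hj).
right=> -[i b] ls; have /= i4 := s4 _ ls.
case: b ls => ls; first by rewrite /pos_ind; move: i i4 ls => [|[|[|[|]]]].
exfalso; have [ni|ni] := leqP n i; first by have := sn i; rewrite ni i4 ls => /(_ isT).
have hi : (i, true) \in s by apply: h; rewrite mem_iota.
by have /allP/(_ _ ls) := sa _ hi; rewrite /antipodal /= eqxx.
Qed.

Ltac use_pos H := rewrite ?H ?inE ?eqxx ?orbT //; ring.

(** The alternating sum is, up to sign, a 5 by 5 determinant with rows [p 0], ..., [p 3] and a row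
    of ones. Either a row of indicators vanishes, or the ones are the sum of the other rows. *)
Lemma co4_closed a b c d e : valid [:: a; b; c; d; e] ->
  co4 b c d e - co4 a c d e + co4 a b d e - co4 a b c e + co4 a b c d = 0.
Proof.
move=> v; have [] := @pos_dichotomy 4 _ isT v; first by case=> [|[|[|[|]]]].
- by case=> [[|[|[|[|//]]]]] _ H; rewrite /co4 /co3 /co2; use_pos H.
- by move=> H; rewrite /co4 /co3 /co2; use_pos H.
Qed.

(** The cross-polytope without the vertex - e_3 is a cone with apex e_3, so the cocycle is a
    coboundary there. The primitive [- co3] comes from replacing the row of [p 3] by ones and
    expanding along it. *)
Lemma co4_exact a b c d : valid [:: a; b; c; d] -> (3, false) \notin [:: a; b; c; d] ->
  co4 a b c d = - (co3 b c d - co3 a c d + co3 a b d - co3 a b c).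
Proof.
move=> v n3; have [] := @pos_dichotomy 3 _ isT v; first by case=> [|[|[|[|]]]].
- by case=> [[|[|[|//]]]] _ H; rewrite /co4 /co3 /co2; use_pos H.
- by move=> H; rewrite /co4 /co3 /co2; use_pos H.
Qed.

Lemma pos_notin j l (s : seq label) : (j, true) \notin s -> l \in s -> p j l = 0.
Proof. by move=> h ls; rewrite /pos_ind; case: eqP ls => // ->; rewrite (negbTE h). Qed.

Lemma co3_exact a b c : valid [:: a; b; c] -> (2, false) \notin [:: a; b; c] ->
  (3, false) \notin [:: a; b; c] -> (3, true) \notin [:: a; b; c] ->
  co3 a b c = co2 b c - co2 a c + co2 a b.
Proof.
move=> v n2 n3 m3; have [] := @pos_dichotomy 2 _ isT v; first by case=> [|[|[|[|]]]].
- by case=> [[|[|//]]] _ H; rewrite /co3 /co2; use_pos H.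
- move=> H.
  have H2 l : l \in [:: a; b; c] -> p 2 l = 1 - p 0%N l - p 1%N l.
    by move=> ls; have := H _ ls; rewrite (pos_notin m3 ls); lia.
  by rewrite /co3 /co2; use_pos H2.
Qed.

(** The labels left are e_0, - e_0 and e_1, the vertices of an arc, on which winding is a difference
    of end values of [co1]. *)
Lemma co2_exact a b : valid [:: a; b] ->
  (forall i, (0 < i < 4)%N -> (i, false) \notin [:: a; b]) ->
  (forall i, (1 < i < 4)%N -> (i, true) \notin [:: a; b]) ->
  co2 a b = co1 a - co1 b.
Proof.
move=> v n m; have [] := @pos_dichotomy 1 _ isT v; first by move=> i; exact: n.
- by case=> [[|//]] _ H; rewrite /co2 /co1; use_pos H.
- move=> H.
  have H2 l : l \in [:: a; b] -> p 1%N l = 1 - p 0%N l.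
    by move=> ls; have := H _ ls; rewrite (pos_notin (m 2 isT) ls) (pos_notin (m 3 isT) ls); lia.
  by rewrite /co2 /co1; use_pos H2.
Qed.

Lemma co4_repeat12 a b c : co4 a a b c = 0. Proof. rewrite /co4 /co3 /co2; ring. Qed.
Lemma co4_repeat23 a b c : co4 a b b c = 0. Proof. rewrite /co4 /co3 /co2; ring. Qed.
Lemma co4_repeat34 a b c : co4 a b c c = 0. Proof. rewrite /co4 /co3 /co2; ring. Qed.
Lemma co3_repeat12 a b : co3 a a b = 0. Proof. rewrite /co3 /co2; ring. Qed.
Lemma co3_repeat23 a b : co3 a b b = 0. Proof. rewrite /co3 /co2; ring. Qed.

Lemma co4_missing j a b c d : (j < 4)%N -> (j, true) \notin [:: a; b; c; d] ->
  co4 a b c d = 0.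
Proof.
move=> j4 nj; have H l := @pos_notin j l _ nj.
by case: j j4 nj H => [|[|[|[|//]]]] _ _ H; rewrite /co4 /co3 /co2; use_pos H.
Qed.

Lemma co3_missing j a b c : (j < 3)%N -> (j, true) \notin [:: a; b; c] ->
  co3 a b c = 0.
Proof.
move=> j4 nj; have H l := @pos_notin j l _ nj.
by case: j j4 nj H => [|[|[|//]]] _ _ H; rewrite /co3 /co2; use_pos H.
Qed.

Lemma co2_missing j a b : (j < 2)%N -> (j, true) \notin [:: a; b] -> co2 a b = 0.
Proof.
move=> j4 nj; have H l := @pos_notin j l _ nj.
by case: j j4 nj H => [|[|//]] _ _ H; rewrite /co2; use_pos H.
Qed.

(* The Freudenthal triangulations. *)
Definition square3 (v : nat -> nat -> label) : int :=
  co3 (v 0 0) (v 1 0) (v 1 1) - co3 (v 0 0) (v 0 1) (v 1 1).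

Definition cube4 (v : nat -> nat -> nat -> label) : int :=
  let o := v 0 0 0 in let e := v 1 1 1 in
  co4 o (v 1 0 0) (v 1 1 0) e - co4 o (v 1 0 0) (v 1 0 1) e
  - co4 o (v 0 1 0) (v 1 1 0) e + co4 o (v 0 1 0) (v 0 1 1) e
  + co4 o (v 0 0 1) (v 1 0 1) e - co4 o (v 0 0 1) (v 0 1 1) e.

Definition d4 a b c d e :=
  co4 b c d e - co4 a c d e + co4 a b d e - co4 a b c e + co4 a b c d.

(** Every simplex of the Freudenthal triangulation of the 4-cube contains [v 0 0 0 0] and
    [v 1 1 1 1]. Its face opposite the first lies in a facet x_i = 1, its face opposite the second
    in a facet x_i = 0, and each other face is shared with the simplex of a transposed permutation,
    of opposite sign. *)
Lemma hypercube_boundary (v : nat -> nat -> nat -> nat -> label) :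
  (forall s, (forall l, l \in s -> exists x1 x2 x3 x4,
      [/\ (x1 <= 1)%N, (x2 <= 1)%N, (x3 <= 1)%N, (x4 <= 1)%N & l = v x1 x2 x3 x4]) ->
    valid s) ->
  (cube4 (fun x y z => v 1 x y z) - cube4 (fun x y z => v 0 x y z))
  - (cube4 (fun x y z => v x 1 y z) - cube4 (fun x y z => v x 0 y z))
  + (cube4 (fun x y z => v x y 1 z) - cube4 (fun x y z => v x y 0 z))
  - (cube4 (fun x y z => v x y z 1) - cube4 (fun x y z => v x y z 0)) = 0.
Proof.
move=> hv.
pose o := v 0 0 0 0; pose e := v 1 1 1 1.
pose D x y z := d4 o x y z e.
have D0 x1 x2 x3 x4 y1 y2 y3 y4 z1 z2 z3 z4 :
  all (fun i => (i <= 1)%N) [:: x1; x2; x3; x4; y1; y2; y3; y4; z1; z2; z3; z4] ->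
  D (v x1 x2 x3 x4) (v y1 y2 y3 y4) (v z1 z2 z3 z4) = 0.
  rewrite /= => /and5P[? ? ? ? /and5P[? ? ? ? /and5P[? ? ? ? _]]].
  apply: co4_closed; apply: hv => l; rewrite !inE => /orP[/eqP->|/orP[/eqP->|/orP[/eqP->|/orP[/eqP->|/eqP->]]]].
  - by exists 0, 0, 0, 0.
  - by exists x1, x2, x3, x4.
  - by exists y1, y2, y3, y4.
  - by exists z1, z2, z3, z4.
  - by exists 1, 1, 1, 1.
pose X a b c d a' b' c' d' a'' b'' c'' d'' := D (v a b c d) (v a' b' c' d') (v a'' b'' c'' d'').
(* The 24 terms are the maximal chains of the hypercube, one for each order in which the coordinates
   are raised, with the sign of that permutation. *)
have -> : (cube4 (fun x y z => v 1 x y z) - cube4 (fun x y z => v 0 x y z))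
  - (cube4 (fun x y z => v x 1 y z) - cube4 (fun x y z => v x 0 y z))
  + (cube4 (fun x y z => v x y 1 z) - cube4 (fun x y z => v x y 0 z))
  - (cube4 (fun x y z => v x y z 1) - cube4 (fun x y z => v x y z 0)) =
   X 1 0 0 0 1 1 0 0 1 1 1 0 - X 1 0 0 0 1 1 0 0 1 1 0 1
 - X 1 0 0 0 1 0 1 0 1 1 1 0 + X 1 0 0 0 1 0 1 0 1 0 1 1
 + X 1 0 0 0 1 0 0 1 1 1 0 1 - X 1 0 0 0 1 0 0 1 1 0 1 1
 - X 0 1 0 0 1 1 0 0 1 1 1 0 + X 0 1 0 0 1 1 0 0 1 1 0 1
 + X 0 1 0 0 0 1 1 0 1 1 1 0 - X 0 1 0 0 0 1 1 0 0 1 1 1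
 - X 0 1 0 0 0 1 0 1 1 1 0 1 + X 0 1 0 0 0 1 0 1 0 1 1 1
 + X 0 0 1 0 1 0 1 0 1 1 1 0 - X 0 0 1 0 1 0 1 0 1 0 1 1
 - X 0 0 1 0 0 1 1 0 1 1 1 0 + X 0 0 1 0 0 1 1 0 0 1 1 1
 + X 0 0 1 0 0 0 1 1 1 0 1 1 - X 0 0 1 0 0 0 1 1 0 1 1 1
 - X 0 0 0 1 1 0 0 1 1 1 0 1 + X 0 0 0 1 1 0 0 1 1 0 1 1
 + X 0 0 0 1 0 1 0 1 1 1 0 1 - X 0 0 0 1 0 1 0 1 0 1 1 1
 - X 0 0 0 1 0 0 1 1 1 0 1 1 + X 0 0 0 1 0 0 1 1 0 1 1 1.
  rewrite /X /D /d4 /o /e /cube4 /=; ring.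
by rewrite /X !D0.
Qed.

End Labels.

(** * Degree of a labelled grid, its homotopy invariance and its reduction to lower dimension *)

Definition deg3 (nt na nb : nat) (L : nat -> nat -> nat -> label) : int :=
  \sum_(0 <= t < nt) \sum_(0 <= a < na) \sum_(0 <= b < nb)
    cube4 (fun x y z => L (t + x)%N (a + y)%N (b + z)%N).

Definition deg2 (na nb : nat) (L : nat -> nat -> label) : int :=
  \sum_(0 <= a < na) \sum_(0 <= b < nb)
    square3 (fun x y => L (a + x)%N (b + y)%N).

Definition near_nat (n i j : nat) := [&& (i <= n)%N, (j <= n)%N, (i <= j.+1)%N & (j <= i.+1)%N].

(** The discrete substitute for continuity; it makes the vertex labels of every cell [valid]. *)
Definition tame4 (nu nt na nb : nat) (L : nat -> nat -> nat -> nat -> label) :=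
  (forall u t a b, (L u t a b).1 < 4)%N /\
  forall u u' t t' a a' b b', near_nat nu u u' -> near_nat nt t t' ->
    near_nat na a a' -> near_nat nb b b' -> ~~ antipodal (L u t a b) (L u' t' a' b').

Lemma near_cell n i x y : (i < n)%N -> (x <= 1)%N -> (y <= 1)%N -> near_nat n (i + x) (i + y).
Proof. rewrite /near_nat; lia. Qed.

(** Each chain raises the third coordinate exactly once, so each tetrahedron gets the same label
    twice. This kills the facets where the map is collapsed. *)
Lemma cube4_flat3 v : (forall x y z, v x y z = v x y 0) -> cube4 v = 0.
Proof.
by move=> h; rewrite /cube4 !(h _ _ 1) !co4_repeat12 !co4_repeat23 !co4_repeat34; ring.
Qed.

Lemma eq_cube4 v w : (forall x y z, (x <= 1)%N -> (y <= 1)%N -> (z <= 1)%N -> v x y z = w x y z) ->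
  cube4 v = cube4 w.
Proof. by move=> h; rewrite /cube4 !h. Qed.

Lemma sum_nat_eq0 n (F : nat -> int) : (forall i, (i < n)%N -> F i = 0) -> \sum_(0 <= i < n) F i = 0.
Proof. by move=> h; rewrite big_nat big1 // => i /andP[_]; exact: h. Qed.

(** Discrete Stokes: the hypercube identity is summed over the grid. The differences in u telescope
    to the claim, those in t and a to facets where the labels are independent of b and the cubes
    degenerate, those in b to zero by periodicity. *)
Lemma deg3_homotopy nu nt na nb L : tame4 nu nt na nb L ->
  (forall u a b, L u 0 a b = L u 0 0 0) ->
  (forall u a b, L u nt a b = L u nt 0 0) ->
  (forall u t b, L u t 0 b = L u t 0 0) ->
  (forall u t b, L u t na b = L u t na 0) ->
  (forall u t a, L u t a nb = L u t a 0) ->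
  deg3 nt na nb (L 0) = deg3 nt na nb (L nu).
Proof.
move=> [L4 LA] t0 t1 a0 a1 b1.
pose V u t a b := (fun x1 x2 x3 x4 => L (u + x1)%N (t + x2)%N (a + x3)%N (b + x4)%N).
pose F1 u t a b := cube4 (fun x y z => L u (t + x)%N (a + y)%N (b + z)%N).
pose F2 u t a b := cube4 (fun x y z => L (u + x)%N t (a + y)%N (b + z)%N).
pose F3 u t a b := cube4 (fun x y z => L (u + x)%N (t + y)%N a (b + z)%N).
pose F4 u t a b := cube4 (fun x y z => L (u + x)%N (t + y)%N (a + z)%N b).
have key u t a b : (u < nu)%N -> (t < nt)%N -> (a < na)%N -> (b < nb)%N ->
  (F1 u.+1 t a b - F1 u t a b) - (F2 u t.+1 a b - F2 u t a b)
  + (F3 u t a.+1 b - F3 u t a b) - (F4 u t a b.+1 - F4 u t a b) = 0.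
  move=> hu ht ha hb.
  have := @hypercube_boundary (V u t a b); rewrite /V /F1 /F2 /F3 /F4.
  rewrite !addn1 !addn0; apply => s hs; apply/andP; split; apply/allP.
    by move=> l /hs [x1 [x2 [x3 [x4 [_ _ _ _ ->]]]]]; exact: L4.
  move=> l /hs [x1 [x2 [x3 [x4 [? ? ? ? ->]]]]]; apply/allP.
  move=> l' /hs [y1 [y2 [y3 [y4 [? ? ? ? ->]]]]].
  by apply: LA; exact: near_cell.
have S : \sum_(0 <= u < nu) \sum_(0 <= t < nt) \sum_(0 <= a < na) \sum_(0 <= b < nb)
   ((F1 u.+1 t a b - F1 u t a b) - (F2 u t.+1 a b - F2 u t a b)
  + (F3 u t a.+1 b - F3 u t a b) - (F4 u t a b.+1 - F4 u t a b)) = 0.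
  by do 4![apply: sum_nat_eq0 => ? ?]; exact: key.
have E u : \sum_(0 <= t < nt) \sum_(0 <= a < na) \sum_(0 <= b < nb)
   ((F1 u.+1 t a b - F1 u t a b) - (F2 u t.+1 a b - F2 u t a b)
  + (F3 u t a.+1 b - F3 u t a b) - (F4 u t a b.+1 - F4 u t a b)) =
  deg3 nt na nb (L u.+1) - deg3 nt na nb (L u).
  rewrite /deg3.
  transitivity ((\sum_(0 <= t < nt) \sum_(0 <= a < na) \sum_(0 <= b < nb) F1 u.+1 t a b
    - \sum_(0 <= t < nt) \sum_(0 <= a < na) \sum_(0 <= b < nb) F1 u t a b)
    - \sum_(0 <= t < nt) \sum_(0 <= a < na) \sum_(0 <= b < nb) (F2 u t.+1 a b - F2 u t a b)
    + \sum_(0 <= t < nt) \sum_(0 <= a < na) \sum_(0 <= b < nb) (F3 u t a.+1 b - F3 u t a b)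
    - \sum_(0 <= t < nt) \sum_(0 <= a < na) \sum_(0 <= b < nb) (F4 u t a b.+1 - F4 u t a b)).
    rewrite -!(sumrB, big_split) /=; apply: eq_bigr => t _.
    rewrite -!(sumrB, big_split) /=; apply: eq_bigr => a _.
    by rewrite -!(sumrB, big_split) /=; apply: eq_bigr => b _.
  have -> : \sum_(0 <= t < nt) \sum_(0 <= a < na) \sum_(0 <= b < nb) (F2 u t.+1 a b - F2 u t a b) = 0.
    under eq_bigr do (under eq_bigr do rewrite sumrB; rewrite sumrB).
    rewrite (telescope_sumr (fun t => \sum_(0 <= a < na) \sum_(0 <= b < nb) F2 u t a b)) //.
    rewrite !sum_nat_eq0 // => a _; apply: sum_nat_eq0 => b _; apply: cube4_flat3 => x y z.
    - by rewrite t0 [RHS]t0.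
    - by rewrite t1 [RHS]t1.
  have -> : \sum_(0 <= t < nt) \sum_(0 <= a < na) \sum_(0 <= b < nb) (F3 u t a.+1 b - F3 u t a b) = 0.
    apply: sum_nat_eq0 => t _; under eq_bigr do rewrite sumrB.
    rewrite (telescope_sumr (fun a => \sum_(0 <= b < nb) F3 u t a b)) //.
    rewrite !sum_nat_eq0 // => b _; apply: cube4_flat3 => x y z.
    - by rewrite a0 [RHS]a0.
    - by rewrite a1 [RHS]a1.
  have -> : \sum_(0 <= t < nt) \sum_(0 <= a < na) \sum_(0 <= b < nb) (F4 u t a b.+1 - F4 u t a b) = 0.
    apply: sum_nat_eq0 => t _; apply: sum_nat_eq0 => a _.
    rewrite (telescope_sumr (F4 u t a)) // /F4.
    by apply/eqP; rewrite subr_eq0; apply/eqP/eq_cube4 => *; rewrite b1.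
  by rewrite /F1; ring.
move: S; under eq_bigr do rewrite E.
rewrite (telescope_sumr (fun u => deg3 nt na nb (L u))) // => /eqP.
by rewrite subr_eq0 => /eqP.
Qed.

Definition tame3 (nt na nb : nat) (L : nat -> nat -> nat -> label) :=
  (forall t a b, (L t a b).1 < 4)%N /\
  forall t t' a a' b b', near_nat nt t t' ->
    near_nat na a a' -> near_nat nb b b' -> ~~ antipodal (L t a b) (L t' a' b').

(** Inserting the primitive [- co3] into the six tetrahedra leaves only the triangles on the six
    faces of the cube. *)
Lemma cube4_boundary v : valid [seq v x.1 x.2.1 x.2.2 | x <-
   [:: (0,(0,0)); (0,(0,1)); (0,(1,0)); (0,(1,1)); (1,(0,0)); (1,(0,1)); (1,(1,0)); (1,(1,1))]%N] ->
  (forall x y z, (x <= 1)%N -> (y <= 1)%N -> (z <= 1)%N -> v x y z != (3, false)) ->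
  cube4 v = - ((square3 (fun y z => v 1 y z) - square3 (fun y z => v 0 y z))
   - (square3 (fun x z => v x 1 z) - square3 (fun x z => v x 0 z))
   + (square3 (fun x y => v x y 1) - square3 (fun x y => v x y 0))).
Proof.
move=> hv h3.
have hs s : {subset s <= [seq v x.1 x.2.1 x.2.2 | x <-
   [:: (0,(0,0)); (0,(0,1)); (0,(1,0)); (0,(1,1)); (1,(0,0)); (1,(0,1)); (1,(1,0)); (1,(1,1))]%N]} -> valid s.
  move=> ss; case/andP: hv => /allP h4 /allP ha; apply/andP; split; apply/allP => l /ss ls; first exact: h4.
  by apply/allP => l' /ss ls'; have /allP := ha _ ls; exact.
by rewrite /cube4 /square3 !co4_exact ?inE ?negb_or ?[_ == v _ _ _]eq_sym ?h3 //;
  [ring|..]; apply: hs => l; rewrite !inE => /orP[/eqP->|/orP[/eqP->|/orP[/eqP->|/eqP->]]];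
  rewrite ?eqxx ?orbT.
Qed.

Lemma sum_range_eq0 m n (F : nat -> int) : (forall i, (m <= i < n)%N -> F i = 0) ->
  \sum_(m <= i < n) F i = 0.
Proof. by move=> h; rewrite big_nat big1 // => i; exact: h. Qed.

Lemma valid_near (s : seq label) : (forall l, l \in s -> (l.1 < 4)%N) ->
  (forall l l', l \in s -> l' \in s -> ~~ antipodal l l') -> valid s.
Proof.
move=> h4 ha; apply/andP; split; apply/allP => l ls; first exact: h4.
by apply/allP => l' ls'; exact: ha.
Qed.

(** Where - e_3 does not occur the cocycle is a coboundary, so a slab contributes only its two end
    levels; the sides in a are degenerate and those in b cancel. *)
Lemma deg3_slab_exact nt na nb L t0 t1 : tame3 nt na nb L ->
  (t0 <= t1 <= nt)%N ->
  (forall t a b, (t0 <= t <= t1)%N -> (a <= na)%N -> (b <= nb)%N -> L t a b != (3, false)) ->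
  (forall t b, L t 0 b = L t 0 0) ->
  (forall t b, L t na b = L t na 0) ->
  (forall t a, L t a nb = L t a 0) ->
  \sum_(t0 <= t < t1) \sum_(0 <= a < na) \sum_(0 <= b < nb)
    cube4 (fun x y z => L (t + x)%N (a + y)%N (b + z)%N) =
  - (deg2 na nb (L t1) - deg2 na nb (L t0)).
Proof.
move=> [L4 LA] /andP[t01 t1n] h3 a0 a1 b1.
pose F1 t a b := square3 (fun y z => L t (a + y)%N (b + z)%N).
pose F2 t a b := square3 (fun x z => L (t + x)%N a (b + z)%N).
pose F3 t a b := square3 (fun x y => L (t + x)%N (a + y)%N b).
have key t a b : (t0 <= t < t1)%N -> (a < na)%N -> (b < nb)%N ->
  cube4 (fun x y z => L (t + x)%N (a + y)%N (b + z)%N) =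
  - ((F1 t.+1 a b - F1 t a b) - (F2 t a.+1 b - F2 t a b) + (F3 t a b.+1 - F3 t a b)).
  move=> /andP[ht0 ht1] ha hb; rewrite cube4_boundary.
  - by rewrite /F1 /F2 /F3 !addn0 !addn1.
  - apply: valid_near; first by move=> l /mapP[x _ ->]; exact: L4.
    move=> l l' /mapP[[x [y z]] hx ->] /mapP[[x' [y' z']] hx' ->] /=.
    have hh u v w : (u, (v, w)) \in [:: (0,(0,0)); (0,(0,1)); (0,(1,0)); (0,(1,1)); (1,(0,0)); (1,(0,1)); (1,(1,0)); (1,(1,1))]%N -> [/\ (u <= 1)%N, (v <= 1)%N & (w <= 1)%N].
      by rewrite !inE !xpair_eqE => h; split; move: h; lia.
    have [? ? ?] := hh _ _ _ hx; have [? ? ?] := hh _ _ _ hx'.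
    by apply: LA; apply: near_cell => //; lia.
  - by move=> x y z *; apply: h3; lia.
transitivity (\sum_(t0 <= t < t1) (deg2 na nb (L t) - deg2 na nb (L t.+1))); last first.
  rewrite (telescope_sumr_eq (fun t => - deg2 na nb (L t))) //; first by ring.
  by move=> k _; ring.
apply: eq_big_nat => t ht.
transitivity (\sum_(0 <= a < na) \sum_(0 <= b < nb)
  - ((F1 t.+1 a b - F1 t a b) - (F2 t a.+1 b - F2 t a b) + (F3 t a b.+1 - F3 t a b))).
  by apply: eq_big_nat => a ha; apply: eq_big_nat => b hb; exact: key.
transitivity ((\sum_(0 <= a < na) \sum_(0 <= b < nb) F1 t a b - \sum_(0 <= a < na) \sum_(0 <= b < nb) F1 t.+1 a b)
  + \sum_(0 <= a < na) \sum_(0 <= b < nb) (F2 t a.+1 b - F2 t a b)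
  - \sum_(0 <= a < na) \sum_(0 <= b < nb) (F3 t a b.+1 - F3 t a b)).
  rewrite -!(sumrB, big_split) /=; apply: eq_bigr => a _.
  by rewrite -!(sumrB, big_split) /=; apply: eq_bigr => b _; ring.
have -> : \sum_(0 <= a < na) \sum_(0 <= b < nb) (F2 t a.+1 b - F2 t a b) = 0.
  under eq_bigr do rewrite sumrB.
  rewrite (telescope_sumr (fun a => \sum_(0 <= b < nb) F2 t a b)) //.
  rewrite !sum_nat_eq0 // => b _; rewrite /F2 /square3 ?addn0.
  - by rewrite !(a0 _ b) !(a0 _ (b + 1)%N) !co3_repeat12 !co3_repeat23 subrr.
  - by rewrite !(a1 _ b) !(a1 _ (b + 1)%N) !co3_repeat12 !co3_repeat23 subrr.
have -> : \sum_(0 <= a < na) \sum_(0 <= b < nb) (F3 t a b.+1 - F3 t a b) = 0.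
  apply: sum_nat_eq0 => a _.
  rewrite (telescope_sumr (F3 t a)) // /F3 /square3 !b1.
  by rewrite subrr.
by rewrite /deg2 /F1; ring.
Qed.

Lemma deg3_slab_missing na nb L t0 t1 :
  (forall t a b, (t0 <= t <= t1)%N -> (a <= na)%N -> (b <= nb)%N -> L t a b != (3, true)) ->
  \sum_(t0 <= t < t1) \sum_(0 <= a < na) \sum_(0 <= b < nb)
    cube4 (fun x y z => L (t + x)%N (a + y)%N (b + z)%N) = 0.
Proof.
move=> h; apply: sum_range_eq0 => t ht; apply: sum_nat_eq0 => a ha; apply: sum_nat_eq0 => b hb.
rewrite /cube4 !(@co4_missing 3) //.
all: by rewrite !inE !negb_or ![(3, true) == _]eq_sym !h //; lia.
Qed.

Definition tame2 (na nb : nat) (L : nat -> nat -> label) :=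
  (forall a b, (L a b).1 < 4)%N /\
  forall a a' b b', near_nat na a a' -> near_nat nb b b' -> ~~ antipodal (L a b) (L a' b').

(** The winding number of a labelled path around the square with vertices e_0, e_1, - e_0, - e_1:
    edges from e_0 to e_1 count 1, edges back count - 1. *)
Definition deg1 (b0 b1 : nat) (L : nat -> label) := \sum_(b0 <= b < b1) co2 (L b) (L b.+1).

(** The same descent one dimension lower: away from - e_2, e_3 and - e_3 the primitive of [co3] is
    [co2], and a band contributes the winding numbers of its two boundary circles. *)
Lemma deg2_slab_exact na nb L a0 a1 : tame2 na nb L ->
  (a0 <= a1 <= na)%N ->
  (forall a b, (a0 <= a <= a1)%N -> (b <= nb)%N ->
     L a b \notin [:: (2, false); (3, false); (3, true)]) ->
  (forall a, L a nb = L a 0) ->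
  \sum_(a0 <= a < a1) \sum_(0 <= b < nb) square3 (fun x y => L (a + x)%N (b + y)%N) =
  deg1 0 nb (L a1) - deg1 0 nb (L a0).
Proof.
move=> [L4 LA] /andP[a01 a1n] h3 b1.
pose F1 a b := co2 (L a b) (L a b.+1).
pose F2 a b := co2 (L a b) (L a.+1 b).
have key a b : (a0 <= a < a1)%N -> (b < nb)%N ->
  square3 (fun x y => L (a + x)%N (b + y)%N) =
  (F1 a.+1 b - F1 a b) - (F2 a b.+1 - F2 a b).
  move=> /andP[ha0 ha1] hb; rewrite /square3 /F1 /F2 !addn0 !addn1.
  have vv s : all (fun x : nat * nat => (x.1 <= 1)%N && (x.2 <= 1)%N) s ->
     valid [seq L (a + x.1)%N (b + x.2)%N | x <- s].
    move=> /allP hs; apply: valid_near; first by move=> l /mapP[x _ ->]; exact: L4.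
    move=> l l' /mapP[x /hs/andP[? ?] ->] /mapP[x' /hs/andP[? ?] ->].
    by apply: LA; apply: near_cell => //; lia.
  have nn s (z : label) : all (fun x : nat * nat => (x.1 <= 1)%N && (x.2 <= 1)%N) s ->
     z \in [:: (2, false); (3, false); (3, true)] ->
     z \notin [seq L (a + x.1)%N (b + x.2)%N | x <- s].
    move=> /allP hs hz; apply/negP => /mapP[[x1 x2] /hs/andP[/= ? ?] e].
    have := @h3 (a + x1)%N (b + x2)%N; rewrite -e hz => h; suff: ~~ true by [].
    by apply: h; lia.
  have := vv [:: (0,0); (1,0); (1,1)]%N isT; have := vv [:: (0,0); (0,1); (1,1)]%N isT.
  have := fun z => nn [:: (0,0); (1,0); (1,1)]%N z isT; have := fun z => nn [:: (0,0); (0,1); (1,1)]%N z isT.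
  rewrite /= !addn0 !addn1 => n1 n2 v1 v2; rewrite !co3_exact //; first ring.
  1-6: by [apply: n1|apply: n2].
transitivity (\sum_(a0 <= a < a1) (deg1 0 nb (L a.+1) - deg1 0 nb (L a))); last first.
  by rewrite (telescope_sumr (fun t => deg1 0 nb (L t))).
apply: eq_big_nat => a ha.
transitivity (\sum_(0 <= b < nb) ((F1 a.+1 b - F1 a b) - (F2 a b.+1 - F2 a b))).
  by apply: eq_big_nat => b hb; exact: key.
rewrite sumrB [X in _ - X](_ : _ = 0); last first.
  by rewrite (telescope_sumr (F2 a)) // /F2 !b1 subrr.
by rewrite subr0 sumrB.
Qed.

Lemma deg2_slab_missing nb L a0 a1 :
  (forall a b, (a0 <= a <= a1)%N -> (b <= nb)%N -> L a b != (2, true)) ->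
  \sum_(a0 <= a < a1) \sum_(0 <= b < nb) square3 (fun x y => L (a + x)%N (b + y)%N) = 0.
Proof.
move=> h; apply: sum_range_eq0 => a ha; apply: sum_nat_eq0 => b hb.
rewrite /square3 !(@co3_missing 2) //.
all: by rewrite !inE !negb_or ![(2, true) == _]eq_sym !h //; lia.
Qed.

Lemma deg1_exact b0 b1 L : (b0 <= b1)%N ->
  (forall b, (b0 <= b < b1)%N -> valid [:: L b; L b.+1]) ->
  (forall b, (b0 <= b <= b1)%N -> L b = (0%N, true) \/ L b = (1%N, true)) ->
  L b0 = (0%N, true) -> L b1 = (1%N, true) ->
  deg1 b0 b1 L = 1.
Proof.
move=> b01 hv h e0 e1.
transitivity (\sum_(b0 <= b < b1) (co1 (L b) - co1 (L b.+1))).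
  apply: eq_big_nat => b /[dup] hb /andP[hb0 hb1]; apply: co2_exact; first exact: hv.
  - move=> i hi; rewrite !inE.
    by have [] := h b; rewrite ?hb0 ?(ltnW hb1) // => ->; have [] := h b.+1; rewrite ?(leqW hb0) ?hb1 // => ->; rewrite !xpair_eqE !andbF.
  - move=> i hi; rewrite !inE.
    by have [] := h b; rewrite ?hb0 ?(ltnW hb1) // => ->; have [] := h b.+1; rewrite ?(leqW hb0) ?hb1 // => ->; rewrite !xpair_eqE !andbT; lia.
rewrite (telescope_sumr_eq (fun b => - co1 (L b))) //; last by move=> k _; ring.
by rewrite e0 e1 /co1 /pos_ind.
Qed.

Lemma deg1_missing j b0 b1 L : (j < 2)%N -> (forall b, (b0 <= b <= b1)%N -> L b != (j, true)) ->
  deg1 b0 b1 L = 0.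
Proof.
move=> j2 h; apply: sum_range_eq0 => b hb; apply: (@co2_missing j) => //.
by rewrite !inE negb_or ![(j, true) == _]eq_sym !h //; lia.
Qed.

Lemma deg1_cat b0 b1 b2 L : (b0 <= b1)%N -> (b1 <= b2)%N ->
  deg1 b0 b2 L = deg1 b0 b1 L + deg1 b1 b2 L.
Proof. by move=> h1 h2; rewrite /deg1 (big_cat_nat h1 h2). Qed.

(** * Degree of the standard loops *)

Section Tucker.
Variable R : realType.
Implicit Types (y : nat -> R) (m : nat).

(* A unit vector of R^4 has a coordinate of absolute value at least 1/2, and changing a
   coordinate by less than 1 cannot take it from one side of ]-1/2, 1/2[ to the other. *)
Definition tucker y : label :=
  if 2^-1 <= `|y 0%N| then (0%N, 0 < y 0%N) else
  if 2^-1 <= `|y 1%N| then (1%N, 0 < y 1%N) else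
  if 2^-1 <= `|y 2| then (2, 0 < y 2) else (3, 0 < y 3).

Definition unit4 y := y 0%N ^+ 2 + y 1%N ^+ 2 + y 2 ^+ 2 + y 3 ^+ 2 = 1.

Let half1 : (2^-1 <= 1 :> R) = true.
Proof. by rewrite invf_le1 // ler1n. Qed.

Let half0 : (2^-1 <= 0 :> R) = false.
Proof. by rewrite invr_le0 lern0. Qed.

Lemma tucker_lt4 y : ((tucker y).1 < 4)%N.
Proof. by rewrite /tucker; do 3![case: ifP => // _]. Qed.

Lemma tucker_large y : unit4 y -> 2^-1 <= `|y (tucker y).1|.
Proof.
move=> uy; rewrite /tucker; case: (leP 2^-1 `|y 0%N|) => //= h0; case: (leP 2^-1 `|y 1%N|) => //= h1.
case: (leP 2^-1 `|y 2|) => //= h2.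
rewrite leNgt; apply/negP => h3.
have sq (z : R) : `|z| < 2^-1 -> z ^+ 2 < 4^-1.
  move=> hz; rewrite -real_normK ?num_real// -[4]/((2 * 2)%:R) natrM invfM -expr2.
  by rewrite ltrXn2r//= ?nnegrE ?invr_ge0.
have := sq _ h0; have := sq _ h1; have := sq _ h2; have := sq _ h3.
move: uy; rewrite /unit4; lra.
Qed.

Lemma tucker_sign y : (tucker y).2 = (0 < y (tucker y).1).
Proof. by rewrite /tucker; do 3![case: ifP => //= _]. Qed.

Lemma tucker_near y y' : unit4 y -> unit4 y' ->
  (forall i, (i < 4)%N -> `|y i - y' i| < 1) -> ~~ antipodal (tucker y) (tucker y').
Proof.
move=> /tucker_large h /tucker_large h' hn; apply/negP => /andP[/eqP e].
rewrite !tucker_sign -e in h' *; have := hn _ (tucker_lt4 y).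
move: (y _) (y' _) h h' => a b; rewrite ltr_norml !ler_normr => h h' /andP[? ?].
have [a0|a0] := ltrP 0 a; have [b0|b0] := ltrP 0 b => // _.
- by clear e; move: h h' => /orP[] ? /orP[] ?; lra.
- by clear e; move: h h' => /orP[] ? /orP[] ?; lra.
Qed.

(** A zero coordinate would also get the sign [false], but on a unit vector it is too small to be
    selected. *)
Lemma tucker_nneg i y : unit4 y -> 0 <= y i -> tucker y != (i, false).
Proof.
move=> uy hy; apply/eqP => e; have := tucker_large uy; have := tucker_sign y.
rewrite e /= => /esym/negbT; rewrite -leNgt => y0.
have -> : y i = 0 by apply/eqP; rewrite eq_le hy y0.
by rewrite normr0; lra.
Qed.

Lemma tucker_npos i y : y i <= 0 -> tucker y != (i, true).
Proof.
move=> hy; apply/eqP => e; have := tucker_sign y.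
by rewrite e /= => /esym; rewrite ltNge hy.
Qed.

(** A quarter turn is divided into m steps, so that the zeros of sine and cosine are grid points and
    every sign change of a coordinate falls on the border between two slabs. *)
Definition ang m (s : nat) : R := s%:R / m%:R * (pi / 2).

Lemma ang0 m : ang m 0 = 0. Proof. by rewrite /ang !mul0r. Qed.

Lemma ang_quarter m s : (0 < m)%N -> ang m (m + s)%N = ang m s + pi / 2.
Proof.
by move=> m0; rewrite /ang natrD !mulrDl divff ?pnatr_eq0 ?gtn_eqF // mul1r addrC.
Qed.

Lemma cos_ang_quarter m s : (0 < m)%N -> cos (ang m (m + s)%N) = - sin (ang m s).
Proof. by move=> m0; rewrite ang_quarter // cosDpihalf. Qed.

Lemma sin_ang_quarter m s : (0 < m)%N -> sin (ang m (m + s)%N) = cos (ang m s).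
Proof. by move=> m0; rewrite ang_quarter // sinDpihalf. Qed.

Lemma ang_first m s : (0 < m)%N -> (s <= m)%N -> 0 <= ang m s <= pi / 2.
Proof.
move=> m0 sm; have := pi_gt0 R => pi0; have m0' : 0 < m%:R :> R by rewrite ltr0n.
apply/andP; split; first by rewrite /ang !mulr_ge0 ?invr_ge0 ?ler0n // ltW.
rewrite /ang ler_piMl ?divr_ge0 ?ler0n ?(ltW pi0) //.
by rewrite ler_pdivrMr // mul1r ler_nat.
Qed.

Lemma cos_first m s : (0 < m)%N -> (s <= m)%N -> 0 <= cos (ang m s).
Proof.
move=> m0 sm; apply: cos_ge0_pihalf; have /andP[? ?] := ang_first m0 sm.
by apply/andP; split => //; have := pi_gt0 R; lra.
Qed.

Lemma sin_first m s : (0 < m)%N -> (s <= m)%N -> 0 <= sin (ang m s).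
Proof.
move=> m0 sm; apply: sin_ge0_pi; have /andP[? ?] := ang_first m0 sm.
by apply/andP; split => //; have := pi_gt0 R; lra.
Qed.

Definition sgn_trig m s q := match q with
  | 0%N => (0 <= cos (ang m s) :> R) /\ (0 <= sin (ang m s) :> R)
  | 1%N => (cos (ang m s) <= 0 :> R) /\ (0 <= sin (ang m s) :> R)
  | 2%N => (cos (ang m s) <= 0 :> R) /\ (sin (ang m s) <= 0 :> R)
  | _ => (0 <= cos (ang m s) :> R) /\ (sin (ang m s) <= 0 :> R)
  end.

Lemma trig_quadrant m s q : (0 < m)%N -> (q < 4)%N -> (q * m <= s <= q.+1 * m)%N -> sgn_trig m s q.
Proof.
move=> m0 q4 hs; have -> : (s = q * m + (s - q * m))%N by lia.
have hr : (s - q * m <= m)%N by lia.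
have c := cos_first m0 hr; have s' := sin_first m0 hr.
move: (s - q * m)%N hr c s' => r hr c s'.
rewrite /sgn_trig; case: q q4 hs => [|[|[|[|//]]]] _ _.
- by rewrite mul0n add0n.
- by rewrite mul1n cos_ang_quarter // sin_ang_quarter //; split; lra.
- by rewrite mulSn mul1n -addnA !(cos_ang_quarter, sin_ang_quarter) //; split; lra.
- rewrite mulSn -addnA mulSn mul1n -addnA.
  by rewrite !(cos_ang_quarter, sin_ang_quarter) //; split; lra.
Qed.

Lemma trig_value m : (0 < m)%N ->
  [/\ cos (ang m m) = 0 :> R, sin (ang m m) = 1 :> R,
      cos (ang m (2 * m)%N) = -1 :> R & sin (ang m (2 * m)%N) = 0 :> R] /\
  [/\ cos (ang m (3 * m)%N) = 0 :> R, sin (ang m (3 * m)%N) = -1 :> R,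
      cos (ang m (4 * m)%N) = 1 :> R & sin (ang m (4 * m)%N) = 0 :> R].
Proof.
move=> m0.
have e1 : cos (ang m m) = 0 :> R /\ sin (ang m m) = 1 :> R.
  by rewrite -[X in ang _ X]addn0 cos_ang_quarter // sin_ang_quarter // ang0 sin0 cos0 oppr0.
have e2 : cos (ang m (2 * m)%N) = -1 :> R /\ sin (ang m (2 * m)%N) = 0 :> R.
  by rewrite mulSn mul1n cos_ang_quarter // sin_ang_quarter // e1.1 e1.2.
have e3 : cos (ang m (3 * m)%N) = 0 :> R /\ sin (ang m (3 * m)%N) = -1 :> R.
  by rewrite mulSn cos_ang_quarter // sin_ang_quarter // e2.1 e2.2 oppr0.
have e4 : cos (ang m (4 * m)%N) = 1 :> R /\ sin (ang m (4 * m)%N) = 0 :> R.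
  by rewrite mulSn cos_ang_quarter // sin_ang_quarter // e3.1 e3.2 opprK.
by split; split; tauto.
Qed.

Lemma cos_ang_period m j s : (0 < m)%N -> cos (ang m (4 * j * m + s)%N) = cos (ang m s) :> R.
Proof.
move=> m0; elim: j => [|j IH]; first by rewrite muln0 mul0n.
have -> : (4 * j.+1 * m + s = m + (m + (m + (m + (4 * j * m + s)))))%N by lia.
by rewrite !(cos_ang_quarter, sin_ang_quarter) // opprK.
Qed.

Lemma sin_ang_period m j s : (0 < m)%N -> sin (ang m (4 * j * m + s)%N) = sin (ang m s) :> R.
Proof.
move=> m0; elim: j => [|j IH]; first by rewrite muln0 mul0n.
have -> : (4 * j.+1 * m + s = m + (m + (m + (m + (4 * j * m + s)))))%N by lia.
by rewrite !(cos_ang_quarter, sin_ang_quarter) // opprK.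
Qed.

(* The point [(sin th * x, cos th)] of the 3-sphere, where [x] has spherical coordinates [(al, be)]. *)
Definition suspend (th al be : R) (i : nat) : R := match i with
  | 0%N => sin th * (sin al * cos be)
  | 1%N => sin th * (sin al * sin be)
  | 2%N => sin th * cos al
  | _ => cos th end.

Lemma unit4_suspend th al be : unit4 (suspend th al be).
Proof.
have h1 := cos2Dsin2 th; have h2 := cos2Dsin2 al; have h3 := cos2Dsin2 be.
have {}h3 : cos be ^+ 2 = 1 - sin be ^+ 2 by lra.
have {}h2 : cos al ^+ 2 = 1 - sin al ^+ 2 by lra.
have {}h1 : cos th ^+ 2 = 1 - sin th ^+ 2 by lra.
by rewrite /unit4 /suspend !exprMn h1 h2 h3; ring.
Qed.

Section Degree.
Variables (k mt m : nat).
Hypotheses (mt0 : (0 < mt)%N) (m0 : (0 < m)%N).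

Definition labelling (t a b : nat) : label :=
  tucker (suspend (ang mt t) (ang m a) (ang m b)).

Hypothesis tameL : tame3 (4 * k * mt) (2 * m) (4 * m) labelling.

Let eq_label y y' : y 0%N = y' 0%N -> y 1%N = y' 1%N -> y 2 = y' 2 -> y 3 = y' 3 ->
  tucker y = tucker y'.
Proof. by rewrite /tucker => -> -> -> ->. Qed.

Lemma labelling_a0 t b : labelling t 0 b = labelling t 0 0.
Proof. by apply: eq_label; rewrite /suspend // ang0 sin0 !mul0r. Qed.

Lemma labelling_a1 t b : labelling t (2 * m) b = labelling t (2 * m) 0.
Proof.
by have [[_ _ _ s0] _] := trig_value m0; apply: eq_label; rewrite /suspend // s0 !mul0r.
Qed.

Lemma labelling_b1 t a : labelling t a (4 * m) = labelling t a 0.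
Proof.
have [_ [_ _ c s]] := trig_value m0; apply: eq_label; rewrite /suspend //.
- by rewrite c ang0 cos0.
- by rewrite s ang0 sin0.
Qed.

Let tame2L t : (t <= 4 * k * mt)%N -> tame2 (2 * m) (4 * m) (labelling t).
Proof.
have [h1 h2] := tameL; move=> ht; split => // a a' b b' ha hb.
by apply: h2 => //; rewrite /near_nat ht leqnSn.
Qed.

Let label_not i t a b : 0 <= suspend (ang mt t) (ang m a) (ang m b) i -> labelling t a b != (i, false).
Proof. by move=> h; apply: tucker_nneg => //; exact: unit4_suspend. Qed.

Let label_notp i t a b : suspend (ang mt t) (ang m a) (ang m b) i <= 0 -> labelling t a b != (i, true).
Proof. exact: tucker_npos. Qed.

Let quad1 b q : (q < 4)%N -> (q * m <= b <= q.+1 * m)%N -> sgn_trig m b q.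
Proof. exact: trig_quadrant. Qed.

Let valid1 t a b : (t <= 4 * k * mt)%N -> (a <= 2 * m)%N -> (b < 4 * m)%N ->
  valid [:: labelling t a b; labelling t a b.+1].
Proof.
move=> ht ha hb; have [h1 h2] := tameL.
apply: valid_near => l; first by rewrite !inE => /orP[/eqP->|/eqP->].
move=> l' ; rewrite !inE => /orP[/eqP->|/eqP->] /orP[/eqP->|/eqP->]; apply: h2;
  rewrite /near_nat; lia.
Qed.

(** The equator is sent to the unit circle at the angle b itself. Only the first quadrant can carry
    both e_0 and e_1; in each other quadrant one of them is missing. *)
Lemma deg1_equator_pos t : (t <= 4 * k * mt)%N -> sin (ang mt t) = 1 -> cos (ang mt t) = 0 ->
  deg1 0 (4 * m) (labelling t m) = 1.
Proof.
move=> ht st ct; have [[cm sm c2 s2] [c3 s3 c4 s4]] := trig_value m0.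
have sE i b : suspend (ang mt t) (ang m m) (ang m b) i =
   match i with 0%N => cos (ang m b) | 1%N => sin (ang m b) | _ => 0 end.
  by case: i => [|[|[|i]]]; rewrite /= ?st ?sm ?cm ?mul1r // mulr0.
rewrite (@deg1_cat 0 m) //; last by lia.
rewrite (@deg1_cat m (2 * m)) //; try lia.
rewrite (@deg1_missing 0 m (2 * m)) //; last first.
  move=> b hb; apply: label_notp; rewrite sE.
  by have [] := @quad1 b 1 isT _; first lia.
rewrite (@deg1_missing 1 (2 * m) (4 * m)) //; last first.
  move=> b hb; apply: label_notp; rewrite sE.
  have [h|h] := leqP b (3 * m).
    by have [] := @quad1 b 2 isT _; first lia.
  by have [] := @quad1 b 3 isT _; first lia.
rewrite !addr0; apply: deg1_exact => //.
- by move=> b hb; apply: valid1 => //; lia.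
- move=> b hb; have [cb sb] : sgn_trig m b 0 by apply: trig_quadrant => //; lia.
  have n i : labelling t m b != (i, false).
    by apply: label_not; rewrite sE; case: i => [|[|i]].
  have n2 : labelling t m b != (2, true) by apply: label_notp; rewrite sE.
  have n3 : labelling t m b != (3, true) by apply: label_notp; rewrite sE.
  have := tucker_lt4 (suspend (ang mt t) (ang m m) (ang m b)).
  move: (n 0%N) (n 1%N) (n 2) (n 3) n2 n3; rewrite -/(labelling t m b).
  by case: (labelling t m b) => [[|[|[|[|i]]]] []] //; [left|right].
- by rewrite /labelling /tucker !sE ang0 cos0 normr1 ltr01 half1.
- by rewrite /labelling /tucker !sE cm sm normr0 normr1 ltr01 half0 half1.
Qed.

(** The circle now starts at the antipode, so the arc from e_0 to e_1 is the third quadrant. The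
    winding number stays 1 because the antipodal map of a circle is a rotation. *)
Lemma deg1_equator_neg t : (t <= 4 * k * mt)%N -> sin (ang mt t) = -1 -> cos (ang mt t) = 0 ->
  deg1 0 (4 * m) (labelling t m) = 1.
Proof.
move=> ht st ct; have [[cm sm c2 s2] [c3 s3 c4 s4]] := trig_value m0.
have sE i b : suspend (ang mt t) (ang m m) (ang m b) i =
   match i with 0%N => - cos (ang m b) | 1%N => - sin (ang m b) | _ => 0 end.
  by case: i => [|[|[|i]]]; rewrite /= ?st ?sm ?cm ?mul1r ?mulN1r // oppr0.
rewrite (@deg1_cat 0 m) //; last by lia.
rewrite (@deg1_cat m (2 * m)) //; try lia.
rewrite (@deg1_cat (2 * m) (3 * m)) //; try lia.
rewrite (@deg1_missing 0 0 m) //; last first.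
  move=> b hb; apply: label_notp; rewrite sE oppr_le0.
  by have [] := @quad1 b 0 isT _; first lia.
rewrite (@deg1_missing 1 m (2 * m)) //; last first.
  move=> b hb; apply: label_notp; rewrite sE oppr_le0.
  by have [] := @quad1 b 1 isT _; first lia.
rewrite (@deg1_missing 0 (3 * m) (4 * m)) //; last first.
  move=> b hb; apply: label_notp; rewrite sE oppr_le0.
  by have [] := @quad1 b 3 isT _; first lia.
rewrite !add0r !addr0; apply: deg1_exact => //; try lia.
- by move=> b hb; apply: valid1 => //; lia.
- move=> b hb; have [cb sb] : sgn_trig m b 2 by apply: trig_quadrant => //; lia.
  have n i : labelling t m b != (i, false).
    by apply: label_not; rewrite sE; case: i => [|[|i]]; rewrite ?oppr_ge0.
  have n2 : labelling t m b != (2, true) by apply: label_notp; rewrite sE.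
  have n3 : labelling t m b != (3, true) by apply: label_notp; rewrite sE.
  have := tucker_lt4 (suspend (ang mt t) (ang m m) (ang m b)).
  move: (n 0%N) (n 1%N) (n 2) (n 3) n2 n3; rewrite -/(labelling t m b).
  by case: (labelling t m b) => [[|[|[|[|i]]]] []] //; [left|right].
- by rewrite /labelling /tucker !sE c2 opprK normr1 ltr01 half1.
- by rewrite /labelling /tucker !sE c3 s3 oppr0 opprK normr0 normr1 ltr01 half0 half1.
Qed.

Let third t a b : suspend (ang mt t) (ang m a) (ang m b) 3 = cos (ang mt t). Proof. by []. Qed.

Lemma deg2_pos t : (t <= 4 * k * mt)%N -> sin (ang mt t) = 1 -> cos (ang mt t) = 0 ->
  deg2 (2 * m) (4 * m) (labelling t) = 1.
Proof.
move=> ht st ct; have [[cm sm c2 s2] [c3 s3 c4 s4]] := trig_value m0.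
rewrite /deg2 (@big_cat_nat _ _ _ m) //=; last by lia.
rewrite [X in _ + X](_ : _ = 0) ?addr0; last first.
  apply: deg2_slab_missing => a b ha _; apply: label_notp; rewrite /= st mul1r.
  by have [] := @quad1 a 1 isT _; first lia.
rewrite (deg2_slab_exact (tame2L ht)); [|lia| |by move=> a; exact: labelling_b1].
  rewrite deg1_equator_pos // (@deg1_missing 0) ?subr0 // => b _.
  by apply: label_notp; rewrite /= ang0 sin0 mul0r mulr0.
move=> a b ha _; rewrite !inE !negb_or; apply/and3P; split.
- apply: label_not; rewrite /= st mul1r.
  by have [] := @quad1 a 0 isT _; first lia.
- by apply: label_not; rewrite /= ct.
- by apply: label_notp; rewrite /= ct.
Qed.

(** On S^2 the antipodal map reverses orientation: the cap where e_2 can occur is now a >= m, and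
    the equator enters as its lower end. *)
Lemma deg2_neg t : (t <= 4 * k * mt)%N -> sin (ang mt t) = -1 -> cos (ang mt t) = 0 ->
  deg2 (2 * m) (4 * m) (labelling t) = -1.
Proof.
move=> ht st ct; have [[cm sm c2 s2] [c3 s3 c4 s4]] := trig_value m0.
rewrite /deg2 (@big_cat_nat _ _ _ m) //=; last by lia.
rewrite [X in X + _](_ : _ = 0) ?add0r; last first.
  apply: deg2_slab_missing => a b ha _; apply: label_notp; rewrite /= st mulN1r oppr_le0.
  by have [] := @quad1 a 0 isT _; first lia.
rewrite (deg2_slab_exact (tame2L ht)); [|lia| |by move=> a; exact: labelling_b1].
  rewrite deg1_equator_neg // (@deg1_missing 0) ?sub0r // => b _.
  by apply: label_notp; rewrite /= s2 mul0r mulr0.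
move=> a b ha _; rewrite !inE !negb_or; apply/and3P; split.
- apply: label_not; rewrite /= st mulN1r oppr_ge0.
  by have [] := @quad1 a 1 isT _; first lia.
- by apply: label_not; rewrite /= ct.
- by apply: label_notp; rewrite /= ct.
Qed.

Lemma deg2_pole t : sin (ang mt t) = 0 -> deg2 (2 * m) (4 * m) (labelling t) = 0.
Proof.
move=> st; apply: deg2_slab_missing => a b _ _; apply: label_notp.
by rewrite /= st mul0r.
Qed.

(** Each turn is cut at the zeros of cos th, the last coordinate. The middle half turn misses e_3;
    the first quarter gives -(1 - 0) and the last one -(0 - (-1)), so a turn adds up to - 2. *)
Lemma deg3_labelling : deg3 (4 * k * mt) (2 * m) (4 * m) labelling = - (2 * k)%:R.
Proof.
(* The number of turns is generalised to some j <= k, while the tameness hypothesis keeps all k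
   turns. *)
have := leqnn k; rewrite /deg3; move: {1 3 4}k; elim => [|j IH] jk.
  by rewrite muln0 mul0n big_geq // muln0 oppr0.
have [[cm sm c2 s2] [c3 s3 c4 s4]] := trig_value mt0.
have cp s := @cos_ang_period mt j s mt0; have sp s := @sin_ang_period mt j s mt0.
have bound : (4 * j * mt + 4 * mt <= 4 * k * mt)%N by rewrite -mulnDl leq_mul2r; lia.
have -> : (4 * j.+1 * mt = 4 * j * mt + 4 * mt)%N by lia.
rewrite (@big_cat_nat _ _ _ (4 * j * mt)) ?leq_addr //= IH; last exact: ltnW.
rewrite (@big_cat_nat _ _ _ (4 * j * mt + mt)) /=; [|lia|lia].
rewrite (@big_cat_nat _ _ _ (4 * j * mt + 3 * mt) (4 * j * mt + mt)) /=; [|lia|lia].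
have cosq q t : (q < 4)%N -> (4 * j * mt + q * mt <= t <= 4 * j * mt + q.+1 * mt)%N ->
    sgn_trig mt (t - 4 * j * mt) q /\ cos (ang mt t) = cos (ang mt (t - 4 * j * mt)) :> R.
  move=> q4 ht; split.
    by apply: trig_quadrant => //; move: ht; move: (q * mt)%N (q.+1 * mt)%N (4 * j * mt)%N => x y z; lia.
  rewrite -(cp (t - _)%N) subnKC //; case/andP: ht => h _.
  exact: leq_trans (leq_addr _ _) h.
rewrite (deg3_slab_exact tameL); last 5 first.
- lia.
- move=> t a b ht _ _; apply: label_not; rewrite third.
  by have [|[? _] ->] := @cosq 0 t isT; first lia.
- exact: labelling_a0.
- exact: labelling_a1.
- exact: labelling_b1.
rewrite (deg3_slab_missing (t0 := (4 * j * mt + mt)%N)); last first.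
  move=> t a b ht _ _; apply: label_notp; rewrite third.
  have [h|h] := leqP t (4 * j * mt + 2 * mt).
    by have [|[? _] ->] := @cosq 1 t isT; first lia.
  by have [|[? _] ->] := @cosq 2 t isT; first lia.
rewrite (deg3_slab_exact tameL); last 5 first.
- lia.
- move=> t a b ht _ _; apply: label_not; rewrite third.
  by have [|[? _] ->] := @cosq 3 t isT; first lia.
- exact: labelling_a0.
- exact: labelling_a1.
- exact: labelling_b1.
have p0 : sin (ang mt (4 * j * mt)) = 0 :> R by have := sp 0%N; rewrite addn0 ang0 sin0.
have d1 : deg2 (2 * m) (4 * m) (labelling (4 * j * mt + mt)) = 1.
  by apply: deg2_pos; rewrite ?sp ?cp //; lia.
have d3 : deg2 (2 * m) (4 * m) (labelling (4 * j * mt + 3 * mt)) = -1.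
  by apply: deg2_neg; rewrite ?sp ?cp //; lia.
have d4 : deg2 (2 * m) (4 * m) (labelling (4 * j * mt + 4 * mt)) = 0.
  by apply: deg2_pole; rewrite sp.
by rewrite d1 d3 d4 (deg2_pole p0) !natrM -natr1; ring.
Qed.

End Degree.

End Tucker.

(** * Smooth functions *)

Section Smooth.
Context {R : realType} {V : normedModType R} {I : Type} (e : I -> V).
Implicit Types (f g : V -> R) (n : nat) (i : I).

(** The directions [e] are a parameter so that one theory serves the line, with the single direction
    1, and R^5 with its basis, where [dirs] is [partials]. *)
Definition dirs (l : seq I) f : V -> R := foldr (fun i g x => 'D_(e i) g x) f l.

Definition smooth f := forall l x, differentiable (dirs l f) x.

(** A graded version of [smooth]: the derivative of a product mixes the factors with their
    derivatives, so closure properties go by induction on the order. *)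
Fixpoint Cn n f : Prop := (forall x, differentiable f x) /\
  (if n is n'.+1 then forall i, Cn n' ('D_(e i) f) else True).

Lemma dirs_rcons l i f : dirs (rcons l i) f = dirs l ('D_(e i) f).
Proof. by rewrite /dirs -cats1 foldr_cat. Qed.

Lemma Cn_smooth f : (forall n, Cn n f) -> smooth f.
Proof.
move=> h l; elim/last_ind: l f h => [|l i IH] f h x; first by have [] := h 0%N.
by rewrite dirs_rcons; apply: IH => n; have [_] := h n.+1; exact.
Qed.

Lemma smooth_Cn f n : smooth f -> Cn n f.
Proof.
elim: n f => [|n IH] f h; split => //; try exact: (h [::]).
by move=> i; apply: IH => l; rewrite -dirs_rcons; exact: h.
Qed.

Lemma smooth_differentiable f x : smooth f -> differentiable f x.
Proof. by move/(_ [::]); exact. Qed.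

Lemma smooth_continuous f : smooth f -> continuous f.
Proof. by move=> h x; apply: differentiable_continuous; exact: smooth_differentiable. Qed.

Lemma smooth_derive f i : smooth f -> smooth ('D_(e i) f).
Proof. by move=> h l; rewrite -dirs_rcons; exact: h. Qed.

Lemma smooth_dirs f l : smooth f -> smooth (dirs l f).
Proof.
by elim: l f => //= i l IH f /IH; exact: smooth_derive.
Qed.

(** Coinduction in disguise; it spares closed forms for the higher derivatives. *)
Lemma smooth_class (S : (V -> R) -> Prop) f : S f ->
  (forall g, S g -> (forall x, differentiable g x) /\ forall i, S ('D_(e i) g)) ->
  smooth f.
Proof.
move=> Sf hS; apply: Cn_smooth => n; elim: n f Sf => [|n IH] f /hS[h1 h2]; split => //.
by move=> i; exact/IH/h2.
Qed.

Lemma CnW n f : Cn n.+1 f -> Cn n f.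
Proof. by elim: n f => [|n IH] f [h1 h2]; split => // i; exact/IH/h2. Qed.

Lemma Cn_cst n (c : R) : Cn n (cst c).
Proof.
elim: n c => [|n IH] c; split => // i.
rewrite (_ : 'D__ _ = cst 0); first exact: IH.
by apply/funext => x; rewrite derive_cst.
Qed.

Lemma CnD n f g : Cn n f -> Cn n g -> Cn n (fun x => f x + g x).
Proof.
elim: n f g => [|n IH] f g [f1 f2] [g1 g2]; split => //.
- by move=> x; exact: differentiableD.
- by move=> x; exact: differentiableD.
move=> i; rewrite (_ : 'D__ _ = fun x => 'D_(e i) f x + 'D_(e i) g x); first exact: (IH _ _ (f2 i) (g2 i)).
by apply/funext => x; rewrite deriveD //; exact: diff_derivable.
Qed.

Lemma CnM n f g : Cn n f -> Cn n g -> Cn n (fun x => f x * g x).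
Proof.
elim: n f g => [|n IH] f g; [move=> [f1 f2] [g1 g2]; split => //|].
  by move=> x; exact: differentiableM.
move=> /[dup] fn [f1 f2] /[dup] gn [g1 g2]; split; first by move=> x; exact: differentiableM.
move=> i; rewrite (_ : 'D__ _ = fun x => f x * 'D_(e i) g x + g x * 'D_(e i) f x).
  by apply: CnD; [exact: (IH _ _ (CnW fn) (g2 i))|exact: (IH _ _ (CnW gn) (f2 i))].
by apply/funext => x; rewrite deriveM //; exact: diff_derivable.
Qed.

Lemma CnV n f : (forall x, f x != 0) -> Cn n f -> Cn n (fun x => (f x)^-1).
Proof.
move=> f0; elim: n => [|n IH]; first by move=> [f1 f2]; split => // x; exact: differentiableV.
move=> /[dup] fn [f1 f2]; split; first by move=> x; exact: differentiableV.
have h := IH (CnW fn).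
move=> i; rewrite (_ : 'D__ _ = fun x => (-1) * (((f x)^-1 * (f x)^-1) * 'D_(e i) f x)).
  by apply: CnM; [exact: Cn_cst|]; exact: (CnM (CnM h h) (f2 i)).
apply/funext => x; rewrite deriveV //; last exact: diff_derivable.
by rewrite mulN1r scaleNr /GRing.scale /= -invfM expr2.
Qed.

Lemma smooth_cst (c : R) : smooth (cst c).
Proof. by apply: Cn_smooth => n; exact: Cn_cst. Qed.

Lemma smoothD f g : smooth f -> smooth g -> smooth (fun x => f x + g x).
Proof. by move=> hf hg; apply: Cn_smooth => n; apply: CnD; exact: smooth_Cn. Qed.

Lemma smoothM f g : smooth f -> smooth g -> smooth (fun x => f x * g x).
Proof. by move=> hf hg; apply: Cn_smooth => n; apply: CnM; exact: smooth_Cn. Qed.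

Lemma smoothV f : (forall x, f x != 0) -> smooth f -> smooth (fun x => (f x)^-1).
Proof. by move=> f0 hf; apply: Cn_smooth => n; apply: CnV => //; exact: smooth_Cn. Qed.

Lemma smoothZ c f : smooth f -> smooth (fun x => c * f x).
Proof. by move=> hf; apply: (@smoothM (cst c)) => //; exact: smooth_cst. Qed.

Lemma smoothN f : smooth f -> smooth (fun x => - f x).
Proof. by move=> /(smoothZ (-1)); under eq_fun do rewrite mulN1r. Qed.

Lemma smoothB f g : smooth f -> smooth g -> smooth (fun x => f x - g x).
Proof. by move=> hf /smoothN hg; exact: (smoothD hf hg). Qed.

Lemma smooth_sum n (F : 'I_n -> V -> R) : (forall j, smooth (F j)) ->
  smooth (fun x => \sum_(j < n) F j x).
Proof.
elim: n F => [|n IH] F h.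
  by rewrite (_ : (fun _ => _) = cst 0); [exact: smooth_cst|apply/funext => x; rewrite big_ord0].
under eq_fun do rewrite big_ord_recr /=.
by apply: smoothD => //; apply: IH => j; exact: h.
Qed.

Lemma smooth_prod n (F : 'I_n -> V -> R) : (forall j, smooth (F j)) ->
  smooth (fun x => \prod_(j < n) F j x).
Proof.
elim: n F => [|n IH] F h.
  by rewrite (_ : (fun _ => _) = cst 1); [exact: smooth_cst|apply/funext => x; rewrite big_ord0].
under eq_fun do rewrite big_ord_recr /=.
by apply: smoothM => //; apply: IH => j; exact: h.
Qed.

End Smooth.

(** * Composition with smooth functions of one variable *)

Section SmoothLine.
Context {R : realType}.
Notation smooth1 := (@smooth R R unit (fun=> 1)).
Notation Cn1 := (@Cn R R unit (fun=> 1)).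

Context {V : normedModType R} {I : Type} (e : I -> V).

Lemma Cn_comp n (h : R -> R) (f : V -> R) : Cn1 n h -> Cn e n f -> Cn e n (fun x => h (f x)).
Proof.
elim: n h => [|n IH] h.
  by move=> [h1 _] [f1 _]; split => // x; apply: (@differentiable_comp _ _ _ _ f h).
move=> [h1 h2] /[dup] fn [f1 f2]; split.
  by move=> x; apply: (@differentiable_comp _ _ _ _ f h).
move=> i; rewrite (_ : 'D__ _ = fun x => ('D_1 h) (f x) * 'D_(e i) f x).
  exact: (CnM (IH _ (h2 tt) (CnW fn)) (f2 i)).
apply/funext => x; rewrite deriveE; last by apply: (@differentiable_comp _ _ _ _ f h).
rewrite [X in 'd X _](_ : _ = h \o f) // diff_comp //=.
have lin y a : 'd h y a = a * 'd h y 1.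
  by rewrite -[in LHS](mulr1 a) -[in LHS]/(a *: (1 : R)) linearZ.
by rewrite lin -!deriveE // mulrC.
Qed.

Lemma smooth_comp (h : R -> R) (f : V -> R) : smooth1 h -> smooth e f -> smooth e (fun x => h (f x)).
Proof. by move=> hh hf; apply: Cn_smooth => n; apply: Cn_comp; exact: smooth_Cn. Qed.

End SmoothLine.

Local Notation smooth1 := (@smooth _ (Real_sort__canonical__normed_module_NormedModule _) unit (fun=> 1)).

(** * Flat functions and the smooth step *)

Section Flat.
Context {R : realType}.
Implicit Types (p : {poly R}) (x y : R).

Lemma poly_growth p : exists2 C, 0 <= C & exists n, forall y, 0 <= y -> `|p.[y]| <= C * (1 + y) ^+ n.
Proof.
elim/poly_ind: p => [|p c [C C0 [n h]]].
  by exists 0 => //; exists 0%N => y _; rewrite horner0 normr0 mul0r.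
exists (C + `|c|); first by rewrite addr_ge0.
exists n.+1 => y y0; rewrite hornerMXaddC.
have y1 : 1 <= 1 + y by rewrite lerDl.
apply: le_trans (ler_normD _ _) _; rewrite mulrDl lerD //.
  rewrite normrM exprSr mulrA ler_pM // ?h // ger0_norm // lerDr //.
by rewrite ler_peMr // exprn_ege1.
Qed.

(** This is the power n + 1 of 1 + y <= (n + 1)(1 + y / (n + 1)) <= (n + 1) exp (y / (n + 1)). The
    surplus factor 1 + y in the denominator yields, for y = 1/x, a bound linear in x. *)
Lemma expR_growth n y : 0 <= y -> (1 + y) ^+ n <= n.+1%:R ^+ n.+1 * expR y / (1 + y).
Proof.
move=> y0; have y1 : 0 < 1 + y by rewrite ltr_pwDl.
rewrite ler_pdivlMr // -exprSr.
have -> : y = n.+1%:R * (y / n.+1%:R) by rewrite mulrC divfK // pnatr_eq0.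
rewrite expRM_natl -exprMn lerXn2r ?nnegrE ?mulr_ge0 ?expR_ge0 ?ler0n //; first last.
  have := expR_ge1Dx (y / n.+1%:R) => h.
  apply: le_trans (ler_wpM2l (ler0n _ _) h); rewrite mulrDr mulr1 lerD2r.
  by rewrite ler1n.
by rewrite mulrC divfK ?pnatr_eq0 // ltW.
Qed.

(** The derivatives of exp(-1/x), extended by 0, all have this shape; the polynomial parameter makes
    the family stable under derivation. *)
Definition flat p x : R := if 0 < x then p.[x^-1] * expR (- x^-1) else 0.

Lemma flat_le p : exists2 C, 0 <= C & forall x, `|flat p x| <= C * `|x|.
Proof.
have [C C0 [n h]] := poly_growth p.
exists (C * n.+1%:R ^+ n.+1); first by rewrite mulr_ge0 // exprn_ge0.
move=> x; rewrite /flat; case: ifPn => x0; last by rewrite normr0 !mulr_ge0 // exprn_ge0.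
have y0 : 0 < x^-1 by rewrite invr_gt0.
rewrite normrM (ger0_norm (expR_ge0 _)) expRN ler_pdivrMr ?expR_gt0 //.
apply: le_trans (h _ (ltW y0)) _.
rewrite -!mulrA ler_wpM2l //.
apply: le_trans (expR_growth n (ltW y0)) _; rewrite -mulrA ler_wpM2l ?exprn_ge0 //.
rewrite mulrC ler_wpM2r ?expR_ge0 // gtr0_norm // -[leRHS]invrK lef_pV2 ?posrE ?ltr_pwDl //.
  by rewrite lerDr.
exact: ltW.
Qed.

Definition dflat p := 'X^2 * (p - p^`()).

Lemma flat_derive p x : is_derive x 1 (flat p) (flat (dflat p) x).
Proof.
have [x0|x0|->] := ltgtP x 0.
- have E : \near x, (cst 0) x = flat p x.
    near=> z; rewrite /flat ltNge ifF //; apply/negbTE; rewrite negbK ltW //.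
    by near: z; exact: lt_nbhsl.
  have -> : flat (dflat p) x = 0 by rewrite /flat ltNge (ltW x0).
  exact: (near_eq_is_derive E).
- have E : \near x, ((horner p \o GRing.inv) * (expR \o (fun y => - y^-1))) x = flat p x.
    near=> z; rewrite /flat ifT //.
    by near: z; exact: lt_nbhsr.
  apply: (near_eq_is_derive E).
  have xn : x != 0 by rewrite gt_eqF.
  have h1 : is_derive x 1 (GRing.inv : R -> R) (- x ^- 2).
    have := @is_deriveV _ id x 1 1 xn (is_derive_id _ _).
    by rewrite /GRing.scale /= mulr1.
  have h2 := is_derive1_comp (is_derive_poly p x^-1) h1.
  have h3 := @is_derive1_comp _ expR (fun y => - y^-1) x _ _ (is_derive_expR (- x^-1)) (is_deriveN h1).
  apply: (is_derive_eq (is_deriveM h2 h3)).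
  rewrite /flat x0 /dflat /GRing.scale /= hornerM hornerXn hornerD hornerN exprVn; ring.
(* At 0 the difference quotient is [flat ('X * p)], and the linear bound applied to it gives the
   limit 0. *)
- have C : (fun h : R => h^-1 *: (flat p (h *: 1 + 0) - flat p 0)) @ 0^' --> (0 : R).
    have [c c0 hc] := flat_le ('X * p).
    apply/cvgr0Pnorm_le => eps eps0.
    have d0 : 0 < eps / (c + 1) by rewrite divr_gt0 // ltr_pwDr.
    near=> h.
    have h0 : h != 0 by near: h; exact: nbhs_dnbhs_neq.
    have -> : h^-1 *: (flat p (h *: 1 + 0) - flat p 0) = flat ('X * p) h.
      rewrite /flat ltxx subr0 addr0 -[h *: 1]/(h * 1) mulr1 -[_ *: _]/(_ * _).
      by case: ifP => _; rewrite ?mulr0 // hornerM hornerX mulrA.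
    apply: le_trans (hc _) _.
    have hd : `|h| < eps / (c + 1).
      near: h; apply: cvg_within; apply/nbhs_ballP; exists (eps / (c + 1)) => //= z.
      by rewrite /ball /= sub0r normrN.
    apply: (@le_trans _ _ ((c + 1) * `|h|)); first by rewrite ler_wpM2r // lerDl.
    by rewrite mulrC -ler_pdivlMr ?ltW // ltr_pwDr.
  have -> : flat (dflat p) 0 = 0 by rewrite /flat ltxx.
  by apply: DeriveDef; [apply/cvg_ex; exists 0|exact: cvg_lim].
Unshelve. all: by end_near.
Qed.

Lemma flat_smooth p : smooth1 (flat p).
Proof.
apply: (smooth_class (S := fun g => exists q, g = flat q)); first by exists p.
move=> _ [q ->]; split.
  by move=> x; apply/derivable1_diffP; have [] := flat_derive q x.
move=> _; exists (dflat q); apply/funext => x.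
by have [_ ->] := flat_derive q x.
Qed.

Lemma flat1_ge0 x : 0 <= flat 1 x.
Proof. by rewrite /flat; case: ifP => // _; rewrite hornerC mul1r expR_ge0. Qed.

Lemma flat1_gt0 x : 0 < x -> 0 < flat 1 x.
Proof. by rewrite /flat => ->; rewrite hornerC mul1r expR_gt0. Qed.

Lemma flat1_eq0 x : x <= 0 -> flat 1 x = 0.
Proof. by rewrite /flat leNgt => /negbTE ->. Qed.

Lemma dflat1_ge0 x : 0 <= flat (dflat 1) x.
Proof.
rewrite /flat; case: ifP => // x0; rewrite mulr_ge0 ?expR_ge0 //.
by rewrite /dflat derivC subr0 mulr1 hornerXn exprn_ge0 // invr_ge0 ltW.
Qed.

Definition step x := flat 1 x / (flat 1 x + flat 1 (1 - x)).

Lemma smooth1_affine (a b : R) : smooth1 (fun x : R => a * x + b).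
Proof.
have hd g : (exists a b, g = (fun x => a * x + b)) -> forall x : R, is_derive x 1 g (g 1 - g 0).
  move=> [c [d ->]] x; rewrite mulr1 mulr0 add0r addrK.
  have := is_deriveD (is_deriveZ c (is_derive_id x (1 : R))) (is_derive_cst d x (1 : R)).
  by rewrite addr0 -[c *: 1]/(c * 1) mulr1.
apply: (smooth_class (S := fun g => exists a b, g = (fun x => a * x + b))).
  by exists a, b.
move=> g hg; split.
  by move=> x; apply/derivable1_diffP; have [] := hd _ hg x.
move=> _; exists 0, (g 1 - g 0); apply/funext => x; rewrite mul0r add0r.
by have [_ ->] := hd _ hg x.
Qed.

Lemma step_den x : 0 < flat 1 x + flat 1 (1 - x).
Proof.
have [x0|x0] := ltP 0 x; first by rewrite ltr_pwDl ?flat1_gt0 ?flat1_ge0.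
by rewrite ltr_wpDl ?flat1_gt0 ?flat1_ge0 //; lra.
Qed.

Lemma smooth1_comp (h f : R -> R) : smooth1 h -> smooth1 f -> smooth1 (fun x => h (f x)).
Proof. exact: smooth_comp. Qed.

Lemma step_smooth : smooth1 step.
Proof.
apply: smoothM; first exact: flat_smooth.
apply: smoothV; first by move=> x; rewrite gt_eqF // step_den.
apply: smoothD; first exact: flat_smooth.
apply: (smooth1_comp (flat_smooth 1)).
rewrite (_ : (fun x => _) = (fun x => (-1) * x + 1)); first exact: smooth1_affine.
by apply/funext => x; lra.
Qed.

Lemma step_ge0 x : 0 <= step x.
Proof. by rewrite divr_ge0 ?flat1_ge0 // ltW // step_den. Qed.

Lemma step_le1 x : step x <= 1.
Proof. by rewrite ler_pdivrMr ?step_den // mul1r lerDl flat1_ge0. Qed.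

Lemma step_eq0 x : x <= 0 -> step x = 0.
Proof. by move=> x0; rewrite /step flat1_eq0 // mul0r. Qed.

Lemma step_eq1 x : 1 <= x -> step x = 1.
Proof.
move=> x1; rewrite /step (@flat1_eq0 (1 - x)) ?subr_le0 // addr0 divff // gt_eqF //.
by rewrite flat1_gt0 // (lt_le_trans ltr01).
Qed.

(** Monotonicity makes the rescaled derivatives of the step nonnegative mollifiers. The terms left
    by the quotient rule are products of nonnegative functions, since [dflat 1] is ['X^2]. *)
Lemma step_derive_ge0 x : 0 <= 'D_1 step x.
Proof.
have hB : is_derive x 1 (fun y => 1 - y : R) (-1).
  have := is_deriveD (is_derive_cst (1 : R) x (1 : R)) (is_deriveN (is_derive_id x (1 : R))).
  by rewrite add0r.
have h2 := @is_derive1_comp _ (flat 1) (fun y => 1 - y) x _ _ (flat_derive 1 (1 - x)) hB.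
have h3 := is_deriveD (flat_derive 1 x) h2.
have d0 : (flat 1 + (flat 1 \o (fun y => 1 - y))) x != 0 by rewrite gt_eqF // step_den.
have h4 := is_deriveM (flat_derive 1 x) (is_deriveV d0 h3).
have [_ e4] := h4; rewrite (e4 : 'D_1 step x = _).
rewrite /GRing.scale /=.
set u := flat 1 x; set v := flat 1 (1 - x); set u' := flat _ x; set v' := flat (dflat 1) (1 - x).
have u0 : 0 <= u by exact: flat1_ge0.
have v0 : 0 <= v by exact: flat1_ge0.
have u'0 : 0 <= u' by exact: dflat1_ge0.
have v'0 : 0 <= v' by exact: dflat1_ge0.
have uv : 0 < u + v by exact: step_den.
have -> : u * (- (u + v) ^- 2 * (u' + v' * -1)) + (u + v)^-1 * u' =
   (u * v' + v * u') / (u + v) ^+ 2 by field; rewrite gt_eqF.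
by rewrite divr_ge0 ?exprn_ge0 ?(ltW uv) // addr_ge0 // mulr_ge0.
Qed.

End Flat.

(** * Measurability of continuous functions on R^5 *)

Section ContinuousMeasurable.
Variable R : realType.

Lemma measurable_countable_factor d (T : measurableType d) (K : countType) (h : T -> K) (g : K -> R) :
  (forall k, measurable (h @^-1` [set k])) -> measurable_fun setT (g \o h).
Proof.
move=> mh _ Y mY; rewrite setTI.
rewrite (_ : _ @^-1` _ = \bigcup_(k in [set k | Y (g k)]) (h @^-1` [set k])); last first.
  by apply/seteqP; split => [x Yx|x [k /= Yk hk]]; [by exists (h x)|by rewrite hk].
rewrite bigcup_mkcond; apply: countable_bigcupT_measurable; first exact: countableP.
by move=> k; case: ifP.
Qed.

Definition cell (n : nat) (x : R) : int := Num.floor (n.+1%:R * x).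
Definition corner (n : nat) (z : int) : R := z%:~R / n.+1%:R.

Lemma measurable_cell n z : measurable (cell n @^-1` [set z] : set R).
Proof.
rewrite (_ : _ @^-1` _ = `[z%:~R / n.+1%:R, (z + 1)%:~R / n.+1%:R[%classic); first exact: measurable_itv.
apply/seteqP; split => x /=; rewrite in_itv /= /cell ler_pdivrMr ?ltr0n // ltr_pdivlMr ?ltr0n // [x * _]mulrC.
  by move=> <-; exact: floor_itv.
by move=> /andP[h1 h2]; apply: floor_def; rewrite h1 h2.
Qed.

Lemma corner_cell_cvg (x : R) : (fun n => corner n (cell n x)) @ \oo --> x.
Proof.
have h n : `|x - corner n (cell n x)| <= n.+1%:R^-1.
  have n0 : 0 < n.+1%:R :> R by rewrite ltr0n.
  rewrite /corner /cell.
  have -> : x - (Num.floor (n.+1%:R * x))%:~R / n.+1%:R = (n.+1%:R * x - (Num.floor (n.+1%:R * x))%:~R) / n.+1%:R.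
    by rewrite mulrBl [_ * x]mulrC mulfK // gt_eqF.
  rewrite normrM (gtr0_norm (_ : 0 < n.+1%:R^-1)) ?invr_gt0 //.
  rewrite ler_piMl ?invr_ge0 ?ltW // ger0_norm ?subr_ge0 ?floor_le //.
  by have /andP[_] := floor_itv (n.+1%:R * x); rewrite intrD; lra.
apply/cvgrPdist_le => eps eps0; near=> n.
apply: le_trans (h n) _.
rewrite invf_ple ?posrE ?ltr0n //.
near: n; exists (Num.bound (eps^-1)) => // n /= hn.
apply: (@le_trans _ _ (Num.bound eps^-1)%:R); last by rewrite ler_nat leqW.
by apply/ltW/archi_boundP; rewrite invr_ge0 ltW.
Unshelve. all: by end_near.
Qed.

Local Notation R5 := (R5 R).
Definition cell5 n (x : R5) : int * int * int * int * int :=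
  let: (x0, x1, x2, x3, x4) := x in (cell n x0, cell n x1, cell n x2, cell n x3, cell n x4).
Definition corner5 n (z : int * int * int * int * int) : R5 :=
  let: (x0, x1, x2, x3, x4) := z in (corner n x0, corner n x1, corner n x2, corner n x3, corner n x4).

Lemma measurable_cell5 n z : measurable (cell5 n @^-1` [set z] : set R5).
Proof.
case: z => [[[[z0 z1] z2] z3] z4].
rewrite (_ : _ @^-1` _ = (cell n @^-1` [set z0]) `*` (cell n @^-1` [set z1]) `*` (cell n @^-1` [set z2])
   `*` (cell n @^-1` [set z3]) `*` (cell n @^-1` [set z4])).
  have m z := measurable_cell n z.
  exact: (measurableX (measurableX (measurableX (measurableX (m z0) (m z1)) (m z2)) (m z3)) (m z4)).
apply/seteqP; split => -[[[[x0 x1] x2] x3] x4] /=; first by case.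
by move=> [[[[-> ->] ->] ->] ->].
Qed.

Lemma cvg_pair_seq (U W : topologicalType) (f : nat -> U) (g : nat -> W) (a : U) (b : W) :
  f @ \oo --> a -> g @ \oo --> b -> (fun n => (f n, g n)) @ \oo --> (a, b).
Proof. by move=> fa gb; apply: cvg_pair. Qed.

Lemma corner_cell5_cvg (x : R5) : (fun n => corner5 n (cell5 n x)) @ \oo --> x.
Proof.
case: x => [[[[x0 x1] x2] x3] x4] /=.
have c := corner_cell_cvg.
exact: (cvg_pair_seq (cvg_pair_seq (cvg_pair_seq (cvg_pair_seq (c x0) (c x1)) (c x2)) (c x3)) (c x4)).
Qed.

(** R^5 carries a product sigma-algebra, so the link with open sets is made by approximation: f is
    the pointwise limit of functions constant on the countably many boxes of side 1/(n+1). *)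
Lemma continuous_measurable5 (f : R5 -> R) : continuous f -> measurable_fun setT f.
Proof.
move=> cf; apply: (@measurable_fun_cvg _ _ _ _ (fun n => (f \o corner5 n) \o cell5 n)).
  move=> n; apply: measurable_countable_factor => z; exact: measurable_cell5.
by move=> x _; apply: (continuous_cvg _ (cf x)); exact: corner_cell5_cvg.
Qed.

End ContinuousMeasurable.

(** * Integration by parts *)

Section Dominated.
Context d (T : measurableType d) (R : realType).

(** Conditions that pass to the slices of a function on a product, so that Fubini can be iterated
    one variable at a time. *)
Definition dominated (m : {measure set T -> \bar R}) (A : set T) (f : T -> R) :=
  [/\ measurable_fun setT f, measurable A, (m A < +oo)%E,
      exists M, forall x, `|f x| <= M & forall x, ~ A x -> f x = 0].

Lemma integrable_extend0 (m : {measure set T -> \bar R}) A (f : T -> R) : measurable A ->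
  m.-integrable A (EFin \o f) -> (forall x, ~ A x -> f x = 0) -> m.-integrable setT (EFin \o f).
Proof.
move=> mA fi f0; rewrite (_ : EFin \o f = (EFin \o f) \_ A); last first.
  apply/funext => x; rewrite patchE; case: ifPn => // /negP; rewrite inE => xA /=.
  by rewrite f0.
exact/(integrable_mkcond _ mA).
Qed.

Lemma dominated_integrable m A f : dominated m A f -> m.-integrable setT (EFin \o f).
Proof.
move=> [mf mA Aoo [M hM] f0].
apply: (integrable_extend0 mA) => //; apply: measurable_bounded_integrable => //.
  exact: measurable_funTS.
exists M; split; first exact: num_real.
by move=> x Mx y _ /=; apply: le_trans (hM y) _; exact: ltW.
Qed.
End Dominated.
Arguments dominated {d T R}.

Section ProductSigmaFinite.
Context d1 d2 (T1 : measurableType d1) (T2 : measurableType d2) (R : realType).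
Variables (m1 : {sigma_finite_measure set T1 -> \bar R}) (m2 : {sigma_finite_measure set T2 -> \bar R}).

(* The canonical sigma-finite structure on [m1 \x m2] in the library is the one
   of products of subprobabilities, hence this copy of the product. *)
Definition sf_prod := (m1 \x m2)%E.

HB.instance Definition _ := Measure.on sf_prod.

Lemma sf_prod_sigma_finite : sigma_finite setT sf_prod.
Proof.
have [F TF Foo] := sigma_finiteT m1; have [G TG Goo] := sigma_finiteT m2.
pose c n := odflt (0%N, 0%N) (unpickle n).
exists (fun n => F (c n).1 `*` G (c n).2).
  apply/seteqP; split => // -[x y] _.
  have : setT x by []. have : setT y by [].
  rewrite TG => -[j _ Gy]; rewrite TF => -[i _ Fx].
  by exists (pickle (i, j)) => //; rewrite /c pickleK.
move=> n; have [? ?] := Foo (c n).1; have [? ?] := Goo (c n).2; split; first exact: measurableX.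
by rewrite /sf_prod product_measure1E // lte_mul_pinfty // ge0_fin_numE.
Qed.

HB.instance Definition _ := Measure_isSigmaFinite.Build _ _ _ sf_prod sf_prod_sigma_finite.
End ProductSigmaFinite.

Section Fubini0.
Context d1 d2 (T1 : measurableType d1) (T2 : measurableType d2) (R : realType).
Variables (m1 : {sigma_finite_measure set T1 -> \bar R}) (m2 : {sigma_finite_measure set T2 -> \bar R}).
Variables (A : set T1) (B : set T2).
Hypotheses (mA : measurable A) (mB : measurable B) (Aoo : (m1 A < +oo)%E) (Boo : (m2 B < +oo)%E).
Implicit Type f : T1 * T2 -> R.

Lemma finite_product : ((m1 \x m2)%E (A `*` B) < +oo)%E.
Proof. by rewrite product_measure1E // lte_mul_pinfty // ge0_fin_numE. Qed.

Lemma dominated_fst f y : dominated (m1 \x m2)%E (A `*` B) f -> dominated m1 A (fun x => f (x, y)).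
Proof.
move=> [mf _ _ [M hM] f0]; split => //; first exact: measurable_fun_pair1.
- by exists M.
- by move=> x xA; rewrite f0 // => -[].
Qed.

Lemma integral_eq0_fst f : dominated (m1 \x m2)%E (A `*` B) f ->
  (forall y, \int[m1]_x (f (x, y))%:E = 0)%E -> (\int[m1 \x m2]_z (f z)%:E = 0)%E.
Proof.
move=> /dominated_integrable fi f0.
by rewrite -integral21_prod_meas1 // integral0_eq // => y _; exact: f0.
Qed.

Lemma integral_eq0_snd f : dominated (m1 \x m2)%E (A `*` B) f ->
  (forall x, \int[m2]_y (f (x, y))%:E = 0)%E -> (\int[m1 \x m2]_z (f z)%:E = 0)%E.
Proof.
move=> /dominated_integrable fi f0.
by rewrite -integral12_prod_meas1 // integral0_eq // => y _; exact: f0.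
Qed.
End Fubini0.

(** * Boxes and Lebesgue measure on R^5 *)

Section ByParts.
Variable R : realType.
Local Notation R5 := (R5 R).
Local Notation mu := (@lebesgue_measure R).
Local Notation lebesgue5 := (@lebesgue5 R).

Definition seg (r : R) : set R := `[- r, r]%classic.
Definition box (r : R) : set R5 := seg r `*` seg r `*` seg r `*` seg r `*` seg r.

Lemma measurable_seg r : measurable (seg r). Proof. exact: measurable_itv. Qed.

Lemma seg_finite r : (mu (seg r) < +oo)%E.
Proof. by rewrite lebesgue_measure_itv /= lte_fin; case: ifP => // _; rewrite -EFinD ltry. Qed.

Lemma compact_box r : compact (box r).
Proof.
have h : compact (seg r) by exact: segment_compact.
exact: (compact_setX (compact_setX (compact_setX (compact_setX h h) h) h) h).
Qed.

Lemma compact_sub_box (K : set R5) : compact K -> exists2 r, 0 < r & K `<=` box r.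
Proof.
move=> /compact_bounded [M [_ hM]]; exists (`|M| + 1); first by rewrite ltr_pwDr.
have h := hM (`|M| + 1); move=> x /h; rewrite (le_lt_trans (ler_norm M)) ?ltrDl //.
move=> /(_ isT); case: x => [[[[x0 x1] x2] x3] x4] /=.
rewrite prod_normE /= prod_normE /= prod_normE /= prod_normE /= !ge_max.
by rewrite /box /seg /= !in_itv /= -!ler_norml => /andP[/andP[/andP[/andP[-> ->] ->] ->] ->].
Qed.

Lemma continuous_box_bounded (f : R5 -> R) r : continuous f -> (forall x, ~ box r x -> f x = 0) ->
  exists M, forall x, `|f x| <= M.
Proof.
move=> cf f0.
have : compact (f @` box r).
  by apply: continuous_compact; [exact: continuous_subspaceT|exact: compact_box].
move=> /compact_bounded [M [_ hM]]; exists (`|M| + 1) => x.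
have [xb|xb] := pselect (box r x); last by rewrite f0 // normr0 addr_ge0.
by apply: (hM (`|M| + 1)); [rewrite (le_lt_trans (ler_norm M)) ?ltrDl|exists x].
Qed.

(** Lebesgue measure is rebuilt factor by factor with sigma-finite structures; [lebesgue5] is
    convertible to the product of [m4] and [mu]. *)
Definition m2 := sf_prod mu mu.
HB.instance Definition _ := SigmaFiniteMeasure.on m2.
Definition m3 := sf_prod m2 mu.
HB.instance Definition _ := SigmaFiniteMeasure.on m3.
Definition m4 := sf_prod m3 mu.
HB.instance Definition _ := SigmaFiniteMeasure.on m4.

Local Notation b2 r := (seg r `*` seg r).
Local Notation b3 r := (seg r `*` seg r `*` seg r).
Local Notation b4 r := (seg r `*` seg r `*` seg r `*` seg r).

Lemma measurable_b2 r : measurable (b2 r).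
Proof. by apply: measurableX; exact: measurable_seg. Qed.
Lemma measurable_b3 r : measurable (b3 r).
Proof. by apply: measurableX; [exact: measurable_b2|exact: measurable_seg]. Qed.
Lemma measurable_b4 r : measurable (b4 r).
Proof. by apply: measurableX; [exact: measurable_b3|exact: measurable_seg]. Qed.
Lemma measurable_box r : measurable (box r).
Proof. by apply: measurableX; [exact: measurable_b4|exact: measurable_seg]. Qed.
Lemma b2_finite r : (m2 (b2 r) < +oo)%E.
Proof. exact: (finite_product (m1 := mu) (m2 := mu) (measurable_seg r) (measurable_seg r) (seg_finite r) (seg_finite r)). Qed.
Lemma b3_finite r : (m3 (b3 r) < +oo)%E.
Proof. exact: (finite_product (m1 := m2) (m2 := mu) (measurable_b2 r) (measurable_seg r) (b2_finite r) (seg_finite r)). Qed.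
Lemma b4_finite r : (m4 (b4 r) < +oo)%E.
Proof. exact: (finite_product (m1 := m3) (m2 := mu) (measurable_b3 r) (measurable_seg r) (b3_finite r) (seg_finite r)). Qed.
Lemma box_finite r : (lebesgue5 (box r) < +oo)%E.
Proof. exact: (finite_product (m1 := m4) (m2 := mu) (measurable_b4 r) (measurable_seg r) (b4_finite r) (seg_finite r)). Qed.

Lemma continuous_dominated (f : R5 -> R) r : continuous f -> (forall x, ~ box r x -> f x = 0) ->
  dominated lebesgue5 (box r) f.
Proof.
move=> cf f0; split => //.
- exact: continuous_measurable5.
- exact: measurable_box.
- exact: box_finite.
- exact: continuous_box_bounded cf f0.
Qed.

End ByParts.

Section ByParts.
Variable R : realType.
Local Notation R5 := (R5 R).
Local Notation mu := (@lebesgue_measure R).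
Local Notation lebesgue5 := (@lebesgue5 R).

Lemma integral_derive_line (g : R -> R) r : 0 < r -> (forall t : R, derivable g t 1) ->
  continuous ('D_1 g) -> (forall t, ~ seg r t -> g t = 0) ->
  (\int[mu]_t ('D_1 g t)%:E = 0)%E.
Proof.
move=> r0 dg cg g0.
have Dg0 t : ~ seg (r + 1) t -> 'D_1 g t = 0.
  move=> ht; have E : \near t, cst 0 t = g t.
    have : r < `|t|.
      rewrite ltNge; apply/negP => h; apply: ht; rewrite /seg /= in_itv /= -ler_norml.
      by rewrite (le_trans h) // lerDl.
    rewrite ltr_normr => /orP[h|h]; near=> z; rewrite g0 // /seg /= in_itv /= => /andP[h1 h2].
    - have : r < z by near: z; exact: lt_nbhsr.
      by rewrite ltNge h2.
    - have : z < - r by near: z; apply: lt_nbhsl; rewrite ltrNr.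
      by rewrite ltNge h1.
  have [_ <-] := near_eq_is_derive E (is_derive_cst (0 : R) t (1 : R)).
  by [].
(* The interval is enlarged by 1 because [g] is known to vanish only off the closed segment, which
   contains the endpoints r and - r. *)
have rr : - (r + 1) < r + 1 by lra.
have cF := fun t => differentiable_continuous ((derivable1_diffP _ _).1 (dg t)).
have := @continuous_FTC2 R ('D_1 g) g (- (r + 1)) (r + 1) rr.
rewrite g0; last by rewrite /seg /= in_itv /= => /andP[]; lra.
rewrite g0; last by rewrite /seg /= in_itv /= => /andP[]; lra.
rewrite sube0 => ftc.
transitivity (\int[mu]_(t in `[(- (r + 1))%R, (r + 1)%R]%classic) ('D_1 g t)%:E)%E; last apply: ftc.
- rewrite [RHS]integral_mkcond; apply: eq_integral => t _; rewrite patchE.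
  case: ifPn => // /negP; rewrite inE => /Dg0 ->.
  by [].
- exact: continuous_subspaceT.
- split; first by move=> t _; exact: dg.
  + by apply: cvg_at_right_filter; exact: cF.
  + by apply: cvg_at_left_filter; exact: cF.
- by move=> t _; rewrite derive1E.
Unshelve. all: by end_near.
Qed.

Section FiveFold.
Variables (F : R5 -> R) (r : R).
Hypothesis dom5 : dominated lebesgue5 (box r) F.
Let dom4 x4 : dominated (@m4 R) (seg r `*` seg r `*` seg r `*` seg r) (fun z => F (z, x4)).
Proof. exact: (dominated_fst (m1 := @m4 R) (m2 := mu) (@measurable_b4 R r) (@b4_finite R r) x4 dom5). Qed.
Let dom3 x3 x4 : dominated (@m3 R) (seg r `*` seg r `*` seg r) (fun z => F (z, x3, x4)).
Proof. exact: (dominated_fst (m1 := @m3 R) (m2 := mu) (@measurable_b3 R r) (@b3_finite R r) x3 (dom4 x4)). Qed.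
Let dom2 x2 x3 x4 : dominated (@m2 R) (seg r `*` seg r) (fun z => F (z, x2, x3, x4)).
Proof. exact: (dominated_fst (m1 := @m2 R) (m2 := mu) (@measurable_b2 R r) (@b2_finite R r) x2 (dom3 x3 x4)). Qed.

Lemma integral5_line0 : (forall x1 x2 x3 x4, \int[mu]_t (F (t, x1, x2, x3, x4))%:E = 0)%E -> (\int[lebesgue5]_x (F x)%:E = 0)%E.
Proof.
move=> h.
apply: (integral_eq0_fst (m1 := @m4 R) (m2 := mu) dom5) => x4.
apply: (integral_eq0_fst (m1 := @m3 R) (m2 := mu) (dom4 x4)) => x3.
apply: (integral_eq0_fst (m1 := @m2 R) (m2 := mu) (dom3 x3 x4)) => x2.
apply: (integral_eq0_fst (m1 := mu) (m2 := mu) (dom2 x2 x3 x4)) => x1.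
exact: h.
Qed.
Lemma integral5_line1 : (forall x0 x2 x3 x4, \int[mu]_t (F (x0, t, x2, x3, x4))%:E = 0)%E -> (\int[lebesgue5]_x (F x)%:E = 0)%E.
Proof.
move=> h.
apply: (integral_eq0_fst (m1 := @m4 R) (m2 := mu) dom5) => x4.
apply: (integral_eq0_fst (m1 := @m3 R) (m2 := mu) (dom4 x4)) => x3.
apply: (integral_eq0_fst (m1 := @m2 R) (m2 := mu) (dom3 x3 x4)) => x2.
apply: (integral_eq0_snd (m1 := mu) (m2 := mu) (dom2 x2 x3 x4)) => x0.
exact: h.
Qed.
Lemma integral5_line2 : (forall x0 x1 x3 x4, \int[mu]_t (F (x0, x1, t, x3, x4))%:E = 0)%E -> (\int[lebesgue5]_x (F x)%:E = 0)%E.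
Proof.
move=> h.
apply: (integral_eq0_fst (m1 := @m4 R) (m2 := mu) dom5) => x4.
apply: (integral_eq0_fst (m1 := @m3 R) (m2 := mu) (dom4 x4)) => x3.
apply: (integral_eq0_snd (m1 := @m2 R) (m2 := mu) (dom3 x3 x4)) => -[x0 x1].
exact: h.
Qed.
Lemma integral5_line3 : (forall x0 x1 x2 x4, \int[mu]_t (F (x0, x1, x2, t, x4))%:E = 0)%E -> (\int[lebesgue5]_x (F x)%:E = 0)%E.
Proof.
move=> h.
apply: (integral_eq0_fst (m1 := @m4 R) (m2 := mu) dom5) => x4.
apply: (integral_eq0_snd (m1 := @m3 R) (m2 := mu) (dom4 x4)) => -[[x0 x1] x2].
exact: h.
Qed.
Lemma integral5_line4 : (forall x0 x1 x2 x3, \int[mu]_t (F (x0, x1, x2, x3, t))%:E = 0)%E -> (\int[lebesgue5]_x (F x)%:E = 0)%E.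
Proof.
move=> h.
apply: (integral_eq0_snd (m1 := @m4 R) (m2 := mu) dom5) => -[[[x0 x1] x2] x3].
exact: h.
Qed.
End FiveFold.

Section Lines.
Variables (psi : R5 -> R) (r : R).
Hypotheses (r0 : 0 < r) (dpsi : forall x, differentiable psi x).
Hypothesis psi0 : forall x, ~ box r x -> psi x = 0.

(** The hypothesis says that [p] is a line in the i-th direction at unit speed; the two difference
    quotients are then equal term by term. *)
Lemma derive_along (i : 'I_5) (p : R -> R5) :
  (forall h t, p (h + t) = h *: (basis5 R i : R5) + p t) ->
  forall t, derivable (psi \o p) t 1 /\ 'D_1 (psi \o p) t = 'D_(basis5 R i) psi (p t).
Proof.
move=> hp t.
have E : (fun h : R => h^-1 *: (((psi \o p) \o shift t) (h *: 1) - (psi \o p) t)) =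
    (fun h : R => h^-1 *: ((psi \o shift (p t)) (h *: (basis5 R i : R5)) - psi (p t))).
  by apply/funext => h /=; rewrite -[h *: 1]/(h * 1) mulr1 hp.
by rewrite /derivable /derive E; split => //; exact: diff_derivable.
Qed.

Lemma integral_derive_along (i : 'I_5) (p : R -> R5) :
  continuous ('D_(basis5 R i) psi) ->
  (forall h t, p (h + t) = h *: (basis5 R i : R5) + p t) -> continuous p ->
  (forall t, box r (p t) -> seg r t) ->
  (\int[mu]_t ('D_(basis5 R i) psi (p t))%:E = 0)%E.
Proof.
move=> cD hp cp bp; have h := derive_along hp.
under eq_integral => t _ do rewrite -(h t).2.
apply: (integral_derive_line r0).
- by move=> t; exact: (h t).1.
- rewrite (_ : 'D_1 (psi \o p) = 'D_(basis5 R i) psi \o p); last by apply/funext => t; exact: (h t).2.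
  by move=> t; apply: continuous_comp; [exact: cp|exact: cD].
- by move=> t ht /=; apply: psi0 => /bp.
Qed.

Lemma derive_box (i : 'I_5) x : ~ box r x -> 'D_(basis5 R i) psi x = 0.
Proof.
move=> xb; have cb : closed (box r : set R5) by apply: compact_closed; [exact: norm_hausdorff|exact: compact_box].
have E : \near x, cst 0 x = psi x.
  have : nbhs x (~` box r) by apply: open_nbhs_nbhs; split => //; exact: closed_openC.
  by apply: filterS => z /psi0 ->.
have [_ ->] := near_eq_is_derive E (is_derive_cst (0 : R) x (basis5 R i : R5)).
by [].
Qed.

(** Fubini reduces this to the lines in the i-th direction, where the fundamental theorem of
    calculus applies. *)
Lemma integral_derive5 (i : 'I_5) : continuous ('D_(basis5 R i) psi) ->
  (\int[lebesgue5]_x ('D_(basis5 R i) psi x)%:E = 0)%E.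
Proof.
move=> cD; set f := ('D_(basis5 R i) psi : R5 -> R).
have ms := @measurable_seg R r; have fs := @seg_finite R r.
have D0 x : ~ box r x -> f x = 0 := @derive_box i x.
have dom5 := continuous_dominated cD D0.
have cvp (U W : topologicalType) (a : R -> U) (b : R -> W) : continuous a -> continuous b ->
   continuous (fun t => (a t, b t)).
  by move=> ca cb t; apply: cvg_pair; [exact: ca|exact: cb].
have cc (U : topologicalType) (u : U) : continuous (fun _ : R => u) by move=> t; exact: cvg_cst.
have ci : continuous (fun t : R => t) by move=> t; exact: cvg_id.
have line := integral_derive_along cD.
have scalebE (j : 'I_5) (h : R) (y : R5) : h *: (basis5 R j : R5) + y =
    let: (y0, y1, y2, y3, y4) := y in
    (h * (0%N == j :> nat)%:R + y0, h * (1%N == j :> nat)%:R + y1, h * (2%N == j :> nat)%:R + y2,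
     h * (3%N == j :> nat)%:R + y3, h * (4%N == j :> nat)%:R + y4).
  by case: y => [[[[y0 y1] y2] y3] y4].
case: i @f cD D0 dom5 line => [[|[|[|[|[|//]]]]] i5] f cD D0 dom5 line.
- apply: (integral5_line0 dom5) => x1 x2 x3 x4.
  apply: (line (fun t => (t, x1, x2, x3, x4))).
  + by move=> h t; rewrite scalebE /= ?mulr1 !mulr0 !add0r.
  + exact: (cvp _ _ _ _ (cvp _ _ _ _ (cvp _ _ _ _ (cvp _ _ _ _ ci (cc _ x1)) (cc _ x2)) (cc _ x3)) (cc _ x4)).
  + by move=> t [[[[]]]].
- apply: (integral5_line1 dom5) => x0 x2 x3 x4.
  apply: (line (fun t => (x0, t, x2, x3, x4))).
  + by move=> h t; rewrite scalebE /= ?mulr1 !mulr0 !add0r.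
  + exact: (cvp _ _ _ _ (cvp _ _ _ _ (cvp _ _ _ _ (cvp _ _ _ _ (cc _ x0) ci) (cc _ x2)) (cc _ x3)) (cc _ x4)).
  + by move=> t [[[[]]]].
- apply: (integral5_line2 dom5) => x0 x1 x3 x4.
  apply: (line (fun t => (x0, x1, t, x3, x4))).
  + by move=> h t; rewrite scalebE /= ?mulr1 !mulr0 !add0r.
  + exact: (cvp _ _ _ _ (cvp _ _ _ _ (cvp _ _ _ _ (cvp _ _ _ _ (cc _ x0) (cc _ x1)) ci) (cc _ x3)) (cc _ x4)).
  + by move=> t [[[[]]]].
- apply: (integral5_line3 dom5) => x0 x1 x2 x4.
  apply: (line (fun t => (x0, x1, x2, t, x4))).
  + by move=> h t; rewrite scalebE /= ?mulr1 !mulr0 !add0r.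
  + exact: (cvp _ _ _ _ (cvp _ _ _ _ (cvp _ _ _ _ (cvp _ _ _ _ (cc _ x0) (cc _ x1)) (cc _ x2)) ci) (cc _ x4)).
  + by move=> t [[[[]]]].
- apply: (integral5_line4 dom5) => x0 x1 x2 x3.
  apply: (line (fun t => (x0, x1, x2, x3, t))).
  + by move=> h t; rewrite scalebE /= ?mulr1 !mulr0 !add0r.
  + exact: (cvp _ _ _ _ (cvp _ _ _ _ (cvp _ _ _ _ (cvp _ _ _ _ (cc _ x0) (cc _ x1)) (cc _ x2)) (cc _ x3)) ci).
  + by move=> t [[[[]]]].
Qed.

End Lines.
End ByParts.

(** * Weak derivatives of smooth functions *)

Section WeakDerivative.
Variable R : realType.
Local Notation R5 := (R5 R).
Local Notation lebesgue5 := (@lebesgue5 R).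
Local Notation smooth5 := (smooth (basis5 R : 'I_5 -> R5)).

Lemma ball_box (r : R) : ball (0 : R5) r `<=` box r.
Proof.
move=> [[[[x0 x1] x2] x3] x4] [[[[h0 h1] h2] h3] h4].
have h (x : R) : ball (0 : R) r x -> seg r x.
  by rewrite /ball /= sub0r normrN /seg /= in_itv /= -ler_norml => /ltW.
by do ?split; exact: h.
Qed.

Lemma measurable_ball5 (r : R) : measurable (ball (0 : R5) r).
Proof.
have m (x : R) : measurable (ball x r) by exact: measurable_ball.
rewrite (_ : ball _ _ = ball (0 : R) r `*` ball (0 : R) r `*` ball (0 : R) r `*` ball (0 : R) r `*` ball (0 : R) r) //.
exact: (measurableX (measurableX (measurableX (measurableX (m 0) (m 0)) (m 0)) (m 0)) (m 0)).
Qed.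

Lemma ball5_finite (r : R) : (lebesgue5 (ball (0%R : R5) r) < +oo)%E.
Proof.
apply: le_lt_trans (box_finite r); apply: le_measure; rewrite ?inE.
- exact: measurable_ball5.
- exact: measurable_box.
- exact: ball_box.
Qed.

Lemma bounded_on_ball (f : R5 -> R) r : continuous f -> exists2 M, 0 <= M & forall x, ball (0 : R5) r x -> `|f x| <= M.
Proof.
move=> cf; have : compact (f @` box r).
  by apply: continuous_compact; [exact: continuous_subspaceT|exact: compact_box].
move=> /compact_bounded [M [_ hM]]; exists (`|M| + 1); first by rewrite addr_ge0.
move=> x /ball_box xb; apply: (hM (`|M| + 1)); last by exists x.
by rewrite (le_lt_trans (ler_norm M)) ?ltrDl.
Qed.

Lemma continuous_integrable_ball (f : R5 -> R) r : continuous f ->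
  lebesgue5.-integrable (ball (0 : R5) r) (EFin \o f).
Proof.
move=> cf; apply: measurable_bounded_integrable.
- exact: measurable_ball5.
- exact: ball5_finite.
- by apply: measurable_funTS; exact: continuous_measurable5.
- have [M M0 hM] := bounded_on_ball r cf; exists M; split; first exact: num_real.
  by move=> y My x /hM h /=; apply: le_trans h _; exact: ltW.
Qed.

Lemma continuous_L2loc (f : R5 -> R) : continuous f -> L2loc f.
Proof.
move=> cf; split; first exact: continuous_measurable5.
move=> r; have c2 : continuous (fun x => f x ^+ 2).
  by move=> x; apply: continuousM; exact: cf.
have /integrableP[_] := continuous_integrable_ball r c2.
move=> h; apply: le_lt_trans h; rewrite le_eqVlt; apply/orP; left; apply/eqP.
by apply: eq_integral => x _ /=; rewrite ger0_norm // sqr_ge0.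
Qed.

Lemma integral_by_parts5 (v chi : R5 -> R) r i : 0 < r -> smooth5 v -> smooth5 chi ->
  (forall x, ~ box r x -> chi x = 0) ->
  (\int[lebesgue5]_(x in setT) (v x * 'D_(basis5 R i) chi x) =
   - \int[lebesgue5]_(x in setT) ('D_(basis5 R i) v x * chi x))%R.
Proof.
move=> r0 sv sc c0.
have sD (f : R5 -> R) : smooth5 f -> smooth5 ('D_(basis5 R i) f) by exact: smooth_derive.
have dc0 := derive_box c0 i.
have svc := smoothM sv sc.
have h := integral_derive5 r0 (fun x => smooth_differentiable x svc) _ (smooth_continuous (sD _ svc)).
have E x : 'D_(basis5 R i) (fun x => v x * chi x) x = v x * 'D_(basis5 R i) chi x + 'D_(basis5 R i) v x * chi x.
  have dv : derivable v x (basis5 R i) by apply: diff_derivable; exact: (sv [::] x).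
  have dc : derivable chi x (basis5 R i) by apply: diff_derivable; exact: (sc [::] x).
  have := deriveM dv dc; rewrite /GRing.scale /= => e.
  by rewrite [RHS]addrC [X in X + _]mulrC [RHS]addrC -e.
have i1 : lebesgue5.-integrable setT (EFin \o (fun x => v x * 'D_(basis5 R i) chi x)).
  apply: dominated_integrable; apply: (@continuous_dominated _ _ r).
    exact: (smooth_continuous (smoothM sv (sD _ sc))).
  by move=> x xb; rewrite dc0 // mulr0.
have i2 : lebesgue5.-integrable setT (EFin \o (fun x => 'D_(basis5 R i) v x * chi x)).
  apply: dominated_integrable; apply: (@continuous_dominated _ _ r).
    exact: (smooth_continuous (smoothM (sD _ sv) sc)).
  by move=> x xb; rewrite c0 // mulr0.
apply/eqP; rewrite -addr_eq0 -RintegralD //; apply/eqP; rewrite /Rintegral.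
under eq_integral => x _ do rewrite -E.
by rewrite h // => x xb; rewrite c0 // mulr0.
Qed.

Lemma partials_box (phi : R5 -> R) r l : smooth5 phi -> (forall x, ~ box r x -> phi x = 0) ->
  forall x, ~ box r x -> partials l phi x = 0.
Proof.
move=> sp p0; elim: l => //= i l IH x xb; exact: (derive_box IH).
Qed.

(** Integrating by parts strips the outermost derivative off the test function and makes it the
    innermost one on v, hence the reversed word. *)
Lemma smooth_weak_derivative (v : R5 -> R) l : smooth5 v ->
  is_weak_derivative l v (partials (rev l) v).
Proof.
move=> sv; split.
  exact: (continuous_L2loc (smooth_continuous (smooth_dirs (rev l) sv))).
move=> phi [sp [K /compact_sub_box[r r0 Kr] p0]].
have {}p0 x : ~ box r x -> phi x = 0 by move=> xb; apply: p0 => /Kr.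
elim: l v sv => [|i l IH] v sv; first by rewrite expr0 mul1r.
rewrite [partials (i :: l) phi]/(partials _ _) /= (integral_by_parts5 i r0 sv) //; last first.
- exact: partials_box.
- exact: smooth_dirs.
rewrite IH; last exact: smooth_derive.
by rewrite rev_cons [partials (rcons _ _) v]dirs_rcons exprS mulN1r mulNr.
Qed.

End WeakDerivative.

(** * Uniqueness of weak derivatives *)

(** The countable cover lets products of generators recover a cylinder over A as a countable union
    of rectangles. *)
Definition pi_generator d (T : measurableType d) (G : set (set T)) :=
  [/\ @measurable _ T = <<s G >>, setI_closed G &
    exists g : nat -> set T, (forall n, G (g n)) /\ \bigcup_n g n = setT].

Section PiProduct.
Context d1 d2 (T1 : measurableType d1) (T2 : measurableType d2).
Variables (G1 : set (set T1)) (G2 : set (set T2)).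

Definition rectangles : set (set (T1 * T2)) := [set C | exists A B, [/\ G1 A, G2 B & C = A `*` B]].

Lemma pi_generator_prod : pi_generator G1 -> pi_generator G2 -> pi_generator rectangles.
Proof.
move=> [g1 I1 [s1 [G1s U1]]] [g2 I2 [s2 [G2s U2]]]; split; last 2 first.
- move=> _ _ [A [B [GA GB ->]]] [A' [B' [GA' GB' ->]]].
  by exists (A `&` A'), (B `&` B'); rewrite setXI; split; [exact: I1|exact: I2|].
- pose c n := odflt (0%N, 0%N) (unpickle n).
  exists (fun n => s1 (c n).1 `*` s2 (c n).2); split; first by move=> n; exists (s1 (c n).1), (s2 (c n).2).
  apply/seteqP; split => // -[x y] _.
  have : [set: T1] x by []. have : [set: T2] y by [].
  rewrite -U1 -U2 => -[j _ Gy] [i _ Fx].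
  by exists (pickle (i, j)) => //; rewrite /c pickleK.
rewrite measurable_prod_measurableType; apply/seteqP; split; last first.
  apply: smallest_sub; first exact: smallest_sigma_algebra.
  move=> _ [A [B [GA GB ->]]]; apply: sub_sigma_algebra; exists A => /=.
    by rewrite g1; exact: sub_sigma_algebra.
  by exists B => //; rewrite g2; exact: sub_sigma_algebra.
apply: smallest_sub; first exact: smallest_sigma_algebra.
pose T := g_sigma_algebraType rectangles.
have m1 : measurable_fun [set: T] (fst : T -> T1).
  apply: (measurability _ g1) => _ [A GA <-].
  rewrite setTI (_ : fst @^-1` A = \bigcup_n (A `*` s2 n)).
    by apply: bigcupT_measurable => n; apply: sub_sigma_algebra; exists A, (s2 n).
  apply/seteqP; split => -[x y] /=; last by case=> n _ [].
  move=> Ax; have : [set: T2] y by []. rewrite -U2 => -[n _ sy]; by exists n.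
have m2 : measurable_fun [set: T] (snd : T -> T2).
  apply: (measurability _ g2) => _ [A GA <-].
  rewrite setTI (_ : snd @^-1` A = \bigcup_n (s1 n `*` A)).
    by apply: bigcupT_measurable => n; apply: sub_sigma_algebra; exists (s1 n), A.
  apply/seteqP; split => -[x y] /=; last by case=> n _ [].
  move=> Ax; have : [set: T1] x by []. rewrite -U1 => -[n _ sy]; by exists n.
move=> _ [A mA [B mB <-]].
have -> : A `*` B = ([set: T] `&` fst @^-1` A) `&` ([set: T] `&` snd @^-1` B).
  by rewrite !setTI; apply/seteqP; split => -[].
by apply: (@measurableI _ T); [exact: m1|exact: m2].
Qed.
End PiProduct.

(** Dynkin's theorem: the sets E for which w has zero integral over Q and E together form a
    lambda-system, the condition on Q itself giving complements. *)
Lemma integral_pi_generator d (T : measurableType d) (R : realType) (m : {measure set T -> \bar R})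
  (G : set (set T)) (Q : set T) (w : T -> \bar R) :
  pi_generator G -> measurable Q -> m.-integrable Q w ->
  (\int[m]_(x in Q) w x = 0)%E ->
  (forall A, G A -> \int[m]_(x in Q `&` A) w x = 0)%E ->
  ae_eq m Q w (cst 0%E).
Proof.
move=> [gG IG _] mQ iw w0 wG.
have key E : measurable E -> (\int[m]_(x in Q `&` E) w x = 0)%E.
  rewrite gG; move: E; apply: (dynkin_induction gG IG) => //.
  - by rewrite setIT.
  - move=> S mS S0; have mQS := measurableI _ _ mQ mS.
    have mQS' : measurable (Q `&` ~` S) by apply: measurableI => //; exact: measurableC.
    have := @integral_setU _ _ _ m (Q `&` S) (Q `&` ~` S) w mQS mQS'.
    rewrite -setIUr setUv setIT S0 add0e w0 => <- //.
      exact: measurable_int iw.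
    by rewrite disj_set2E; apply/eqP; rewrite setIACA setICr setI0.
  - move=> F mF tF F0; rewrite setI_bigcupr integral_bigcup.
    + by apply: eseries0 => n _ _; exact: F0.
    + exact: trivIset_setIl.
    + by move=> n; apply: measurableI.
    + apply: integrableS iw => //; last by move=> x [n _ []].
      by apply: bigcupT_measurable => n; exact: measurableI.
apply: (integral_ae_eq mQ iw); first exact: measurable_cst.
move=> E EQ mE; rewrite integral0.
by rewrite -(key E mE) (setIidr EQ).
Qed.

Section Boxes.
Variable R : realType.

Lemma pi_generator_line : pi_generator (@RGenOpens.G R : set (set (measurableTypeR R))).
Proof.
split.
- exact: RGenOpens.measurableE.
- move=> _ _ [a [b ->]] [c [d ->]]; exists (Num.max a c), (Num.min b d).
  apply/seteqP; split => x /=; rewrite !in_itv /= gt_max lt_min.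
    by move=> [/andP[-> ->] /andP[-> ->]].
  by move=> /andP[/andP[-> ->] /andP[-> ->]].
- exists (fun n => `](- n%:R)%R, n%:R[%classic); split; first by move=> n; exists (- n%:R), n%:R.
  apply/seteqP; split => // x _; exists (Num.bound `|x|) => //=.
  by rewrite in_itv /= -ltr_norml archi_boundP.
Qed.

Definition oseg (p : R * R) : set R := `]p.1, p.2[%classic.
Definition obox (p0 p1 p2 p3 p4 : R * R) : set (R5 R) :=
  oseg p0 `*` oseg p1 `*` oseg p2 `*` oseg p3 `*` oseg p4.

Lemma integral_box_ae (Q : set (R5 R)) (w : R5 R -> \bar R) :
  measurable Q -> (@lebesgue5 R).-integrable Q w ->
  (\int[@lebesgue5 R]_(x in Q) w x = 0)%E ->
  (forall p0 p1 p2 p3 p4, \int[@lebesgue5 R]_(x in Q `&` obox p0 p1 p2 p3 p4) w x = 0)%E ->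
  ae_eq (@lebesgue5 R) Q w (cst 0%E).
Proof.
move=> mQ iw w0 wb; have g1 := pi_generator_line.
have g5 := pi_generator_prod (pi_generator_prod (pi_generator_prod (pi_generator_prod g1 g1) g1) g1) g1.
apply: (integral_pi_generator g5 mQ iw w0).
move=> _ [_ [_ [[_ [_ [[_ [_ [[_ [_ [[a0 [b0 ->]] [a1 [b1 ->]] ->]]] [a2 [b2 ->]] ->]]] [a3 [b3 ->]] ->]]] [a4 [b4 ->]] ->]]].
exact: (wb (a0, b0) (a1, b1) (a2, b2) (a3, b3) (a4, b4)).
Qed.
End Boxes.

(** * Linear forms and products of functions of one variable *)

Section LinearForm.
Context {R : realType} {V : normedModType R}.

Lemma linear_form_differentiable (f : V -> R) (x : V) :
  (forall a x y, f (a *: x + y) = a * f x + f y) -> continuous f -> differentiable f x.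
Proof.
move=> lf cf.
pose mix := GRing.isLinear.Build R V R *:%R f lf.
pose F : {linear V -> R} := HB.pack f mix.
exact: (@linear_differentiable R V R F x cf).
Qed.

Lemma linear_form_derive (f : V -> R) (x v : V) :
  (forall a x y, f (a *: x + y) = a * f x + f y) -> 'D_v f x = f v.
Proof.
move=> lf; have fx h : f (h *: v + x) - f x = h * f v by rewrite lf addrK.
rewrite /derive.
have E : (fun h : R => h^-1 *: ((f \o shift x) (h *: v) - f x)) = (fun h : R => h^-1 * (h * f v)).
  by apply/funext => h /=; rewrite fx.
rewrite E; apply: cvg_lim => //.
apply: cvg_near_cst; apply: filterS (nbhs_dnbhs_neq (0 : R)) => h h0.
by rewrite mulrA mulVf // mul1r.
Qed.

Lemma linear_form_smooth (I : Type) (e : I -> V) (f : V -> R) :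
  (forall a x y, f (a *: x + y) = a * f x + f y) -> continuous f -> smooth e f.
Proof.
move=> lf cf; apply: (smooth_class (S := fun g => g = f \/ exists c, g = cst c)); first by left.
move=> _ [->|[c ->]]; split.
- by move=> x; exact: linear_form_differentiable.
- by move=> i; right; exists (f (e i)); apply/funext => x; rewrite linear_form_derive.
- by [].
- by move=> i; right; exists 0; apply/funext => x; rewrite derive_cst.
Qed.
End LinearForm.

Section Products.
Variable R : realType.
Local Notation R5 := (R5 R).
Local Notation smooth5 := (smooth (basis5 R : 'I_5 -> R5)).
Implicit Types (f : 'I_5 -> R -> R) (x : R5).

Definition coordinate (i : 'I_5) x : R := (coord5 x)`_i.

Lemma coordinate_linear i (a : R) x (y : R5) : coordinate i (a *: x + y) = a * coordinate i x + coordinate i y.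
Proof.
case: x y => [[[[x0 x1] x2] x3] x4] [[[[y0 y1] y2] y3] y4].
by case: i => [[|[|[|[|[|//]]]]] i5].
Qed.

Lemma continuous_coordinate i : continuous (coordinate i).
Proof.
have c1 (U W : topologicalType) (f : R5 -> (U * W)%type) : continuous f -> continuous (fun x => (f x).1).
  by move=> cf x; apply: (@continuous_comp _ _ _ f fst); [exact: cf|exact: cvg_fst].
have c2 (U W : topologicalType) (f : R5 -> (U * W)%type) : continuous f -> continuous (fun x => (f x).2).
  by move=> cf x; apply: (@continuous_comp _ _ _ f snd); [exact: cf|exact: cvg_snd].
have c0 : continuous (fun x : R5 => x : (R * R * R * R * R)%type) by move=> x; exact: cvg_id.
case: i => [[|[|[|[|[|//]]]]] i5].
- rewrite (_ : coordinate _ = fun x => x.1.1.1.1); last by apply/funext => -[[[[]]]].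
  exact: (c1 _ _ _ (c1 _ _ _ (c1 _ _ _ (c1 _ _ _ c0)))).
- rewrite (_ : coordinate _ = fun x => x.1.1.1.2); last by apply/funext => -[[[[]]]].
  exact: (c2 _ _ _ (c1 _ _ _ (c1 _ _ _ (c1 _ _ _ c0)))).
- rewrite (_ : coordinate _ = fun x => x.1.1.2); last by apply/funext => -[[[[]]]].
  exact: (c2 _ _ _ (c1 _ _ _ (c1 _ _ _ c0))).
- rewrite (_ : coordinate _ = fun x => x.1.2); last by apply/funext => -[[[[]]]].
  exact: (c2 _ _ _ (c1 _ _ _ c0)).
- rewrite (_ : coordinate _ = fun x => x.2); last by apply/funext => -[[[[]]]].
  exact: (c2 _ _ _ c0).
Qed.

Lemma coordinate_smooth i : smooth5 (coordinate i).
Proof. by apply: linear_form_smooth; [exact: coordinate_linear|exact: continuous_coordinate]. Qed.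

Lemma coordinate_basis i j : coordinate i (basis5 R j) = (i == j)%:R.
Proof. by case: i => [[|[|[|[|[|//]]]]] i5]. Qed.

Lemma coordinate_box r x : box r x <-> forall i, seg r (coordinate i x).
Proof.
case: x => [[[[x0 x1] x2] x3] x4]; split.
  by move=> [[[[? ?] ?] ?] ?] [[|[|[|[|[|//]]]]] i5].
move=> h; split; [split; [split; [split|]|]|].
- exact: (h 0). - exact: (h 1). - exact: (h 2). - exact: (h 3). - exact: (h 4).
Qed.

Definition prodf f x : R := \prod_(i < 5) f i (coordinate i x).

Lemma prodf_smooth f : (forall i, smooth1 (f i)) -> smooth5 (prodf f).
Proof.
move=> hf; apply: (smooth_prod (F := fun i x => f i (coordinate i x))) => i.
exact: (smooth_comp (hf i) (coordinate_smooth i)).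
Qed.

Lemma prodf_box f r : (forall i t, ~ seg r t -> f i t = 0) -> forall x, ~ box r x -> prodf f x = 0.
Proof.
move=> f0 x xb; have [i hi] : exists i, ~ seg r (coordinate i x).
  by apply: contrapT => /forallNP h; apply: xb; apply/coordinate_box => i; apply: contrapT; exact: h.
by rewrite /prodf (bigD1 i) //= f0 // mul0r.
Qed.

Lemma prodf_test f r : (forall i, smooth1 (f i)) -> (forall i t, ~ seg r t -> f i t = 0) ->
  test_function (prodf f).
Proof.
move=> sf f0; split; first exact: prodf_smooth.
by exists (box r); [exact: compact_box|exact: prodf_box].
Qed.

Lemma prodf_derive f i x : (forall i, smooth1 (f i)) ->
  'D_(basis5 R i) (prodf f) x = prodf (fun j => if j == i then 'D_1 (f i) else f j) x.
Proof.
move=> sf.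
(* The line through x in the i-th direction, parametrised by its i-th coordinate. *)
pose p (t : R) : R5 := (t - coordinate i x) *: (basis5 R i : R5) + x.
have hp h t : p (h + t) = h *: (basis5 R i : R5) + p t.
  by rewrite /p -addrA scalerDl addrA.
have [_ E] := derive_along (fun x => smooth_differentiable x (prodf_smooth sf)) hp (coordinate i x).
have px : p (coordinate i x) = x by rewrite /p subrr scale0r add0r.
rewrite px in E; rewrite -E.
have cp j t : coordinate j (p t) = if j == i then t else coordinate j x.
  rewrite coordinate_linear coordinate_basis; case: eqP => [->|_].
    by rewrite mulr1 subrK.
  by rewrite mulr0 add0r.
pose C := \prod_(j < 5 | j != i) f j (coordinate j x).
have -> : prodf f \o p = (fun t => C * f i t).
  apply/funext => t; rewrite /= /prodf (bigD1 i) //= cp eqxx mulrC; congr (_ * _).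
  by apply: eq_bigr => j /negbTE ji; rewrite cp ji.
have di : derivable (f i) (coordinate i x) 1.
  by apply/derivable1_diffP; exact: (sf i [::]).
have := deriveZ C di; rewrite /GRing.scale /= => ->.
rewrite /prodf (bigD1 i) //= eqxx mulrC; congr (_ * _).
by apply: eq_bigr => j /negbTE ji; rewrite ji.
Qed.

End Products.

(** * The fundamental lemma of the calculus of variations *)

Section Fundamental.
Variable R : realType.
Local Notation R5 := (R5 R).
Local Notation lebesgue5 := (@lebesgue5 R).
Implicit Types (w : R5 -> R) (p : R * R).

Lemma cst_integrable_ball (c r : R) : lebesgue5.-integrable (ball (0 : R5) r) (EFin \o cst c).
Proof. by apply: continuous_integrable_ball => x; exact: cvg_cst. Qed.

Lemma L2loc_square w r : L2loc w -> lebesgue5.-integrable (ball (0 : R5) r) (fun x => (w x ^+ 2)%:E).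
Proof.
move=> [mw wr]; apply/integrableP; split.
  by apply/measurable_EFinP/measurable_funTS; apply: measurable_funX.
apply: le_lt_trans (wr r); rewrite le_eqVlt; apply/orP; left; apply/eqP.
by apply: eq_integral => x _ /=; rewrite ger0_norm // sqr_ge0.
Qed.

Lemma L2loc_integrable w r : L2loc w -> lebesgue5.-integrable (ball (0 : R5) r) (EFin \o w).
Proof.
move=> wL; have mw := wL.1.
apply: (@le_integrable _ _ _ lebesgue5 _ (measurable_ball5 r) (EFin \o w) (fun x => (1 + w x ^+ 2)%:E)).
- by apply/measurable_EFinP/measurable_funTS.
- move=> x _ /=; rewrite lee_fin [leRHS]ger0_norm ?addr_ge0 ?sqr_ge0 //.
  by rewrite -real_normK ?num_real //; have := sqr_ge0 (`|w x| - 1); have := normr_ge0 (w x); nra.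
- rewrite (_ : (fun x => _) = (EFin \o cst 1) \+ (fun x => (w x ^+ 2)%:E)) //.
  apply: integrableD; first exact: measurable_ball5.
  + exact: cst_integrable_ball.
  + exact: L2loc_square.
Qed.

(** A smooth approximation of the indicator of an open interval: zero off it, and at each inner
    point equal to 1 from some n on. *)
Definition bump (n : nat) p (t : R) : R := step (n.+1%:R * (t - p.1)) * step (n.+1%:R * (p.2 - t)).

Lemma bump_smooth n p : smooth1 (bump n p).
Proof.
apply: smoothM; apply: (smooth1_comp (@step_smooth R)).
- rewrite (_ : (fun x => _) = (fun x => n.+1%:R * x + (- n.+1%:R * p.1))); first exact: smooth1_affine.
  by apply/funext => x; ring.
- rewrite (_ : (fun x => _) = (fun x => (- n.+1%:R) * x + (n.+1%:R * p.2))); first exact: smooth1_affine.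
  by apply/funext => x; ring.
Qed.

Lemma bump_ge0 n p t : 0 <= bump n p t.
Proof. by rewrite mulr_ge0 // step_ge0. Qed.

Lemma bump_le1 n p t : bump n p t <= 1.
Proof. by rewrite mulr_ile1 ?step_ge0 ?step_le1. Qed.

Lemma bump_eq0 n p t : ~ oseg p t -> bump n p t = 0.
Proof.
rewrite /oseg /= in_itv /= /bump => /negP; rewrite negb_and -!leNgt => /orP[h|h].
  by rewrite step_eq0 ?mul0r // pmulr_rle0 ?ltr0n // subr_le0.
by rewrite [X in _ * X]step_eq0 ?mulr0 // pmulr_rle0 ?ltr0n // subr_le0.
Qed.

Lemma bump_eq1 p t : oseg p t -> \forall n \near \oo, bump n p t = 1.
Proof.
rewrite /oseg /= in_itv /= => /andP[h1 h2].
have key (d : R) : 0 < d -> \forall n \near \oo, 1 <= n.+1%:R * d.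
  move=> d0; exists (Num.bound d^-1) => // n /= hn.
  rewrite -ler_pdivrMr // mul1r; apply/ltW.
  apply: (@lt_le_trans _ _ (Num.bound d^-1)%:R); last by rewrite ler_nat leqW.
  by apply: archi_boundP; rewrite invr_ge0 ltW.
have k1 := key (t - p.1); have k2 := key (p.2 - t).
near=> n; rewrite /bump !step_eq1 ?mulr1 //; near: n.
- by apply: k2; rewrite subr_gt0.
- by apply: k1; rewrite subr_gt0.
Unshelve. all: by end_near.
Qed.

Definition qbox (q : 'I_5 -> R * R) : set R5 := obox (q 0) (q 1) (q 2) (q 3) (q 4).

Section Core.
Variables (w : R5 -> R) (r : R).
Hypothesis wL : L2loc w.
Hypothesis w0 : forall phi, test_function phi -> \int[lebesgue5]_(x in setT) (w x * phi x) = 0.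
Local Notation Q := (ball (0%R : R5) r).

Lemma ball_obox : Q = obox (- r, r) (- r, r) (- r, r) (- r, r) (- r, r).
Proof.
have -> : Q = ball (0 : R) r `*` ball (0 : R) r `*` ball (0 : R) r `*` ball (0 : R) r `*` ball (0 : R) r by [].
suff -> : ball (0 : R) r = oseg (- r, r) by [].
by rewrite ball_itv sub0r add0r.
Qed.

(** Dominated convergence with majorant [|w|], for products of bumps that tend to the indicator of
    the box. *)
Lemma integral_obox (q : 'I_5 -> R * R) : (forall i, - r <= (q i).1 /\ (q i).2 <= r) ->
  (\int[lebesgue5]_(x in qbox q) (w x)%:E = 0)%E.
Proof.
move=> hq.
set B := qbox q.
have oq i t : oseg (q i) t -> oseg (- r, r) t.
  rewrite /oseg /= !in_itv /= => /andP[h1 h2]; have [h3 h4] := hq i.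
  by rewrite (le_lt_trans h3) // (lt_le_trans h2).
have BQ : B `<=` Q.
  by rewrite ball_obox => -[[[[x0 x1] x2] x3] x4] [[[[? ?] ?] ?] ?]; split; [split; [split; [split|]|]|]; apply: oq; eassumption.
pose phi n := prodf (fun i => bump n (q i)).
have sub_seg i t : ~ seg `|r| t -> ~ oseg (q i) t.
  move=> h /oq; rewrite /oseg /= in_itv /= => /andP[h1 h2]; apply: h.
  by rewrite /seg /= in_itv /= -ler_norml ler_norml; have := ler_norm r; lra.
have tphi n : test_function (phi n).
  apply: (@prodf_test _ _ `|r|); first by move=> i; exact: bump_smooth.
  by move=> i t ht; apply: bump_eq0; exact: sub_seg ht.
have BE x : B x <-> forall i, oseg (q i) (coordinate i x).
  case: x => [[[[x0 x1] x2] x3] x4]; split.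
    move=> [[[[h0 h1] h2] h3] h4] [[|[|[|[|[|//]]]]] i5].
    - by rewrite (_ : Ordinal _ = 0); last exact: val_inj.
    - by rewrite (_ : Ordinal _ = 1); last exact: val_inj.
    - by rewrite (_ : Ordinal _ = 2); last exact: val_inj.
    - by rewrite (_ : Ordinal _ = 3); last exact: val_inj.
    - by rewrite (_ : Ordinal _ = 4); last exact: val_inj.
  move=> h; split; [split; [split; [split|]|]|].
  - exact: (h 0). - exact: (h 1). - exact: (h 2). - exact: (h 3). - exact: (h 4).
have phi0 n x : ~ B x -> phi n x = 0.
  move=> xB; have [i hi] : exists i, ~ oseg (q i) (coordinate i x).
    by apply: contrapT => /forallNP h; apply/xB/BE => i; apply: contrapT; exact: h.
  by rewrite /phi /prodf (bigD1 i) //= bump_eq0 // mul0r.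
have phi1 n x : 0 <= phi n x <= 1.
  apply: (big_ind (fun z : R => 0 <= z <= 1)); first by rewrite ler01 lexx.
  - by move=> y z /andP[? ?] /andP[? ?]; rewrite mulr_ge0 // mulr_ile1.
  - by move=> i _; rewrite bump_ge0 bump_le1.
have phic x : phi n x @[n --> \oo] --> (\1_B x : R).
  have [xB|xB] := pselect (B x); last first.
    rewrite indicE (memNset xB); under eq_cvg do rewrite phi0 //.
    exact: cvg_cst.
  rewrite indicE mem_set //=; apply: cvg_near_cst.
  have h i := bump_eq1 ((BE x).1 xB i).
  have : \forall n \near \oo, forall i : 'I_5, bump n (q i) (coordinate i x) = 1.
    exact: filter_forall.
  by apply: filterS => n hn; rewrite /phi /prodf big1.
have mB : measurable B.
  have m i : measurable (oseg (q i)) by exact: measurable_itv.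
  exact: (measurableX (measurableX (measurableX (measurableX (m 0) (m 1)) (m 2)) (m 3)) (m 4)).
have iw := L2loc_integrable r wL.
have mphi n : measurable_fun setT (phi n).
  apply: continuous_measurable5; apply: smooth_continuous; exact: (tphi n).1.
have mwp n : measurable_fun setT (fun x => w x * phi n x).
  by apply: measurable_funM => //; exact: wL.1.
have wple n x : `|w x * phi n x| <= `|w x|.
  have /andP[p0 p1] := phi1 n x.
  by rewrite normrM (ger0_norm p0) ler_piMr.
have iwp n : lebesgue5.-integrable Q (EFin \o (fun x => w x * phi n x)).
  apply: (@le_integrable _ _ _ lebesgue5 _ (measurable_ball5 r) (EFin \o (fun x => w x * phi n x)) (EFin \o w)) => //.
    by apply/measurable_EFinP/measurable_funTS; exact: mwp.
  by move=> x _ /=; rewrite lee_fin.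
have E n : (\int[lebesgue5]_(x in Q) (w x * phi n x)%:E = 0)%E.
  have E1 : (\int[lebesgue5]_(x in Q) (w x * phi n x)%:E = \int[lebesgue5]_(x in setT) (w x * phi n x)%:E)%E.
    rewrite [LHS]integral_mkcond; apply: eq_integral => x _; rewrite patchE.
    case: ifPn => // /negP; rewrite inE => xQ; rewrite phi0 ?mulr0 //.
    by move=> /BQ.
  have := w0 (tphi n); rewrite /Rintegral -E1 => h.
  (* A vanishing real integral could come from an infinite one, as [fine] sends infinities to 0;
     integrability excludes this. *)
  have fin : (\int[lebesgue5]_(x in Q) (w x * phi n x)%:E)%E \is a fin_num.
    by apply: integrable_fin_num; [exact: measurable_ball5|exact: iwp].
  by rewrite -(fineK fin) h.
have h1 : measurable_fun Q ((EFin \o w) \_ B).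
  apply/(measurable_restrict _ mB (measurable_ball5 r)).
  by apply/measurable_EFinP/measurable_funTS; exact: wL.1.
have h2 : \forall x \ae lebesgue5, Q x -> (w x * phi n x)%:E @[n --> \oo] --> ((EFin \o w) \_ B) x.
  apply: aeW => x _; have xc := phic x.
  have -> : ((EFin \o w) \_ B) x = (w x * \1_B x)%:E.
    by rewrite patchE indicE; case: (x \in B); rewrite ?mulr1 ?mulr0.
  apply: cvg_EFin; first exact: nearW.
  by apply: cvgM; [exact: cvg_cst|exact: xc].
have h3 : lebesgue5.-integrable Q (fun x => `|(w x)%:E|%E) by exact: integrable_abse.
have h4 : \forall x \ae lebesgue5, forall n, Q x -> (`|(w x * phi n x)%:E| <= `|(w x)%:E|)%E.
  by apply: aeW => x n _ /=; rewrite lee_fin.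
have h0 n : measurable_fun Q (fun x => (w x * phi n x)%:E) by exact: (measurable_int lebesgue5 (iwp n)).
have [_ _ C] := @dominated_convergence _ _ _ lebesgue5 _ (measurable_ball5 r) _ _ _ h0 h1 h2 h3 h4.
have Bint : (\int[lebesgue5]_(x in B) (w x)%:E = \int[lebesgue5]_(x in Q) ((EFin \o w) \_ B) x)%E.
  by rewrite -integral_mkcondr (setIidr BQ).
rewrite Bint; apply/esym.
have {}C : cst 0%E @ \oo --> (\int[lebesgue5]_(x in Q) ((EFin \o w) \_ B) x)%E.
  by move: C; under eq_fun do rewrite E.
by apply: (cvg_unique _ (cvg_cst _) C).
Qed.

Lemma oseg_capped (p : R * R) : oseg (- r, r) `&` oseg p = oseg (Num.max (- r) p.1, Num.min r p.2).
Proof.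
apply/seteqP; split => t; rewrite /oseg /= !in_itv /= gt_max lt_min.
  by move=> [/andP[-> ->] /andP[-> ->]].
by move=> /andP[/andP[-> ->] /andP[-> ->]].
Qed.

Lemma orthogonal_test_ae0 : ae_eq lebesgue5 Q (EFin \o w) (cst 0%E).
Proof.
apply: integral_box_ae.
- exact: measurable_ball5.
- exact: L2loc_integrable.
- rewrite ball_obox; apply: (@integral_obox (fun=> (- r, r))) => i; split => //.
- move=> p0 p1 p2 p3 p4; pose p (i : 'I_5) : R * R := nth (0, 0) [:: p0; p1; p2; p3; p4] i.
  rewrite (_ : _ `&` _ = qbox (fun i => (Num.max (- r) (p i).1, Num.min r (p i).2))).
    by apply: integral_obox => i /=; split; [rewrite le_max lexx|rewrite ge_min lexx].
  by rewrite ball_obox /qbox /obox -!oseg_capped -!setXI.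
Qed.
End Core.
Lemma L2locD w1 w2 : L2loc w1 -> L2loc w2 -> L2loc (fun x => w1 x + w2 x).
Proof.
move=> h1 h2; split; first by apply: measurable_funD; [exact: h1.1|exact: h2.1].
move=> r.
have i12 : lebesgue5.-integrable (ball (0 : R5) r) (fun x => (2 * w1 x ^+ 2 + 2 * w2 x ^+ 2)%:E).
  rewrite (_ : (fun x => _) = (fun x => 2%:E * (w1 x ^+ 2)%:E)%E \+ (fun x => 2%:E * (w2 x ^+ 2)%:E)%E) //.
  apply: integrableD; first exact: measurable_ball5.
  - by apply: integrableZl; [exact: measurable_ball5|exact: L2loc_square].
  - by apply: integrableZl; [exact: measurable_ball5|exact: L2loc_square].
have /integrableP[_] : lebesgue5.-integrable (ball (0 : R5) r) (fun x => ((w1 x + w2 x) ^+ 2)%:E).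
  apply: (@le_integrable _ _ _ lebesgue5 _ (measurable_ball5 r) _ _ _ _ i12).
    apply/measurable_EFinP/measurable_funTS/measurable_funX/measurable_funD; [exact: h1.1|exact: h2.1].
  move=> x _ /=; rewrite lee_fin; have s1 := sqr_ge0 (w1 x); have s2 := sqr_ge0 (w2 x).
  rewrite (ger0_norm (sqr_ge0 _)) ger0_norm; last by lra.
  by have := sqr_ge0 (w1 x - w2 x); rewrite sqrrB sqrrD; lra.
move=> h; apply: le_lt_trans h; rewrite le_eqVlt; apply/orP; left; apply/eqP.
by apply: eq_integral => x _ /=; rewrite ger0_norm // sqr_ge0.
Qed.

Lemma L2locZ c w : L2loc w -> L2loc (fun x => c * w x).
Proof.
move=> h; split; first by apply: measurable_funM => //; exact: h.1.
move=> r; have /integrableP[_] : lebesgue5.-integrable (ball (0 : R5) r) (fun x => (c ^+ 2)%:E * (w x ^+ 2)%:E)%E.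
  by apply: integrableZl; [exact: measurable_ball5|exact: L2loc_square].
move=> H; apply: le_lt_trans H; rewrite le_eqVlt; apply/orP; left; apply/eqP.
by apply: eq_integral => x _ /=; rewrite exprMn ger0_norm // mulr_ge0 // sqr_ge0.
Qed.

Lemma test_bounded phi : test_function phi -> exists2 r, 0 < r &
  (forall x, ~ ball (0 : R5) r x -> phi x = 0) /\ exists M, forall x, `|phi x| <= M.
Proof.
move=> [sp [K /compact_sub_box[r r0 Kr] p0]].
have {}p0 x : ~ box r x -> phi x = 0 by move=> xb; apply: p0 => /Kr.
exists (r + 1); first by rewrite addr_gt0.
split; last by apply: (@continuous_box_bounded _ _ r) => //; exact: (smooth_continuous sp).
move=> x xb; apply: p0 => xr; apply: xb.
have h (t : R) : seg r t -> ball (0 : R) (r + 1) t.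
  by rewrite /ball /= sub0r normrN /seg /= in_itv /= -ler_norml => h; rewrite (le_lt_trans h) // ltrDl.
by move: x xr => [[[[x0 x1] x2] x3] x4] [[[[h0 h1] h2] h3] h4]; do ?split; exact: h.
Qed.

Lemma L2loc_test_integrable w phi : L2loc w -> test_function phi ->
  lebesgue5.-integrable setT (EFin \o (fun x => w x * phi x)).
Proof.
move=> wL /[dup] tp /test_bounded [r r0 [p0 [M hM]]].
apply: (@integrable_extend0 _ _ _ lebesgue5 _ _ (measurable_ball5 r)); last first.
  by move=> x xb; rewrite p0 // mulr0.
have iw : lebesgue5.-integrable (ball (0 : R5) r) (fun x => (M%:E * (w x)%:E)%E).
  by apply: integrableZl; [exact: measurable_ball5|exact: L2loc_integrable].
apply: (@le_integrable _ _ _ lebesgue5 _ (measurable_ball5 r) _ _ _ _ iw).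
  apply/measurable_EFinP/measurable_funTS/measurable_funM; first exact: wL.1.
  by apply: continuous_measurable5; exact: (smooth_continuous tp.1).
move=> x _ /=; rewrite lee_fin !normrM mulrC ler_wpM2r //.
by apply: le_trans (hM x) _; exact: ler_norm.
Qed.

Lemma weak_derivativeD l v1 v2 w1 w2 (L1 : L2loc v1) (L2 : L2loc v2) :
  is_weak_derivative l v1 w1 -> is_weak_derivative l v2 w2 ->
  is_weak_derivative l (fun x => v1 x + v2 x) (fun x => w1 x + w2 x).
Proof.
move=> [h1 e1] [h2 e2]; split; first exact: L2locD.
move=> phi tp.
have tpl : test_function (partials l phi).
  split; first exact: (smooth_dirs l tp.1).
  have [sp [K /compact_sub_box[r r0 Kr] p0]] := tp.
  exists (box r); first exact: compact_box.
  by apply: partials_box => // x xb; apply: p0 => /Kr.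
under eq_Rintegral do rewrite mulrDl.
under [in RHS]eq_Rintegral do rewrite mulrDl.
rewrite !RintegralD //; try exact: L2loc_test_integrable.
by rewrite e1 // e2 // mulrDr.
Qed.

Lemma weak_derivativeZ c l v w :
  is_weak_derivative l v w -> L2loc v ->
  is_weak_derivative l (fun x => c * v x) (fun x => c * w x).
Proof.
move=> [h e] Lv; split; first exact: L2locZ.
move=> phi tp.
have tpl : test_function (partials l phi).
  split; first exact: (smooth_dirs l tp.1).
  have [sp [K /compact_sub_box[r r0 Kr] p0]] := tp.
  exists (box r); first exact: compact_box.
  by apply: partials_box => // x xb; apply: p0 => /Kr.
under eq_Rintegral do rewrite -mulrA.
under [in RHS]eq_Rintegral do rewrite -mulrA.
rewrite !RintegralZl //; try exact: L2loc_test_integrable.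
by rewrite e // mulrCA.
Qed.

Lemma weak_derivative_ae l v w1 w2 r :
  is_weak_derivative l v w1 -> is_weak_derivative l v w2 ->
  ae_eq lebesgue5 (ball (0 : R5) r) (fun x => (w1 x ^+ 2)%:E) (fun x => (w2 x ^+ 2)%:E).
Proof.
move=> [h1 e1] [h2 e2].
have L : L2loc (fun x => w1 x + (-1) * w2 x) by apply: L2locD => //; exact: L2locZ.
have := @orthogonal_test_ae0 _ r L.
have H phi : test_function phi -> \int[lebesgue5]_(x in setT) ((w1 x + (-1) * w2 x) * phi x) = 0.
  move=> tp; have i1 := L2loc_test_integrable h1 tp; have i2 := L2loc_test_integrable h2 tp.
  under eq_Rintegral do rewrite mulN1r mulrBl.
  rewrite RintegralB //; apply/eqP; rewrite subr_eq0; apply/eqP.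
  have s0 : (-1) ^+ size l != 0 :> R by rewrite expf_neq0 // oppr_eq0 oner_eq0.
  by apply: (mulfI s0); rewrite -e1 // e2.
move=> /(_ H); apply: filterS => x h /h /= [].
by move/eqP; rewrite mulN1r subr_eq0 => /eqP ->.
Qed.

(** This frees [sobolev_norm] from the choice made in [weak_derivative]: any representative computes
    the same integrals. *)
Lemma weak_derivative_integral l v w1 w2 r :
  is_weak_derivative l v w1 -> is_weak_derivative l v w2 ->
  (\int[lebesgue5]_(x in ball (0%R : R5) r) (w1 x ^+ 2)%:E =
   \int[lebesgue5]_(x in ball (0%R : R5) r) (w2 x ^+ 2)%:E)%E.
Proof.
move=> h1 h2; apply: ae_eq_integral (weak_derivative_ae r h1 h2).
- exact: measurable_ball5.
- by apply/measurable_EFinP/measurable_funTS/measurable_funX; exact: h1.1.1.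
- by apply/measurable_EFinP/measurable_funTS/measurable_funX; exact: h2.1.1.
Qed.

End Fundamental.

(** * Sobolev embedding *)

Section Mollifier.
Variable R : realType.
Local Notation mu := (@lebesgue_measure R).

Lemma smooth1_derivable (f : R -> R) (t : R) : smooth1 f -> derivable f t 1.
Proof. by move=> h; apply/derivable1_diffP; exact: (h [::] t). Qed.

Lemma smooth1_derive (f : R -> R) : smooth1 f -> smooth1 ('D_1 f).
Proof. by move=> h; exact: (smooth_derive tt h). Qed.

Lemma smooth1_continuous (f : R -> R) : smooth1 f -> continuous f.
Proof. by move=> h; exact: (smooth_continuous h). Qed.

Lemma derive_near_cst (f : R -> R) (k t : R) : (\near t, f t = k) -> 'D_1 f t = 0.
Proof.
move=> h; have E : \near t, cst k t = f t by apply: filterS h => z ->.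
by have [_ ->] := near_eq_is_derive E (is_derive_cst k t (1 : R)).
Qed.

Section Line.
Variables (c : R) (n : nat).

(** A smooth Heaviside function rising on [c, c + 1/(n+1)]; its derivative [delta] is a one-sided
    approximation of the Dirac mass at c. *)
Definition sstep (t : R) : R := step (n.+1%:R * (t - c)).

Lemma sstep_smooth : smooth1 sstep.
Proof.
apply: (smooth1_comp (@step_smooth R)).
rewrite (_ : (fun x => _) = (fun x => n.+1%:R * x + (- n.+1%:R * c))); first exact: smooth1_affine.
by apply/funext => x; ring.
Qed.

Lemma sstep_bound t : `|sstep t| <= 1.
Proof. by rewrite ger0_norm ?step_ge0 // step_le1. Qed.

Definition delta : R -> R := 'D_1 sstep.

Lemma delta_smooth : smooth1 delta.
Proof. exact: smooth1_derive sstep_smooth. Qed.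

Lemma delta_ge0 t : 0 <= delta t.
Proof.
have hn : 0 < n.+1%:R :> R by rewrite ltr0n.
have h1 : is_derive t 1 (fun x => n.+1%:R * (x - c)) n.+1%:R.
  have := is_deriveZ n.+1%:R (is_deriveD (is_derive_id t (1 : R)) (is_derive_cst (- c) t (1 : R))).
  by rewrite addr0 -[_ *: 1]/(_ * 1) mulr1.
have h2 : is_derive (n.+1%:R * (t - c)) 1 step ('D_1 step (n.+1%:R * (t - c))).
  by apply: derivableP; apply: smooth1_derivable; exact: step_smooth.
have h3 := @is_derive1_comp _ step (fun x => n.+1%:R * (x - c)) t _ _ h2 h1.
have [_ e] := h3; rewrite (e : delta t = _).
by rewrite mulr_ge0 ?step_derive_ge0 // ltW.
Qed.

Lemma delta_eq0 t : ~ (c <= t <= c + n.+1%:R^-1) -> delta t = 0.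
Proof.
have hn : 0 < n.+1%:R :> R by rewrite ltr0n.
move=> /negP; rewrite negb_and -!ltNge => /orP[h|h].
  apply: (@derive_near_cst _ 0); near=> z; rewrite /sstep step_eq0 // pmulr_rle0 // subr_le0 ltW //.
  by near: z; exact: lt_nbhsl.
apply: (@derive_near_cst _ 1); near=> z; rewrite /sstep step_eq1 //.
rewrite mulrC -ler_pdivrMr // mul1r lerBrDl ltW //.
by near: z; exact: lt_nbhsr.
Unshelve. all: by end_near.
Qed.

Lemma integral_delta : (\int[mu]_t (delta t)%:E = 1)%E.
Proof.
have hn : 0 < n.+1%:R :> R by rewrite ltr0n.
have cc : c < c + n.+1%:R^-1 by rewrite ltrDl invr_gt0.
have cF := smooth1_continuous sstep_smooth.
have := @continuous_FTC2 R delta sstep c (c + n.+1%:R^-1) cc.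
have -> : sstep c = 0 by rewrite /sstep subrr mulr0 step_eq0.
have -> : sstep (c + n.+1%:R^-1) = 1.
  by rewrite /sstep [c + _]addrC addrK mulfV ?gt_eqF // step_eq1.
rewrite sube0 => ftc.
transitivity (\int[mu]_(t in `[c, (c + n.+1%:R^-1)%R]%classic) (delta t)%:E)%E; last apply: ftc.
- rewrite [RHS]integral_mkcond; apply: eq_integral => t _; rewrite patchE.
  case: ifPn => // /negP; rewrite inE /= in_itv /= => h.
  by rewrite delta_eq0.
- by apply: continuous_subspaceT; exact: smooth1_continuous delta_smooth.
- split; first by move=> t _; apply: smooth1_derivable; exact: sstep_smooth.
  + by apply: cvg_at_right_filter; exact: cF.
  + by apply: cvg_at_left_filter; exact: cF.
- by move=> t _; rewrite derive1E.
Qed.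

(** Equal to 1 on [c, c + 1], off which [delta] vanishes for every n, and zero off [c - 1, c + 2];
    it depends on c only by translation. *)
Definition cutoff (t : R) : R := step (t - c + 1) * step (2 - (t - c)).

Lemma cutoff_smooth : smooth1 cutoff.
Proof.
apply: smoothM; apply: (smooth1_comp (@step_smooth R)).
- rewrite (_ : (fun x => _) = (fun x => 1 * x + (1 - c))); first exact: smooth1_affine.
  by apply/funext => x; ring.
- rewrite (_ : (fun x => _) = (fun x => (-1) * x + (2 + c))); first exact: smooth1_affine.
  by apply/funext => x; ring.
Qed.

Lemma cutoff_bound t : `|cutoff t| <= 1.
Proof.
rewrite ger0_norm; last by apply: mulr_ge0; exact: step_ge0.
by apply: mulr_ile1; rewrite ?step_ge0 ?step_le1.
Qed.

Lemma cutoff_eq1 t : c <= t <= c + 1 -> cutoff t = 1.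
Proof. by move=> /andP[h1 h2]; rewrite /cutoff !step_eq1 ?mulr1 //; lra. Qed.

Lemma cutoff_eq0 t : ~ (c - 1 <= t <= c + 2) -> cutoff t = 0.
Proof.
move=> /negP; rewrite negb_and -!ltNge => /orP[h|h]; rewrite /cutoff.
  by rewrite step_eq0 ?mul0r //; lra.
by rewrite [X in _ * X]step_eq0 ?mulr0 //; lra.
Qed.

Lemma dcutoff_eq0 t : ~ (c - 1 <= t <= c + 2) -> 'D_1 cutoff t = 0.
Proof.
move=> /negP; rewrite negb_and -!ltNge => /orP[h|h].
  apply: (@derive_near_cst _ 0); near=> z; apply: cutoff_eq0 => /andP[h1 _].
  have : z < c - 1 by near: z; exact: lt_nbhsl.
  by rewrite ltNge h1.
apply: (@derive_near_cst _ 0); near=> z; apply: cutoff_eq0 => /andP[_ h1].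
have : c + 2 < z by near: z; exact: lt_nbhsr.
by rewrite ltNge h1.
Unshelve. all: by end_near.
Qed.

(* [delta] is unbounded as [n] grows, but equals ['D_1 hat + rest] with [hat] and [rest]
   bounded uniformly in [n]; its tensor power [rho] is thus a sum of mixed derivatives of
   bounded functions. *)
Definition hat (t : R) : R := sstep t * cutoff t.
Definition rest (t : R) : R := - (sstep t * 'D_1 cutoff t).

Lemma hat_smooth : smooth1 hat.
Proof. by apply: smoothM; [exact: sstep_smooth|exact: cutoff_smooth]. Qed.

Lemma rest_smooth : smooth1 rest.
Proof.
apply: smoothN; apply: smoothM; first exact: sstep_smooth.
exact: smooth1_derive cutoff_smooth.
Qed.

Lemma delta_decomposition t : delta t = 'D_1 hat t + rest t.
Proof.
have := deriveM (@smooth1_derivable _ t sstep_smooth) (@smooth1_derivable _ t cutoff_smooth).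
rewrite /GRing.scale /= => e; rewrite (e : 'D_1 hat t = sstep t * 'D_1 cutoff t + cutoff t * delta t) /rest addrAC subrr add0r.
have [h|h] := pselect (c <= t <= c + n.+1%:R^-1); last by rewrite (delta_eq0 h) mulr0.
rewrite cutoff_eq1 ?mul1r //; case/andP: h => -> h /=; apply: le_trans h _.
by rewrite lerD2l invf_le1 ?ltr0n // ler1n.
Qed.

Lemma hat_bound t : `|hat t| <= 1.
Proof. by rewrite normrM mulr_ile1 // ?sstep_bound ?cutoff_bound. Qed.

Lemma rest_bound M : (forall t, `|'D_1 cutoff t| <= M) -> forall t, `|rest t| <= M.
Proof.
move=> h t; rewrite normrN normrM -[M]mul1r.
by rewrite ler_pM // sstep_bound.
Qed.

Lemma hat_eq0 t : ~ (c - 1 <= t <= c + 2) -> hat t = 0.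
Proof. by move=> /cutoff_eq0 h; rewrite /hat h mulr0. Qed.

Lemma rest_eq0 t : ~ (c - 1 <= t <= c + 2) -> rest t = 0.
Proof. by move=> /dcutoff_eq0 h; rewrite /rest h mulr0 oppr0. Qed.
End Line.

(** Translation reduces this to c = 0 and a compact interval. The lower bound on M lets one constant
    serve for [hat] as well as for [rest]. *)
Lemma dcutoff_bounded : exists2 M, 1 <= M & forall c t, `|'D_1 (cutoff c) t| <= M.
Proof.
have c0 := smooth1_continuous (smooth1_derive (cutoff_smooth 0)).
have : compact ('D_1 (cutoff 0) @` seg 3).
  by apply: continuous_compact; [exact: continuous_subspaceT|exact: segment_compact].
move=> /compact_bounded [M [_ hM]]; exists (`|M| + 1); first by rewrite lerDr.
move=> c t.
have -> : 'D_1 (cutoff c) t = 'D_1 (cutoff 0) (t - c).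
  have E : (fun h : R => h^-1 *: ((cutoff c \o shift t) (h *: 1) - cutoff c t)) =
    (fun h : R => h^-1 *: ((cutoff 0 \o shift (t - c)) (h *: 1) - cutoff 0 (t - c))).
    by apply/funext => h /=; rewrite /cutoff !subr0 addrA.
  by rewrite /derive E.
have [h|h] := pselect (seg 3 (t - c)).
  by apply: (hM (`|M| + 1)); [rewrite (le_lt_trans (ler_norm M)) ?ltrDl|exists (t - c)].
rewrite dcutoff_eq0 ?normr0 ?addr_ge0 //.
by move=> /andP[h1 h2]; apply: h; rewrite /seg /= in_itv /=; lra.
Qed.
End Mollifier.

(** * Product densities and the mollifier on R^5 *)

Section TensorDensity.
Context d1 d2 (T1 : measurableType d1) (T2 : measurableType d2) (R : realType).
Variables (m1 : {sigma_finite_measure set T1 -> \bar R}) (m2 : {sigma_finite_measure set T2 -> \bar R}).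

Definition density d (T : measurableType d) (m : {measure set T -> \bar R}) (F : T -> R) :=
  [/\ measurable_fun setT F, forall x, 0 <= F x & (\int[m]_x (F x)%:E = 1)%E].

Lemma density_tensor F G : density m1 F -> density m2 G ->
  density (m1 \x m2)%E (fun z => F z.1 * G z.2).
Proof.
move=> [mF F0 F1] [mG G0 G1].
have mz : measurable_fun [set: T1 * T2] (fun z => F z.1 * G z.2).
  by apply: measurable_funM; apply: measurableT_comp.
split => //; first by move=> z; rewrite mulr_ge0.
rewrite fubini_tonelli1; last 2 first.
- exact/measurable_EFinP.
- by move=> z; rewrite lee_fin mulr_ge0.
rewrite -[RHS]F1; apply: eq_integral => x _; rewrite /fubini_F /=.
under eq_integral do rewrite EFinM.
rewrite ge0_integralZl //; last 3 first.
- exact/measurable_EFinP.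
- by move=> y _; rewrite lee_fin.
- by rewrite lee_fin.
by rewrite G1 mule1.
Qed.
End TensorDensity.

Section Embedding.
Variable R : realType.
Local Notation R5 := (R5 R).
Local Notation mu := (@lebesgue_measure R).
Local Notation lebesgue5 := (@lebesgue5 R).

Lemma prodfE (f : 'I_5 -> R -> R) : prodf f =
  (fun z : R5 => f 0 z.1.1.1.1 * f 1 z.1.1.1.2 * f 2 z.1.1.2 * f 3 z.1.2 * f 4 z.2).
Proof.
apply/funext => -[[[[x0 x1] x2] x3] x4]; rewrite /prodf !big_ord_recr big_ord0 /= mul1r /coordinate /=.
by do ![congr (_ * _)]; congr (f _ _); exact: val_inj.
Qed.

Lemma integral_prodf_density (f : 'I_5 -> R -> R) : (forall i, density mu (f i)) ->
  (\int[lebesgue5]_x (prodf f x)%:E = 1)%E.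
Proof.
move=> h; rewrite prodfE.
have h2 : density (@m2 R) (fun z : (measurableTypeR R * measurableTypeR R)%type => f 0 z.1 * f 1 z.2).
  exact: (density_tensor (m1 := mu) (m2 := mu) (h 0) (h 1)).
have h3 : density (@m3 R) (fun z : (measurableTypeR R * measurableTypeR R * measurableTypeR R)%type => f 0 z.1.1 * f 1 z.1.2 * f 2 z.2).
  exact: (density_tensor (m1 := @m2 R) (m2 := mu) h2 (h 2)).
have h4 : density (@m4 R) (fun z : (measurableTypeR R * measurableTypeR R * measurableTypeR R * measurableTypeR R)%type => f 0 z.1.1.1 * f 1 z.1.1.2 * f 2 z.1.2 * f 3 z.2).
  exact: (density_tensor (m1 := @m3 R) (m2 := mu) h3 (h 3)).
have [_ _ I] := density_tensor (m1 := @m4 R) (m2 := mu) h4 (h 4).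
exact: I.
Qed.

Lemma delta_density c n : density mu (delta c n : R -> R).
Proof.
split; [|exact: delta_ge0|exact: integral_delta].
by apply: continuous_measurable_fun; exact: smooth1_continuous (@delta_smooth _ c n).
Qed.

Lemma partials_prodf (f : 'I_5 -> R -> R) l : uniq l -> (forall i, smooth1 (f i)) ->
  partials l (prodf f) = prodf (fun i => if i \in l then 'D_1 (f i) else f i).
Proof.
move=> ul sf; elim: l ul => [|i l IH] //= /andP[il ul].
rewrite IH //; apply/funext => y; rewrite prodf_derive; last first.
  by move=> j; case: ifP => _ //; exact: smooth1_derive.
congr (prodf _ y); apply/funext => j; rewrite inE.
by case: eqP => [->|//]; rewrite (negbTE il).
Qed.

Section Point.
Variables (x : R5) (n : nat) (r : R).
Hypothesis xr : box r x.
Let c i := coordinate i x.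

Definition rho : R5 -> R := prodf (fun i => delta (c i) n).
Definition piece (S : {set 'I_5}) : R5 -> R :=
  prodf (fun i => if i \in S then hat (c i) n else rest (c i) n).

Lemma piece_factor_smooth (S : {set 'I_5}) i : smooth1 (if i \in S then hat (c i) n else rest (c i) n).
Proof. by case: ifP => _; [exact: hat_smooth|exact: rest_smooth]. Qed.

Lemma piece_factor_eq0 (S : {set 'I_5}) i t : ~ seg (r + 2) t -> (if i \in S then hat (c i) n else rest (c i) n) t = 0.
Proof.
move=> ht; have h : ~ (c i - 1 <= t <= c i + 2).
  move=> /andP[h1 h2]; apply: ht; have := (coordinate_box r x).1 xr i.
  by rewrite /seg /= !in_itv /= -/(c i) => /andP[h3 h4]; lra.
by case: ifP => _; [exact: hat_eq0|exact: rest_eq0].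
Qed.

Lemma piece_test S : test_function (piece S).
Proof. by apply: (@prodf_test _ _ (r + 2)) => i; [exact: piece_factor_smooth|exact: piece_factor_eq0]. Qed.

(** The cutoffs reach at most 2 beyond the coordinates of x, and one more unit passes from the
    closed box to an open ball. *)
Lemma piece_eq0 S y : ~ ball (0 : R5) (r + 3) y -> piece S y = 0.
Proof.
move=> yb; apply: (@prodf_box _ _ (r + 2)); first by move=> i; exact: piece_factor_eq0.
move=> yr; apply: yb.
have h (t : R) : seg (r + 2) t -> ball (0 : R) (r + 3) t.
  by rewrite /ball /= sub0r normrN /seg /= in_itv /= -ler_norml => h; rewrite (le_lt_trans h) //; lra.
by move: y yr => [[[[x0 x1] x2] x3] x4] [[[[h0 h1] h2] h3] h4]; do ?split; exact: h.
Qed.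

Lemma piece_bound M S y : 1 <= M -> (forall c t, `|'D_1 (cutoff c) t : R| <= M) -> `|piece S y| <= M ^+ 5.
Proof.
move=> M1 hM; rewrite /piece /prodf normr_prod.
apply: (@le_trans _ _ (\prod_(i < 5) M)); last by rewrite prodr_const card_ord.
apply: ler_prod => i _; rewrite normr_ge0 /=; case: ifP => _.
  by apply: le_trans (hat_bound _ _ _) _.
exact: rest_bound.
Qed.

(** The product over the directions of ['D_1 hat + rest] is expanded: S is the set of directions
    that carry a derivative, each at most once, so the order is at most 5. *)
Lemma rho_pieces y : rho y = \sum_(S : {set 'I_5}) partials (enum S) (piece S) y.
Proof.
rewrite /rho /prodf; under eq_bigr do rewrite delta_decomposition.
rewrite bigA_distr; apply: eq_bigr => S _.
rewrite /piece partials_prodf ?enum_uniq //; last exact: piece_factor_smooth.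
by apply: eq_bigr => i _; rewrite mem_enum; case: ifP.
Qed.

(** All derivatives move onto v; the functions that remain are bounded uniformly in n, unlike [rho]
    itself. *)
Lemma integral_rho (v : R5 -> R) s : (5 <= s)%N -> continuous v -> Hloc s v ->
  \int[lebesgue5]_(y in setT) (v y * rho y) =
  \sum_(S : {set 'I_5}) (-1) ^+ #|S| * \int[lebesgue5]_(y in setT) (weak_derivative (enum S) v y * piece S y).
Proof.
move=> s5 cv hv.
have wd (S : {set 'I_5}) : is_weak_derivative (enum S) v (weak_derivative (enum S) v).
  rewrite /weak_derivative; apply: xgetPex; apply: hv.
  by rewrite -cardE (leq_trans _ s5) // (leq_trans (max_card _)) // card_ord.
have tp (S : {set 'I_5}) : test_function (partials (enum S) (piece S)).
  have [sp [K /compact_sub_box[r' r0 Kr] p0]] := piece_test S.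
  split; first exact: (smooth_dirs (enum S) sp).
  exists (box r'); first exact: compact_box.
  by apply: partials_box => // z xb; apply: p0 => /Kr.
transitivity (\int[lebesgue5]_(y in setT) (\sum_(S : {set 'I_5}) v y * partials (enum S) (piece S) y)).
  by apply: eq_Rintegral => y _; rewrite rho_pieces mulr_sumr.
have Lv := continuous_L2loc cv.
have iS (S : {set 'I_5}) := L2loc_test_integrable Lv (tp S).
rewrite /Rintegral; under eq_integral do rewrite -sumEFin.
rewrite integral_sum // -sum_fine; last first.
  by move=> S _; apply: integrable_fin_num => //; exact: iS.
by apply: eq_bigr => S _; have [_ e] := wd S; have := e _ (piece_test S); rewrite -cardE.
Qed.
End Point.
End Embedding.

Lemma Rintegral_extend0 d (T : measurableType d) (R : realType) (m : {measure set T -> \bar R})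
  (A : set T) (f : T -> R) : (forall x, ~ A x -> f x = 0) ->
  \int[m]_(x in setT) f x = \int[m]_(x in A) f x.
Proof.
move=> f0; rewrite /Rintegral [in RHS]integral_mkcond; congr fine; apply: eq_integral => x _.
by rewrite patchE; case: ifPn => // /negP; rewrite inE => /f0 ->.
Qed.

Lemma card_set5 : #|{set 'I_5}| = 32%N.
Proof. by rewrite -finset.cardsT -finset.powersetT card_powerset finset.cardsT card_ord. Qed.

(** * Pointwise bounds from the Sobolev norm *)

Section Embedding.
Variable R : realType.
Local Notation R5 := (R5 R).
Local Notation lebesgue5 := (@lebesgue5 R).
Local Notation ball0 r := (ball (0%R : R5) r).

Lemma sqrte_lt (S : \bar R) (eps : R) : (0 <= S)%E -> 0 < eps -> (S `^ 2^-1 < eps%:E)%E -> (S < (eps ^+ 2)%:E)%E.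
Proof.
move=> S0 e0; rewrite poweR12_sqrt //; case: S S0 => [s| |] //=.
  rewrite !lee_fin !lte_fin => s0 h.
  by rewrite -(sqr_sqrtr s0) ltrXn2r // nnegrE ?sqrtr_ge0 // ltW.
Qed.

Lemma lt_sqrte (S : \bar R) (eps : R) : (0 <= S)%E -> 0 < eps -> (S < (eps ^+ 2)%:E)%E -> (S `^ 2^-1 < eps%:E)%E.
Proof.
move=> S0 e0; rewrite poweR12_sqrt //; case: S S0 => [s| |] //=.
rewrite !lee_fin !lte_fin => s0 h.
have e2 : 0 < eps ^+ 2 by rewrite exprn_gt0.
by rewrite -(ger0_norm (ltW e0)) -sqrtr_sqr ltr_sqrt.
Qed.

Definition energy (s : nat) (r : R) (v : R5 -> R) : \bar R :=
  (\sum_(k < s.+1) \sum_(l : k.-tuple 'I_5)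
      \int[lebesgue5]_(x in ball0 r) (weak_derivative l v x ^+ 2)%:E)%E.

Lemma integral_square_ge0 r (w : R5 -> R) : (0 <= \int[lebesgue5]_(x in ball0 r) (w x ^+ 2)%:E)%E.
Proof. by apply: integral_ge0 => x _; rewrite lee_fin sqr_ge0. Qed.

Lemma energy_ge0 s r v : (0 <= energy s r v)%E.
Proof. by apply: sume_ge0 => k _; apply: sume_ge0 => l _; exact: integral_square_ge0. Qed.

Lemma energy_term s r v (l : seq 'I_5) : (size l <= s)%N ->
  (\int[lebesgue5]_(x in ball0 r) (weak_derivative l v x ^+ 2)%:E <= energy s r v)%E.
Proof.
move=> ls; rewrite /energy (bigD1 (Ordinal (ls : (size l < s.+1)%N))) //= (bigD1 (in_tuple l)) //=.
rewrite -addeA leeDl // adde_ge0 //; first by apply: sume_ge0 => ? _; exact: integral_square_ge0.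
by apply: sume_ge0 => k _; apply: sume_ge0 => ? _; exact: integral_square_ge0.
Qed.

Section Bound.
Variables (r : R) (v : R5 -> R) (s : nat).
Hypotheses (s5 : (5 <= s)%N) (cv : continuous v) (hv : Hloc s v).
Variables (M d e : R).
Hypotheses (M1 : 1 <= M) (hM : forall c t, `|'D_1 (cutoff c) t : R| <= M) (d0 : 0 < d) (e0 : 0 < e).
Hypothesis ve : (sobolev_norm s (r + 3) v < e%:E)%E.

Let V := fine (lebesgue5 (ball0 (r + 3))).

(** In place of the Cauchy-Schwarz inequality, |w| <= d + w^2 / d is integrated over a ball off
    which [piece] vanishes; d is tuned later. *)
Lemma weak_piece_bound x n (S : {set 'I_5}) : box r x ->
  `|\int[lebesgue5]_(y in setT) (weak_derivative (enum S) v y * piece x n S y)| <=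
  M ^+ 5 * (d * V + d^-1 * e ^+ 2).
Proof.
move=> xr; set w := weak_derivative _ _; set B := ball0 (r + 3).
have M0 : 0 <= M ^+ 5 by rewrite exprn_ge0 // (le_trans ler01).
have Ss : (size (enum S) <= s)%N by rewrite -cardE (leq_trans _ s5) // (leq_trans (max_card _)) // card_ord.
have [Lw _] : is_weak_derivative (enum S) v w by rewrite /w /weak_derivative; apply: xgetPex; exact: hv.
have iw := L2loc_test_integrable Lw (piece_test n xr S).
have mB : measurable B := measurable_ball5 (r + 3).
apply: le_trans (le_normr_Rintegral measurableT iw) _.
rewrite (@Rintegral_extend0 _ _ _ lebesgue5 B); last first.
  by move=> y yB; rewrite (piece_eq0 n xr S yB) mulr0 normr0.
have i2 := L2loc_square (r + 3) Lw.
have i1 := cst_integrable_ball 1 (r + 3).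
have I2 : \int[lebesgue5]_(y in B) (w y ^+ 2) <= e ^+ 2.
  rewrite -lee_fin fineK; last by apply: integrable_fin_num => //; exact: i2.
  apply: le_trans (energy_term (r + 3) v Ss) _.
  by apply: ltW; apply: sqrte_lt => //; exact: energy_ge0.
have iD : lebesgue5.-integrable B (EFin \o (fun y => M ^+ 5 * (d * 1 + d^-1 * w y ^+ 2))).
  rewrite (_ : EFin \o _ = fun y => ((M ^+ 5)%:E * ((d%:E * 1%:E) + (d^-1%:E * (w y ^+ 2)%:E)))%E) //.
  by apply: integrableZl => //; apply: integrableD => //; apply: integrableZl.
apply: (@le_trans _ _ (\int[lebesgue5]_(y in B) (M ^+ 5 * (d * 1 + d^-1 * w y ^+ 2)))).
  apply: le_Rintegral => //.
    have := integrable_norm iw; rewrite /= => ii.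
    by apply: (integrableS measurableT).
  move=> y _; rewrite normrM mulrC ler_pM //; first exact: piece_bound.
  rewrite mulr1 -[w y ^+ 2]real_normK ?num_real //.
  have a0 := normr_ge0 (w y); set a := `|w y| in a0 *.
  have [ad|da] := lerP a d; first by rewrite ler_wpDr // mulr_ge0 ?sqr_ge0 // invr_ge0 ltW.
  rewrite ler_wpDl ?(ltW d0) // mulrC ler_pdivlMr // expr2.
  by apply: ler_wpM2l => //; exact: ltW.
rewrite RintegralZl //; last first.
  by rewrite (_ : EFin \o _ = fun y => ((d%:E * 1%:E) + (d^-1%:E * (w y ^+ 2)%:E))%E) //;
    apply: integrableD => //; apply: integrableZl.
rewrite ler_wpM2l // RintegralD //; last 2 first.
- exact: (cst_integrable_ball (d * 1) (r + 3)).
- by rewrite (_ : EFin \o _ = fun y => (d^-1%:E * (w y ^+ 2)%:E)%E) //; apply: integrableZl.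
have E1 : \int[lebesgue5]_(y in B) (d * 1) = d * V by rewrite Rintegral_cst //= mulr1.
have E2 : \int[lebesgue5]_(y in B) (d^-1 * w y ^+ 2) = d^-1 * \int[lebesgue5]_(y in B) (w y ^+ 2).
  exact: RintegralZl.
by rewrite E1 E2 lerD // ler_wpM2l ?invr_ge0 ?(ltW d0).
Qed.

(** The value at x is compared with the mean of v against [rho]. The n required depends on the
    continuity of v at x, but the bound on the mean does not depend on n. The factor 32 counts the
    subsets of the five directions. *)
Lemma sup_bound x eta : 0 < eta -> box r x ->
  `|v x| <= eta + 32 * (M ^+ 5 * (d * V + d^-1 * e ^+ 2)).
Proof.
move=> eta0 xr.
have : \forall y \near x, `|v x - v y| < eta by have /cvgrPdist_lt := cv (x := x); exact.
move=> /nbhs_ballP[a /= a0 ha].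
have [n hn] : exists n, n.+1%:R^-1 < a :> R.
  exists (Num.bound a^-1); rewrite invf_plt ?posrE //.
  apply: (@lt_trans _ _ (Num.bound a^-1)%:R); last by rewrite ltr_nat.
  by apply: archi_boundP; rewrite invr_ge0 ltW.
pose rh := rho x n.
have rh0 y : 0 <= rh y by apply: prodr_ge0 => i _; exact: delta_ge0.
have rhE : (\int[lebesgue5]_y (rh y)%:E = 1)%E.
  by apply: integral_prodf_density => i; exact: delta_density.
have rhx y : rh y != 0 -> forall i, coordinate i x <= coordinate i y <= coordinate i x + n.+1%:R^-1.
  move=> h i; apply: contrapT => hi; move/negP: h; apply.
  by rewrite /rh /rho /prodf (bigD1 i) //= delta_eq0 // mul0r.
have rhball y : rh y != 0 -> ball x a y.
  move=> /rhx h; have {}h i : ball (coordinate i x) a (coordinate i y).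
    rewrite /ball /= ltr_norml; have /andP[h1 h2] := h i.
    have := hn; move: (n.+1%:R^-1) h2 => z h2 hz; apply/andP; split; lra.
  case: x y h {xr ha rh rh0 rhE rhx} => [[[[x0 x1] x2] x3] x4] [[[[y0 y1] y2] y3] y4] h.
  split; [split; [split; [split|]|]|].
  - exact: (h 0). - exact: (h 1). - exact: (h 2). - exact: (h 3). - exact: (h 4).
have crh : continuous rh.
  by apply: (smooth_continuous (e := basis5 R : 'I_5 -> R5)); apply: prodf_smooth => i; exact: delta_smooth.
have rhout y : ~ box (r + 1) y -> rh y = 0.
  move=> yb; apply/eqP/negP => /negP h; apply: yb; apply/coordinate_box => i.
  have /andP[h1 h2] := rhx _ h i; have := (coordinate_box r x).1 xr i.
  rewrite /seg /= !in_itv /= => /andP[h3 h4].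
  have n1 : n.+1%:R^-1 <= 1 :> R by rewrite invf_le1 ?ltr0n // ler1n.
  by move: (n.+1%:R^-1) h2 n1 => z h2 hz; apply/andP; split; lra.
have icont (u : R5 -> R) : continuous u -> lebesgue5.-integrable setT (EFin \o (fun y => u y * rh y)).
  move=> cu; apply: dominated_integrable; apply: (@continuous_dominated _ _ (r + 1)).
    by move=> y; apply: continuousM; [exact: cu|exact: crh].
  by move=> y /rhout ->; rewrite mulr0.
have ccst (k : R) : continuous (fun _ : R5 => k) by move=> y; exact: cvg_cst.
have irh k : \int[lebesgue5]_(y in setT) (k * rh y) = k.
  rewrite RintegralZl //; last by have := icont _ (ccst 1); under eq_fun do rewrite mul1r.
  by rewrite /Rintegral rhE mulr1.
have main : `|v x - \int[lebesgue5]_(y in setT) (v y * rh y)| <= eta.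
  rewrite -{1}(irh (v x)) -RintegralB //; last 2 first.
  - exact: icont.
  - exact: icont.
  under eq_Rintegral do rewrite -mulrBl.
  have iB : lebesgue5.-integrable setT (EFin \o (fun y => (v x - v y) * rh y)).
    by apply: icont => y; apply: continuousB; [exact: cvg_cst|exact: cv].
  apply: le_trans (le_normr_Rintegral measurableT iB) _.
  rewrite -[leRHS](irh eta); apply: le_Rintegral => //.
  - exact: (integrable_norm iB).
  - exact: icont.
  - move=> y _; rewrite normrM (ger0_norm (rh0 y)).
    have [->|h] := eqVneq (rh y) 0; first by rewrite !mulr0.
    by rewrite ler_wpM2r // ltW // ha //; exact: rhball.
have sumb : `|\int[lebesgue5]_(y in setT) (v y * rh y)| <= 32 * (M ^+ 5 * (d * V + d^-1 * e ^+ 2)).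
  rewrite /rh (integral_rho n xr s5 cv hv); apply: le_trans (ler_norm_sum _ _ _) _.
  apply: (@le_trans _ _ (\sum_(S : {set 'I_5}) (M ^+ 5 * (d * V + d^-1 * e ^+ 2)))).
    by apply: ler_sum => S _; rewrite normrM normrX normrN1 expr1n mul1r; exact: weak_piece_bound.
  by rewrite sumr_const card_set5 mulr_natl.
rewrite -[v x](subrK (\int[lebesgue5]_(y in setT) (v y * rh y))).
by apply: le_trans (ler_normD _ _) _; exact: lerD.
Qed.

End Bound.

Theorem sobolev_embedding (r tol : R) : 0 < tol -> exists2 e, 0 < e &
  forall s v, (5 <= s)%N -> continuous v -> Hloc s v -> (sobolev_norm s (r + 3) v < e%:E)%E ->
  forall x, box r x -> `|v x| <= tol.
Proof.
move=> tol0; have [M M1 hM] := dcutoff_bounded R.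
have M0 : 0 < M ^+ 5 by rewrite exprn_gt0 // (lt_le_trans ltr01).
set V := fine (lebesgue5 (ball0 (r + 3))).
have V0 : 0 <= V by apply: fine_ge0.
have V1 : 0 < V + 1 by rewrite ltr_wpDl.
have K1 : 0 < 256 * M ^+ 5 by rewrite mulr_gt0 // ltr0n.
have K0 : 0 < 256 * M ^+ 5 * (V + 1) by rewrite mulr_gt0.
(* With this d and the e below, the terms 32 M^5 d V and 32 M^5 e^2 / d are each at most tol / 8,
   while eta takes tol / 2. Adding 1 to V avoids a division by zero. *)
pose d := tol / (256 * M ^+ 5 * (V + 1)).
have d0 : 0 < d by rewrite divr_gt0.
pose e := Num.sqrt (d * (tol / (256 * M ^+ 5))).
have e20 : 0 < d * (tol / (256 * M ^+ 5)) by rewrite mulr_gt0 // divr_gt0.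
have e0 : 0 < e by rewrite sqrtr_gt0.
exists e => // s v s5 cv hv ve x xr.
have h := sup_bound s5 cv hv M1 hM d0 e0 ve _ xr (eta := tol / 2).
apply: le_trans (h _) _; first by rewrite divr_gt0.
rewrite -/V sqr_sqrtr ?ltW // mulKf ?gt_eqF //.
have dV : M ^+ 5 * (d * V) <= tol / 256.
  rewrite /d.
  have -> : M ^+ 5 * (tol / (256 * M ^+ 5 * (V + 1)) * V) = tol / 256 * (V / (V + 1)).
    by field; rewrite !gt_eqF // (lt_le_trans ltr01).
  by rewrite ler_piMr ?divr_ge0 ?(ltW tol0) // ler_pdivrMr // mul1r lerDl.
have -> : 32 * (M ^+ 5 * (d * V + tol / (256 * M ^+ 5))) = 32 * (M ^+ 5 * (d * V)) + tol / 8.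
  by field; rewrite gt_eqF // (lt_le_trans ltr01).
move: dV; move: (M ^+ 5 * (d * V)) => X hX; clear - tol0 hX.
by lra.
Qed.
End Embedding.

(** * The loops in Diff(S^2 x S^3) *)

Lemma continuous_pair (X U W : topologicalType) (f : X -> U) (g : X -> W) :
  continuous f -> continuous g -> continuous (fun x => (f x, g x)).
Proof. by move=> cf cg x; apply: cvg_pair; [exact: cf|exact: cg]. Qed.

Section Continuity.
Variable R : realType.

Lemma continuous_mx (X : topologicalType) m n (f : X -> 'M[R]_(m, n)) :
  (forall i j, continuous (fun x => f x i j)) -> continuous f.
Proof.
move=> h x; apply/cvg_ballP => e e0.
have : \forall y \near x, forall i j, ball (f x i j) e (f y i j).
  apply: filter_forall => i; apply: filter_forall => j.
  by have /cvg_ballP := h i j x; apply.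
by apply: filterS => y hy; split.
Qed.

Lemma continuous_to_set_type (X Y : topologicalType) (A : set Y) (f : X -> set_type A) :
  continuous (fun x => set_val (f x)) -> continuous f.
Proof. exact: continuous_comp_initial. Qed.

Local Notation S2xS3 := (S2xS3 R).
Notation embed := (@embed R).

Lemma continuous_into_manifold (X : topologicalType) (f : X -> S2xS3) :
  (forall j, continuous (fun x => embed j (f x))) -> continuous f.
Proof.
move=> h; have c1 : continuous (fun x => (f x).1).
  apply: continuous_to_set_type; apply: continuous_mx => i j x.
  rewrite ord1; exact: (h (inl j) x).
have c2 : continuous (fun x => (f x).2).
  apply: continuous_to_set_type; apply: continuous_mx => i j x.
  rewrite ord1; exact: (h (inr j) x).
rewrite (_ : f = fun x => ((f x).1, (f x).2)); last by apply/funext => x; case: (f x).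
exact: (continuous_pair c1 c2).
Qed.

Lemma continuous_embed j : continuous (embed j).
Proof.
have c0 (n : nat) (A : set 'rV[R]_n) (i : 'I_n) : continuous (fun p : set_type A => set_val p 0 i).
  move=> p; apply: (@continuous_comp _ _ _ set_val (fun M : 'rV[R]_n => M 0 i)).
    exact: initial_continuous.
  exact: coord_continuous.
have cc (U W : topologicalType) (f : S2xS3 -> U) (g : U -> W) : continuous f -> continuous g -> continuous (g \o f).
  by move=> cf cg p; apply: continuous_comp; [exact: cf|exact: cg].
have c1 : continuous (fst : S2xS3 -> _) by move=> p; exact: cvg_fst.
have c2 : continuous (snd : S2xS3 -> _) by move=> p; exact: cvg_snd.
case: j => i.
  exact: (cc _ _ _ _ c1 (c0 _ _ i)).
exact: (cc _ _ _ _ c2 (c0 _ _ i)).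
Qed.

Lemma embed_inj (p q : S2xS3) : (forall j, embed j p = embed j q) -> p = q.
Proof.
case: p q => [p1 p2] [q1 q2] h; congr (_, _).
  by apply: val_inj; apply/rowP => i; exact: (h (inl i)).
by apply: val_inj; apply/rowP => i; exact: (h (inr i)).
Qed.

End Continuity.

(** * Multiplication by unit quaternions on S^3 *)

Section Rotation.
Variable R : realType.
Local Notation S2xS3 := (S2xS3 R).
Local Notation embed := (@embed R).
Local Notation R5 := (R5 R).
Local Notation smooth5 := (smooth (basis5 R : 'I_5 -> R5)).

Definition i3 k (h : (k < 3)%N) : 'I_(2 + 1) := Ordinal h.
Definition i4 k (h : (k < 4)%N) : 'I_(3 + 1) := Ordinal h.
Notation "x `3_ k" := (x 0 (@i3 k isT)) (at level 2).
Notation "x `4_ k" := (x 0 (@i4 k isT)) (at level 2).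

(* The quaternion product of the imaginary quaternion [x] with [q], the real part being the last coordinate. *)
Definition qact (x : 'rV[R]_(2 + 1)) (q : 'rV[R]_(3 + 1)) : 'rV[R]_(3 + 1) :=
  \row_(j < 3 + 1) match val j with
  | 0%N => x `3_ 0 * q `4_ 3 + x `3_ 1 * q `4_ 2 - x `3_ 2 * q `4_ 1
  | 1%N => x `3_ 1 * q `4_ 3 + x `3_ 2 * q `4_ 0 - x `3_ 0 * q `4_ 2
  | 2 => x `3_ 2 * q `4_ 3 + x `3_ 0 * q `4_ 1 - x `3_ 1 * q `4_ 0
  | _ => - (x `3_ 0 * q `4_ 0 + x `3_ 1 * q `4_ 1 + x `3_ 2 * q `4_ 2)
  end.

Lemma sum3 (F : 'I_(2 + 1) -> R) : \sum_i F i = F (@i3 0 isT) + F (@i3 1 isT) + F (@i3 2 isT).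
Proof. by rewrite !big_ord_recr big_ord0 /= add0r; do ![congr (_ + _)]; congr F; exact: val_inj. Qed.

Lemma sum4 (F : 'I_(3 + 1) -> R) :
  \sum_i F i = F (@i4 0 isT) + F (@i4 1 isT) + F (@i4 2 isT) + F (@i4 3 isT).
Proof. by rewrite !big_ord_recr big_ord0 /= add0r; do ![congr (_ + _)]; congr F; exact: val_inj. Qed.

Lemma row4_eq (u v : 'rV[R]_(3 + 1)) : u `4_ 0 = v `4_ 0 -> u `4_ 1 = v `4_ 1 ->
  u `4_ 2 = v `4_ 2 -> u `4_ 3 = v `4_ 3 -> u = v.
Proof.
move=> h0 h1 h2 h3; apply/rowP => -[[|[|[|[|//]]]] hi].
- by rewrite (_ : Ordinal hi = @i4 0 isT) //; exact: val_inj.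
- by rewrite (_ : Ordinal hi = @i4 1 isT) //; exact: val_inj.
- by rewrite (_ : Ordinal hi = @i4 2 isT) //; exact: val_inj.
- by rewrite (_ : Ordinal hi = @i4 3 isT) //; exact: val_inj.
Qed.

Definition rot_fun (th : R) x q := cos th *: q + sin th *: qact x q.

(** For x imaginary of norm 1, x q has the norm of q and is orthogonal to q, so the cross term in
    the expansion of the square drops out. *)
Lemma rot_funP (th : R) (x : 'rV[R]_(2 + 1)) (q : 'rV[R]_(3 + 1)) :
  x \in @sphere R 2 -> q \in @sphere R 3 -> rot_fun th x q \in @sphere R 3.
Proof.
rewrite !inE /sphere /= !sum3 !sum4 => hx hq; rewrite !mxE /=.
have cs := cos2Dsin2 th.
move: hx hq cs; set x0 := x `3_ 0; set x1 := x `3_ 1; set x2 := x `3_ 2.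
set q0 := q `4_ 0; set q1 := q `4_ 1; set q2 := q `4_ 2; set q3 := q `4_ 3.
move: (cos th) (sin th) => c s hx hq cs.
transitivity (c ^+ 2 * (q0 ^+ 2 + q1 ^+ 2 + q2 ^+ 2 + q3 ^+ 2) +
  s ^+ 2 * ((x0 ^+ 2 + x1 ^+ 2 + x2 ^+ 2) * (q0 ^+ 2 + q1 ^+ 2 + q2 ^+ 2 + q3 ^+ 2))).
  by ring.
by rewrite hx hq !mulr1.
Qed.

Definition rot (th : R) (p : S2xS3) : S2xS3 :=
  (p.1, exist _ (rot_fun th (set_val p.1) (set_val p.2)) (rot_funP th (valP p.1) (valP p.2))).

(** The coordinates of [rot th p] are affine in cos th and sin th, with this function and the next
    two as coefficients; continuity of the loops in the H^s topology rests on this form. *)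
Definition shift_part (j : 'I_(2 + 1) + 'I_(3 + 1)) (p : S2xS3) : R := match j with
  | inl i => 0
  | inr i => qact (set_val p.1) (set_val p.2) 0 i end.
Definition base_part (j : 'I_(2 + 1) + 'I_(3 + 1)) (p : S2xS3) : R := match j with
  | inl i => embed (inl i) p
  | inr i => 0 end.
Definition fixed_part (j : 'I_(2 + 1) + 'I_(3 + 1)) (p : S2xS3) : R := match j with
  | inl i => 0
  | inr i => embed (inr i) p end.

Lemma embed_rot th j p : embed j (rot th p) = base_part j p + cos th * fixed_part j p + sin th * shift_part j p.
Proof.
case: j => i /=; first by rewrite !mulr0 !addr0.
by rewrite add0r [LHS]mxE [X in X + _]mxE [X in _ + X]mxE.
Qed.

(** Since x^2 = - |x|^2 = - 1, the quaternions cos th - sin th x and cos th + sin th x have product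
    1. *)
Lemma rot_cancel th : cancel (rot th) (rot (- th)).
Proof.
move=> [x q]; congr (_, _); apply: val_inj; apply: row4_eq; rewrite /= /rot_fun cosN sinN.
all: have cs := cos2Dsin2 th; have := valP x; rewrite inE /sphere /= sum3 => hx.
all: rewrite !mxE /=; rewrite !set_valE in hx *.
all: move: hx cs; set x0 := (\val x) `3_ 0; set x1 := (\val x) `3_ 1; set x2 := (\val x) `3_ 2.
all: set q0 := (\val q) `4_ 0; set q1 := (\val q) `4_ 1; set q2 := (\val q) `4_ 2; set q3 := (\val q) `4_ 3.
all: move: (cos th) (sin th) => c s hx cs.
- transitivity ((c ^+ 2 + s ^+ 2 * (x0 ^+ 2 + x1 ^+ 2 + x2 ^+ 2)) * q0); first by ring.
  by rewrite hx mulr1 cs mul1r.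
- transitivity ((c ^+ 2 + s ^+ 2 * (x0 ^+ 2 + x1 ^+ 2 + x2 ^+ 2)) * q1); first by ring.
  by rewrite hx mulr1 cs mul1r.
- transitivity ((c ^+ 2 + s ^+ 2 * (x0 ^+ 2 + x1 ^+ 2 + x2 ^+ 2)) * q2); first by ring.
  by rewrite hx mulr1 cs mul1r.
- transitivity ((c ^+ 2 + s ^+ 2 * (x0 ^+ 2 + x1 ^+ 2 + x2 ^+ 2)) * q3); first by ring.
  by rewrite hx mulr1 cs mul1r.
Qed.

Section Charts.
Variable c : bool * bool.

Lemma smooth_sqnorm n (u : 'I_n -> 'I_5) :
  smooth5 (fun x => sqnorm (\row_(i < n) coordinate (u i) x)).
Proof.
apply: smooth_sum => i; rewrite (_ : (fun x => _) = fun x => coordinate (u i) x * coordinate (u i) x).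
  by apply: smoothM; exact: coordinate_smooth.
by apply/funext => x; rewrite mxE expr2.
Qed.

Lemma smooth_stereo n (b : bool) (u : 'I_n -> 'I_5) (j : 'I_(n + 1)) :
  smooth5 (fun x => stereo_fun b (\row_(i < n) coordinate (u i) x) 0 j).
Proof.
have sq := smooth_sqnorm u.
have sV : smooth5 (fun x => (sqnorm (\row_(i < n) coordinate (u i) x) + 1)^-1).
  apply: smoothV; last by apply: smoothD => //; exact: smooth_cst.
  move=> x; rewrite gt_eqF // ltr_wpDl // /sqnorm.
  by apply: sumr_ge0 => i _; exact: sqr_ge0.
rewrite -(fintype.splitK j); case: (fintype.split j) => k /=.
  rewrite (_ : (fun x => _) = fun x => 2 * (sqnorm (\row_(i < n) coordinate (u i) x) + 1)^-1 * coordinate (u k) x).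
    by apply: smoothM; [exact: smoothZ|exact: coordinate_smooth].
  by apply/funext => x; rewrite /stereo_fun row_mxEl !mxE.
rewrite (_ : (fun x => _) = fun x => (-1) ^+ b * (sqnorm (\row_(i < n) coordinate (u i) x) - 1) * (sqnorm (\row_(i < n) coordinate (u i) x) + 1)^-1).
  by apply: smoothM => //; apply: smoothZ; apply: smoothB => //; exact: smooth_cst.
by apply/funext => x; rewrite /stereo_fun row_mxEr !mxE.
Qed.

Lemma embed_param_smooth j : smooth5 (fun x => embed j (param c x)).
Proof.
case: j => j.
  have h := @smooth_stereo 2 c.1 (fun i : 'I_2 => widen_ord (isT : (2 <= 5)%N) i) j.
  rewrite (_ : (fun x => _) = (fun x => stereo_fun c.1 (\row_(i < 2) coordinate (widen_ord (isT : (2 <= 5)%N) i) x) 0 j)) //.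
have h := @smooth_stereo 3 c.2 (fun i : 'I_3 => rshift 2 i) j.
rewrite (_ : (fun x => _) = (fun x => stereo_fun c.2 (\row_(i < 3) coordinate (rshift 2 i) x) 0 j)) //.
Qed.

Lemma shift_part_smooth j : smooth5 (fun x => shift_part j (param c x)).
Proof.
case: j => j /=; first exact: smooth_cst.
have hx i := embed_param_smooth (inl i); have hq i := embed_param_smooth (inr i).
case: j => [[|[|[|[|//]]]] hj].
- rewrite (_ : (fun x => _) = fun x => embed (inl (@i3 0 isT)) (param c x) * embed (inr (@i4 3 isT)) (param c x)
    + embed (inl (@i3 1 isT)) (param c x) * embed (inr (@i4 2 isT)) (param c x)
    - embed (inl (@i3 2 isT)) (param c x) * embed (inr (@i4 1 isT)) (param c x)).
    by apply: smoothB; [apply: smoothD|]; apply: smoothM.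
  by apply/funext => x; rewrite mxE.
- rewrite (_ : (fun x => _) = fun x => embed (inl (@i3 1 isT)) (param c x) * embed (inr (@i4 3 isT)) (param c x)
    + embed (inl (@i3 2 isT)) (param c x) * embed (inr (@i4 0 isT)) (param c x)
    - embed (inl (@i3 0 isT)) (param c x) * embed (inr (@i4 2 isT)) (param c x)).
    by apply: smoothB; [apply: smoothD|]; apply: smoothM.
  by apply/funext => x; rewrite mxE.
- rewrite (_ : (fun x => _) = fun x => embed (inl (@i3 2 isT)) (param c x) * embed (inr (@i4 3 isT)) (param c x)
    + embed (inl (@i3 0 isT)) (param c x) * embed (inr (@i4 1 isT)) (param c x)
    - embed (inl (@i3 1 isT)) (param c x) * embed (inr (@i4 0 isT)) (param c x)).
    by apply: smoothB; [apply: smoothD|]; apply: smoothM.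
  by apply/funext => x; rewrite mxE.
- rewrite (_ : (fun x => _) = fun x => - (embed (inl (@i3 0 isT)) (param c x) * embed (inr (@i4 0 isT)) (param c x)
    + embed (inl (@i3 1 isT)) (param c x) * embed (inr (@i4 1 isT)) (param c x)
    + embed (inl (@i3 2 isT)) (param c x) * embed (inr (@i4 2 isT)) (param c x))).
    by apply: smoothN; apply: smoothD; [apply: smoothD|]; apply: smoothM.
  by apply/funext => x; rewrite mxE.
Qed.

Lemma base_part_smooth j : smooth5 (fun x => base_part j (param c x)).
Proof. by case: j => j; [exact: (embed_param_smooth (inl j))|exact: smooth_cst]. Qed.

Lemma fixed_part_smooth j : smooth5 (fun x => fixed_part j (param c x)).
Proof. by case: j => j; [exact: smooth_cst|exact: (embed_param_smooth (inr j))]. Qed.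

Lemma local_expr_rot th j : local_expr (rot th) c j =
  (fun x => base_part j (param c x) + cos th * fixed_part j (param c x) + sin th * shift_part j (param c x)).
Proof. by apply/funext => x; exact: embed_rot. Qed.

Lemma local_expr_rot_smooth th j : smooth5 (local_expr (rot th) c j).
Proof.
rewrite local_expr_rot; apply: smoothD; last by apply: smoothZ; exact: shift_part_smooth.
by apply: smoothD; [exact: base_part_smooth|apply: smoothZ; exact: fixed_part_smooth].
Qed.
End Charts.

Lemma continuous_rot th : continuous (rot th).
Proof.
have ce := @continuous_embed R.
apply: continuous_into_manifold => j.
have cM (f g : S2xS3 -> R) : continuous f -> continuous g -> continuous (fun x => f x * g x).
  by move=> cf cg x; apply: continuousM; [exact: cf|exact: cg].
have cD (f g : S2xS3 -> R) : continuous f -> continuous g -> continuous (fun x => f x + g x).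
  by move=> cf cg x; apply: continuousD; [exact: cf|exact: cg].
have cN (f : S2xS3 -> R) : continuous f -> continuous (fun x => - f x).
  by move=> cf x; apply: continuousN; exact: cf.
have cc (k : R) : continuous (fun _ : S2xS3 => k) by move=> x; exact: cvg_cst.
under eq_fun do rewrite embed_rot.
have cx i : continuous (fun p : S2xS3 => (set_val p.1 : 'rV[R]_(2 + 1)) 0 i) by exact: (ce (inl i)).
have cq i : continuous (fun p : S2xS3 => (set_val p.2 : 'rV[R]_(3 + 1)) 0 i) by exact: (ce (inr i)).
apply: (cD); first apply: (cD).
- by case: j => i /=; [exact: (ce (inl i))|exact: cc].
- by apply: (cM _ _ (cc _)); case: j => i /=; [exact: cc|exact: (ce (inr i))].
- apply: (cM _ _ (cc _)); case: j => i /=; first exact: cc.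
  case: i => [[|[|[|[|//]]]] hj].
  + have H : continuous (fun p : S2xS3 => (set_val p.1 : 'rV[R]_(2 + 1)) 0 (@i3 0 isT) * (set_val p.2 : 'rV[R]_(3 + 1)) 0 (@i4 3 isT) + (set_val p.1 : 'rV[R]_(2 + 1)) 0 (@i3 1 isT) * (set_val p.2 : 'rV[R]_(3 + 1)) 0 (@i4 2 isT) - (set_val p.1 : 'rV[R]_(2 + 1)) 0 (@i3 2 isT) * (set_val p.2 : 'rV[R]_(3 + 1)) 0 (@i4 1 isT)).
      exact: (cD _ _ (cD _ _ (cM _ _ (cx _) (cq _)) (cM _ _ (cx _) (cq _))) (cN _ (cM _ _ (cx _) (cq _)))).
    have E : (fun p : S2xS3 => (set_val p.1 : 'rV[R]_(2 + 1)) 0 (@i3 0 isT) * (set_val p.2 : 'rV[R]_(3 + 1)) 0 (@i4 3 isT) + (set_val p.1 : 'rV[R]_(2 + 1)) 0 (@i3 1 isT) * (set_val p.2 : 'rV[R]_(3 + 1)) 0 (@i4 2 isT) - (set_val p.1 : 'rV[R]_(2 + 1)) 0 (@i3 2 isT) * (set_val p.2 : 'rV[R]_(3 + 1)) 0 (@i4 1 isT)) = shift_part (inr (Ordinal hj)) by apply/funext => p; rewrite /= mxE.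
    by rewrite E in H; exact: H.
  + have H : continuous (fun p : S2xS3 => (set_val p.1 : 'rV[R]_(2 + 1)) 0 (@i3 1 isT) * (set_val p.2 : 'rV[R]_(3 + 1)) 0 (@i4 3 isT) + (set_val p.1 : 'rV[R]_(2 + 1)) 0 (@i3 2 isT) * (set_val p.2 : 'rV[R]_(3 + 1)) 0 (@i4 0 isT) - (set_val p.1 : 'rV[R]_(2 + 1)) 0 (@i3 0 isT) * (set_val p.2 : 'rV[R]_(3 + 1)) 0 (@i4 2 isT)).
      exact: (cD _ _ (cD _ _ (cM _ _ (cx _) (cq _)) (cM _ _ (cx _) (cq _))) (cN _ (cM _ _ (cx _) (cq _)))).
    have E : (fun p : S2xS3 => (set_val p.1 : 'rV[R]_(2 + 1)) 0 (@i3 1 isT) * (set_val p.2 : 'rV[R]_(3 + 1)) 0 (@i4 3 isT) + (set_val p.1 : 'rV[R]_(2 + 1)) 0 (@i3 2 isT) * (set_val p.2 : 'rV[R]_(3 + 1)) 0 (@i4 0 isT) - (set_val p.1 : 'rV[R]_(2 + 1)) 0 (@i3 0 isT) * (set_val p.2 : 'rV[R]_(3 + 1)) 0 (@i4 2 isT)) = shift_part (inr (Ordinal hj)) by apply/funext => p; rewrite /= mxE.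
    by rewrite E in H; exact: H.
  + have H : continuous (fun p : S2xS3 => (set_val p.1 : 'rV[R]_(2 + 1)) 0 (@i3 2 isT) * (set_val p.2 : 'rV[R]_(3 + 1)) 0 (@i4 3 isT) + (set_val p.1 : 'rV[R]_(2 + 1)) 0 (@i3 0 isT) * (set_val p.2 : 'rV[R]_(3 + 1)) 0 (@i4 1 isT) - (set_val p.1 : 'rV[R]_(2 + 1)) 0 (@i3 1 isT) * (set_val p.2 : 'rV[R]_(3 + 1)) 0 (@i4 0 isT)).
      exact: (cD _ _ (cD _ _ (cM _ _ (cx _) (cq _)) (cM _ _ (cx _) (cq _))) (cN _ (cM _ _ (cx _) (cq _)))).
    have E : (fun p : S2xS3 => (set_val p.1 : 'rV[R]_(2 + 1)) 0 (@i3 2 isT) * (set_val p.2 : 'rV[R]_(3 + 1)) 0 (@i4 3 isT) + (set_val p.1 : 'rV[R]_(2 + 1)) 0 (@i3 0 isT) * (set_val p.2 : 'rV[R]_(3 + 1)) 0 (@i4 1 isT) - (set_val p.1 : 'rV[R]_(2 + 1)) 0 (@i3 1 isT) * (set_val p.2 : 'rV[R]_(3 + 1)) 0 (@i4 0 isT)) = shift_part (inr (Ordinal hj)) by apply/funext => p; rewrite /= mxE.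
    by rewrite E in H; exact: H.
  + have H : continuous (fun p : S2xS3 => - ((set_val p.1 : 'rV[R]_(2 + 1)) 0 (@i3 0 isT) * (set_val p.2 : 'rV[R]_(3 + 1)) 0 (@i4 0 isT) + (set_val p.1 : 'rV[R]_(2 + 1)) 0 (@i3 1 isT) * (set_val p.2 : 'rV[R]_(3 + 1)) 0 (@i4 1 isT) + (set_val p.1 : 'rV[R]_(2 + 1)) 0 (@i3 2 isT) * (set_val p.2 : 'rV[R]_(3 + 1)) 0 (@i4 2 isT))).
      exact: (cN _ (cD _ _ (cD _ _ (cM _ _ (cx _) (cq _)) (cM _ _ (cx _) (cq _))) (cM _ _ (cx _) (cq _)))).
    have E : (fun p : S2xS3 => - ((set_val p.1 : 'rV[R]_(2 + 1)) 0 (@i3 0 isT) * (set_val p.2 : 'rV[R]_(3 + 1)) 0 (@i4 0 isT) + (set_val p.1 : 'rV[R]_(2 + 1)) 0 (@i3 1 isT) * (set_val p.2 : 'rV[R]_(3 + 1)) 0 (@i4 1 isT) + (set_val p.1 : 'rV[R]_(2 + 1)) 0 (@i3 2 isT) * (set_val p.2 : 'rV[R]_(3 + 1)) 0 (@i4 2 isT))) = shift_part (inr (Ordinal hj)) by apply/funext => p; rewrite /= mxE.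
    by rewrite E in H; exact: H.
Qed.

Lemma rot0 p : rot 0 p = p.
Proof.
by case: p => x q; congr (_, _); apply: val_inj; rewrite /= /rot_fun cos0 sin0 scale1r scale0r addr0.
Qed.

Section RotMaps.
Variable s : nat.

Lemma rot_Hloc th c j : Hloc s (local_expr (rot th) c j).
Proof.
move=> l _; exists (partials (rev l) (local_expr (rot th) c j)).
by apply: smooth_weak_derivative; exact: local_expr_rot_smooth.
Qed.

Definition rot_map th : Maps R s := MkMaps (@continuous_rot th) (@rot_Hloc th).

Lemma rot_map_Diff th : rot_map th \in Diff R s.
Proof.
rewrite inE; exists (rot_map (- th)); split; first exact: rot_cancel.
by rewrite /= -{2}[th]opprK; exact: rot_cancel.
Qed.

Definition rot_diff th : set_type (Diff R s) := exist _ (rot_map th) (rot_map_Diff th).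

Lemma Maps_eq (f g : Maps R s) : (forall p, f p = g p) -> f = g.
Proof.
case: f g => [f cf hf] [g cg hg] /= /funext e; subst g.
by rewrite (Prop_irrelevance cf cg) (Prop_irrelevance hf hg).
Qed.

Lemma rot_diff_eq th th' : cos th = cos th' -> sin th = sin th' -> rot_diff th = rot_diff th'.
Proof.
move=> hc hs; apply: val_inj; apply: Maps_eq => p; apply: embed_inj => j.
by rewrite /= !embed_rot hc hs.
Qed.
End RotMaps.
End Rotation.

(** * Continuity of the rotations in the Sobolev topology *)

Section SobolevTopology.
Variable R : realType.
Local Notation R5 := (R5 R).
Local Notation lebesgue5 := (@lebesgue5 R).
Local Notation smooth5 := (smooth (basis5 R : 'I_5 -> R5)).
Local Notation ball0 r := (ball (0%R : R5) r).

Lemma L2loc_product r (u w : R5 -> R) : L2loc u -> L2loc w ->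
  lebesgue5.-integrable (ball0 r) (EFin \o (fun x => u x * w x)).
Proof.
move=> Lu Lw.
apply: (@le_integrable _ _ _ lebesgue5 _ (measurable_ball5 r) _ (fun x => (u x ^+ 2)%:E + (w x ^+ 2)%:E)%E).
- by apply/measurable_EFinP/measurable_funTS/measurable_funM; [exact: Lu.1|exact: Lw.1].
- move=> x _ /=; rewrite lee_fin [leRHS]ger0_norm ?addr_ge0 ?sqr_ge0 // normrM.
  rewrite -[u x ^+ 2]real_normK ?num_real // -[w x ^+ 2]real_normK ?num_real //.
  by have := sqr_ge0 (`|u x| - `|w x|); have := normr_ge0 (u x); have := normr_ge0 (w x); nra.
- by apply: integrableD; [exact: measurable_ball5|exact: L2loc_square|exact: L2loc_square].
Qed.

Lemma integral_square_finite r (w : R5 -> R) : L2loc w ->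
  (\int[lebesgue5]_(x in ball0 r) (w x ^+ 2)%:E)%E \is a fin_num.
Proof. by move=> Lw; apply: integrable_fin_num; [exact: measurable_ball5|exact: L2loc_square]. Qed.

Lemma integral_quadratic r (U A B : R5 -> R) a b : L2loc U -> L2loc A -> L2loc B ->
  \int[lebesgue5]_(x in ball0 r) ((U x + a * A x + b * B x) ^+ 2) =
  \int[lebesgue5]_(x in ball0 r) (U x * U x) + a ^+ 2 * \int[lebesgue5]_(x in ball0 r) (A x * A x)
  + b ^+ 2 * \int[lebesgue5]_(x in ball0 r) (B x * B x)
  + (2 * a) * \int[lebesgue5]_(x in ball0 r) (U x * A x) + (2 * b) * \int[lebesgue5]_(x in ball0 r) (U x * B x)
  + (2 * a * b) * \int[lebesgue5]_(x in ball0 r) (A x * B x).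
Proof.
move=> LU LA LB; set D := ball0 r; have mD : measurable D := measurable_ball5 r.
have iZ k u w : L2loc u -> L2loc w -> lebesgue5.-integrable D (EFin \o (fun x => k * (u x * w x))).
  move=> Lu Lw; rewrite (_ : EFin \o _ = fun x => (k%:E * (u x * w x)%:E)%E) //.
  by apply: integrableZl => //; exact: L2loc_product.
have Z k u w : L2loc u -> L2loc w -> k * \int[lebesgue5]_(x in D) (u x * w x) = \int[lebesgue5]_(x in D) (k * (u x * w x)).
  by move=> Lu Lw; rewrite RintegralZl //; exact: L2loc_product.
have AD f g : lebesgue5.-integrable D (EFin \o f) -> lebesgue5.-integrable D (EFin \o g) ->
  (lebesgue5.-integrable D (EFin \o (fun x => f x + g x))) *
  (\int[lebesgue5]_(x in D) f x + \int[lebesgue5]_(x in D) g x = \int[lebesgue5]_(x in D) (f x + g x)).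
  move=> hf hg; split; last by rewrite RintegralD.
  rewrite (_ : EFin \o _ = (EFin \o f) \+ (EFin \o g))%E //; exact: integrableD.
rewrite !Z //.
have iUU := L2loc_product r LU LU.
have [i1 ->] := AD _ _ iUU (iZ (a ^+ 2) _ _ LA LA).
have [i2 ->] := AD _ _ i1 (iZ (b ^+ 2) _ _ LB LB).
have [i3 ->] := AD _ _ i2 (iZ (2 * a) _ _ LU LA).
have [i4 ->] := AD _ _ i3 (iZ (2 * b) _ _ LU LB).
have [i5 ->] := AD _ _ i4 (iZ (2 * a * b) _ _ LA LB).
by apply: eq_Rintegral => x _; ring.
Qed.

Lemma weak_derivative_spec l (v : R5 -> R) s : Hloc s v -> (size l <= s)%N -> is_weak_derivative l v (weak_derivative l v).
Proof. by move=> hv ls; rewrite /weak_derivative; apply: xgetPex; exact: hv. Qed.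

Lemma energyE s r v (w : seq 'I_5 -> R5 -> R) :
  (forall l, (size l <= s)%N -> is_weak_derivative l v (w l)) ->
  energy s r v = (\sum_(k < s.+1) \sum_(l : k.-tuple 'I_5)
     \int[lebesgue5]_(x in ball0 r) (w l x ^+ 2))%:E.
Proof.
move=> hw; rewrite /energy -sumEFin; apply: eq_bigr => k _; rewrite -sumEFin; apply: eq_bigr => l _.
have ls : (size l <= s)%N by rewrite size_tuple -ltnS.
have hl := hw _ ls.
have hv : is_weak_derivative l v (weak_derivative l v).
  by rewrite /weak_derivative; apply: xgetPex; exists (w l).
rewrite (weak_derivative_integral r hv hl) /Rintegral fineK //.
exact: integral_square_finite hl.1.
Qed.

Section Pencil.
Variables (s : nat) (r : R) (gam A0 A1 A2 : R5 -> R).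
Hypotheses (Cg : continuous gam) (Hg : Hloc s gam).
Hypotheses (S0 : smooth5 A0) (S1 : smooth5 A1) (S2 : smooth5 A2).

(** Here [gam] stands for the local expression of the centre of a subbasic ball; this centre is
    arbitrary, hence only of class H^s. The other coefficients come from [rot] and are smooth. *)
Definition pencil (th : R) : R5 -> R := fun x => gam x - (A0 x + cos th * A1 x + sin th * A2 x).

(** Weak differentiation is linear, so each squared derivative integrates to a quadratic polynomial
    in cos th and sin th whose coefficients are fixed integrals over the ball. *)
Lemma energy_pencil : exists2 q : R -> R, continuous q & forall th, energy s r (pencil th) = (q th)%:E.
Proof.
pose d (f : R5 -> R) l := partials (rev l) f.
pose U l x := weak_derivative l gam x + (-1) * d A0 l x.
have wd f l : smooth5 f -> is_weak_derivative l f (d f l) by exact: smooth_weak_derivative.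
have Lc (f : R5 -> R) : smooth5 f -> L2loc f by move=> sf; apply/continuous_L2loc/(smooth_continuous sf).
have Ld f l : smooth5 f -> L2loc (d f l) by move=> /wd h; exact: (h l).1.
have wU l : (size l <= s)%N -> is_weak_derivative l (fun x => gam x + (-1) * A0 x) (U l).
  move=> ls; apply: weak_derivativeD; [exact: continuous_L2loc|exact/L2locZ/Lc|exact: weak_derivative_spec ls|].
  by apply: weak_derivativeZ; [exact: wd|exact: Lc].
have LU l : (size l <= s)%N -> L2loc (U l) by move=> /wU [].
have wth th l : (size l <= s)%N -> is_weak_derivative l (pencil th) (fun x => U l x + (- cos th) * d A1 l x + (- sin th) * d A2 l x).
  move=> ls; rewrite (_ : pencil th = fun x => (gam x + (-1) * A0 x + (- cos th) * A1 x) + (- sin th) * A2 x); last first.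
    by apply/funext => x; rewrite /pencil; ring.
  have L1 : L2loc (fun x => gam x + (-1) * A0 x) by apply: L2locD; [exact: continuous_L2loc|exact/L2locZ/Lc].
  apply: weak_derivativeD.
  - by apply: L2locD => //; exact/L2locZ/Lc.
  - exact/L2locZ/Lc.
  - apply: weak_derivativeD => //; [exact/L2locZ/Lc|exact: wU|].
    by apply: weak_derivativeZ; [exact: wd|exact: Lc].
  - by apply: weak_derivativeZ; [exact: wd|exact: Lc].
pose q th := \sum_(k < s.+1) \sum_(l : k.-tuple 'I_5)
   \int[lebesgue5]_(x in ball0 r) ((U l x + (- cos th) * d A1 l x + (- sin th) * d A2 l x) ^+ 2).
exists q; last by move=> th; exact: (energyE r (wth th)).
have cM (f g : R -> R) : continuous f -> continuous g -> continuous (fun x => f x * g x).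
  by move=> cf cg x; apply: continuousM; [exact: cf|exact: cg].
have cD (f g : R -> R) : continuous f -> continuous g -> continuous (fun x => f x + g x).
  by move=> cf cg x; apply: continuousD; [exact: cf|exact: cg].
have cN (f : R -> R) : continuous f -> continuous (fun x => - f x).
  by move=> cf x; apply: continuousN; exact: cf.
have cc (k : R) : continuous (fun _ : R => k) by move=> x; exact: cvg_cst.
have csum (I : finType) (F : I -> R -> R) : (forall i, continuous (F i)) -> continuous (fun x => \sum_i F i x).
  move=> h; rewrite (_ : (fun x => _) = \sum_i F i); last by apply/funext => x; rewrite fct_sumE.
  by elim/big_ind: _ => [|f g cf cg|i _]; [exact: (cc 0)|exact: (cD _ _ cf cg)|exact: h].
rewrite /q; apply: (csum) => k; apply: (csum) => l.
have ls : (size l <= s)%N by rewrite size_tuple -ltnS.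
under eq_fun do rewrite (integral_quadratic r _ _ (LU l ls) (Ld _ l S1) (Ld _ l S2)).
have ca : continuous (fun t : R => - cos t) by apply: cN; exact: continuous_cos.
have cb : continuous (fun t : R => - sin t) by apply: cN; exact: continuous_sin.
apply: (cD); last first.
  by apply: (cM _ _ _ (cc _)); apply: (cM) => //; apply: (cM _ _ (cc _)).
apply: (cD); last by apply: (cM _ _ _ (cc _)); apply: (cM _ _ (cc _)).
apply: (cD); last by apply: (cM _ _ _ (cc _)); apply: (cM _ _ (cc _)).
apply: (cD); last by apply: (cM _ _ _ (cc _)); apply: (cM _ _ cb cb).
apply: (cD); last by apply: (cM _ _ _ (cc _)); apply: (cM _ _ ca ca).
exact: cc.
Qed.

Lemma pencil_near eps th : 0 < eps -> (sobolev_norm s r (pencil th) < eps%:E)%E ->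
  \forall t \near th, (sobolev_norm s r (pencil t) < eps%:E)%E.
Proof.
have [q cq qE] := energy_pencil; move=> e0 h.
have h1 : q th < eps ^+ 2.
  by have := sqrte_lt (energy_ge0 s r (pencil th)) e0 h; rewrite qE lte_fin.
have H : \forall t \near th, q t < eps ^+ 2 := cq th [set y | y < eps ^+ 2] (lt_nbhsl h1).
apply: filterS H => t ht; apply: (lt_sqrte (energy_ge0 s r (pencil t)) e0).
by rewrite qE lte_fin.
Qed.
End Pencil.

Lemma continuous_into_Maps (X : topologicalType) s (F : X -> Maps R s) :
  (forall g r eps x, 0 < r -> 0 < eps -> Maps_ball g r eps (F x) ->
     \forall y \near x, Maps_ball g r eps (F y)) -> continuous F.
Proof.
move=> h x A /=; rewrite nbhsE => -[B [[D' D'sub <-] [C D'C CFx]] BA].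
have [E Esub CE] := D'sub _ D'C.
suff : \forall y \near x, C (F y).
  by apply: filterS => y Cy; apply: BA; exists C.
suff H : \forall y \near x, forall i, i \in E -> i (F y).
  by apply: filterS H => y hy; rewrite -CE => i; exact: hy.
have CF i : i \in E -> i (F x) by rewrite -CE in CFx; exact: CFx.
have nE i : i \in E -> \forall y \near x, i (F y).
  move=> iE; have := CF i iE; have /set_mem [g [r [eps [r0 e0 ->]]]] := Esub _ iE.
  exact: h.
have : \forall y \near x, forall i : E, (val i) (F y).
  by apply: filter_forall => i; apply: nE; exact: valP.
by apply: filterS => y hy i iE; exact: (hy [` iE]%fset).
Qed.

End SobolevTopology.

(** * Joint continuity of evaluation *)

Section Evaluation.
Variable R : realType.
Local Notation S2xS3 := (S2xS3 R).
Local Notation embed := (@embed R).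
Local Notation R5 := (R5 R).

Lemma continuous_param c : continuous (param c : R5 -> S2xS3).
Proof.
apply: continuous_into_manifold => j.
exact: (smooth_continuous (embed_param_smooth c j)).
Qed.

Lemma continuous_local_expr s (f : Maps R s) c j : continuous (local_expr f c j).
Proof.
move=> x; apply: (@continuous_comp _ _ _ (fun x => f (param c x)) (embed j)); last exact: continuous_embed.
apply: (@continuous_comp _ _ _ (param c) f); [exact: continuous_param|exact: map_continuous].
Qed.

Lemma continuous_rot_map s : continuous (@rot_map R s).
Proof.
apply: continuous_into_Maps => g r eps th r0 e0 hb.
suff H : \forall t \near th, forall cj : (bool * bool) * ('I_(2 + 1) + 'I_(3 + 1)),
    (sobolev_norm s r (fun x => (local_expr g cj.1 cj.2 x - local_expr (rot_map s t) cj.1 cj.2 x)%R) < eps%:E)%E.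
  by apply: filterS H => t ht c j; exact: (ht (c, j)).
apply: (@filter_forall _ _ (fun (cj : (bool * bool) * ('I_(2 + 1) + 'I_(3 + 1))) t =>
    (sobolev_norm s r (fun x => (local_expr g cj.1 cj.2 x - local_expr (rot_map s t) cj.1 cj.2 x)%R) < eps%:E)%E) _ (nbhs_filter th)) => -[c j] /=.
have E t : (fun x => local_expr g c j x - local_expr (rot_map s t) c j x) =
    pencil (local_expr g c j) (fun x => base_part j (param c x)) (fun x => fixed_part j (param c x))
      (fun x => shift_part j (param c x)) t.
  by apply/funext => x; rewrite [local_expr (rot_map s t) c j](@local_expr_rot R c t j).
have := hb c j; rewrite E => h.
have := pencil_near (@continuous_local_expr s g c j) (@map_Hloc _ _ g c j) (base_part_smooth c j)
  (fixed_part_smooth c j) (shift_part_smooth c j) e0 h.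
by apply: filterS => t; rewrite E.
Qed.

Lemma weak_derivative_zero l : is_weak_derivative l (fun _ : R5 => 0 : R) (fun _ : R5 => 0 : R).
Proof.
have := @smooth_weak_derivative R (cst 0) l (smooth_cst _ 0).
have -> // : forall l, partials l (cst 0 : R5 -> R) = cst 0.
elim => //= i l' ->; apply/funext => x; exact: derive_cst.
Qed.

(** The chosen weak derivatives of 0 may be nonzero on a null set; uniqueness allows them to be
    replaced by 0. *)
Lemma sobolev_norm0 s r eps : 0 < eps -> (sobolev_norm s r (fun _ : R5 => (0 : R)%R) < eps%:E)%E.
Proof.
move=> e0; apply: (lt_sqrte (energy_ge0 s r _) e0).
rewrite (energyE r (fun l _ => weak_derivative_zero l)) lte_fin big1 ?exprn_gt0 // => k _.
rewrite big1 // => l _; rewrite expr0n /=.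
by rewrite Rintegral_cst ?mul0r //; exact: measurable_ball5.
Qed.

Lemma Maps_ball_nbhs s (f : Maps R s) r eps : 0 < r -> 0 < eps -> nbhs f (Maps_ball f r eps).
Proof.
move=> r0 e0; rewrite nbhsE; exists (Maps_ball f r eps) => //; split; last first.
  move=> c j; rewrite (_ : (fun x => _) = fun _ => 0); first exact: sobolev_norm0.
  by apply/funext => x; rewrite subrr.
exists [set Maps_ball f r eps]; last by rewrite bigcup_set1.
move=> _ ->; exists [fset Maps_ball f r eps]%fset.
  by move=> i /fset1P ->; apply/mem_set; exists f, r, eps.
by rewrite set_fset1 bigcap_set1.
Qed.

(** The point is projected from the pole of the other hemisphere, which keeps its chart coordinates
    y_i / (1 + |z|) in [-1, 1]. So the unit boxes of the four charts cover the manifold. *)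
Lemma stereo_cover n (y : @sphere R n) : exists b (x : 'rV[R]_n),
  (forall i, `|x 0 i| <= 1) /\ stereo b x = y.
Proof.
case: y => y yP; pose b := 0 <= y 0 (rshift n ord0).
set z := y 0 (rshift n ord0) in b.
have hy : \sum_(i < n) y 0 (lshift 1 i) ^+ 2 + z ^+ 2 = 1.
  by have := set_mem yP; rewrite /sphere /= big_split_ord /= big_ord1.
have q0 : 0 <= \sum_(i < n) y 0 (lshift 1 i) ^+ 2 by apply: sumr_ge0 => i _; exact: sqr_ge0.
have y1 i : `|y 0 (lshift 1 i)| <= 1.
  rewrite -(@ler_pXn2r _ 2) ?nnegrE // expr1n real_normK ?num_real //.
  have : y 0 (lshift 1 i) ^+ 2 <= \sum_(i < n) y 0 (lshift 1 i) ^+ 2.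
    by rewrite (bigD1 i) //= lerDl; apply: sumr_ge0 => ? _; exact: sqr_ge0.
  by have := sqr_ge0 z; lra.
pose D := 1 + `|z|; have D1 : 1 <= D by rewrite lerDl.
have D0 : 0 < D by rewrite (lt_le_trans ltr01).
exists b, (\row_i (y 0 (lshift 1 i) / D)); split.
  move=> i; rewrite mxE normrM (gtr0_norm (_ : 0 < D^-1)) ?invr_gt0 //.
  by rewrite ler_pdivrMr // mul1r (le_trans (y1 i)).
have zz : `|z| ^+ 2 = z ^+ 2 by rewrite real_normK ?num_real.
have sq : sqnorm (\row_i (y 0 (lshift 1 i) / D)) = (1 - `|z|) / D.
  rewrite /sqnorm; under eq_bigr do rewrite mxE exprMn.
  rewrite -mulr_suml (_ : \sum_(i < n) _ = (1 - `|z|) * D); last by rewrite /D; move: hy; rewrite -zz => hy; lra.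
  by rewrite exprVn expr2; field; rewrite gt_eqF.
have den : (1 - `|z|) / D + 1 = 2 / D by rewrite /D; field; rewrite gt_eqF.
apply: val_inj; rewrite /= /stereo_fun sq den.
rewrite -[y in RHS](hsubmxK y); congr row_mx.
  apply/rowP => i; rewrite !mxE; field; rewrite gt_eqF //.
apply/rowP => i; rewrite !mxE ord1 -/z -mulrA.
have -> : ((1 - `|z|) / D - 1) / (2 / D) = - `|z| by rewrite /D; field; rewrite gt_eqF.
rewrite /b; have [hz|hz] := leP 0 z.
  by rewrite ger0_norm // expr1 mulN1r opprK.
by rewrite ltr0_norm // expr0 mul1r opprK.
Qed.

Lemma chart_cover (p : S2xS3) : exists c x, box (1 : R) x /\ param c x = p.
Proof.
case: p => [p1 p2].
have [b1 [x1 [h1 e1]]] := @stereo_cover 2 p1.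
have [b2 [x2 [h2 e2]]] := @stereo_cover 3 p2.
exists (b1, b2), (x1 0 0, x1 0 1, x2 0 0, x2 0 1, x2 0 2); split.
  by do ?split; rewrite /seg /= in_itv /= -ler_norml.
rewrite /param /=; congr (_, _).
  rewrite -e1; congr stereo; apply/rowP => -[[|[|//]] hi]; rewrite mxE /=; congr (x1 _ _); exact: val_inj.
by rewrite -e2; congr stereo; apply/rowP => -[[|[|[|//]]] hi]; rewrite mxE /=; congr (x2 _ _); exact: val_inj.
Qed.

(** The embedding on the unit box of each chart is applied to the difference of local expressions;
    the widening by 3 makes the Sobolev ball one of radius 1 + 3. *)
Lemma evaluation_near s (f : Maps R s) (tol : R) : (5 <= s)%N -> 0 < tol ->
  nbhs f [set g : Maps R s | forall p j, `|embed j (f p) - embed j (g p)| <= tol].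
Proof.
move=> s5 tol0; have [e e0 he] := @sobolev_embedding R 1 tol tol0.
have r0 : (0 : R) < 1 + 3 by rewrite addr_gt0.
have := Maps_ball_nbhs f r0 e0; apply: filterS => g hg p j.
have [c [x [xb <-]]] := chart_cover p.
have cl := continuous_local_expr.
have hl c' j' : Hloc s (fun x => local_expr f c' j' x - local_expr g c' j' x).
  move=> l ls.
  exists (fun x => weak_derivative l (local_expr f c' j') x + (-1) * weak_derivative l (local_expr g c' j') x).
  rewrite (_ : (fun x => _) = fun x => local_expr f c' j' x + (-1) * local_expr g c' j' x); last first.
    by apply/funext => y; rewrite mulN1r.
  apply: weak_derivativeD.
  - exact: continuous_L2loc.
  - by apply: L2locZ; exact: continuous_L2loc.
  - by apply: weak_derivative_spec ls; exact: map_Hloc.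
  - apply: weak_derivativeZ; last exact: continuous_L2loc.
    by apply: weak_derivative_spec ls; exact: map_Hloc.
apply: (he s (fun x => local_expr f c j x - local_expr g c j x) s5 _ (hl c j) (hg c j) x xb).
by move=> y; apply: continuousB; exact: cl.
Qed.

Lemma continuous_evaluation s (X : topologicalType) (F : X -> Maps R s) : (5 <= s)%N -> continuous F ->
  forall j, continuous (fun z : X * S2xS3 => embed j (F z.1 z.2)).
Proof.
move=> s5 cF j [x p]; apply/cvgrPdist_lt => eps e0.
have e2 : 0 < eps / 2 by rewrite divr_gt0.
have n1 := cF x _ (evaluation_near (F x) s5 e2).
have cx : continuous (fun p => embed j (F x p)).
  move=> q; apply: (@continuous_comp _ _ _ (F x) (embed j)); [exact: map_continuous|exact: continuous_embed].
have /cvgrPdist_lt/(_ _ e2) n2 := cx p.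
exists ([set y | forall q j', `|embed j' (F x q) - embed j' (F y q)| <= eps / 2],
  [set q | `|embed j (F x p) - embed j (F x q)| < eps / 2]); first by split; [exact: n1|exact: n2].
move=> [y q] [/= hy hq].
rewrite (_ : _ - _ = (embed j (F x p) - embed j (F x q)) + (embed j (F x q) - embed j (F y q))); last by ring.
apply: le_lt_trans (ler_normD _ _) _; rewrite [ltRHS]splitr.
by apply: ltr_leD => //; exact: hy.
Qed.

End Evaluation.

(** * Injectivity of the degree *)

Lemma eq_deg3 nt na nb L L' :
  (forall t a b, (t <= nt)%N -> (a <= na)%N -> (b <= nb)%N -> L t a b = L' t a b) ->
  deg3 nt na nb L = deg3 nt na nb L'.
Proof.
move=> h; rewrite /deg3; apply: eq_big_nat => t ht; apply: eq_big_nat => a ha.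
by apply: eq_big_nat => b hb; apply: eq_cube4 => x y z hx hy hz; apply: h; lia.
Qed.

Lemma eq_tucker (R : realType) (y y' : nat -> R) : (forall i, (i < 4)%N -> y i = y' i) -> tucker y = tucker y'.
Proof. by move=> h; rewrite /tucker !h. Qed.

Section Mesh.
Variable R : realType.

(** A Lebesgue number argument. The point y may leave K, which is why the functions live on the
    whole space. *)
Lemma uniform_mesh (V : normedModType R) (n : nat) (K : set V) (W : 'I_n -> V -> R) (eps : R) :
  compact K -> (forall i, continuous (W i)) -> 0 < eps ->
  exists2 d : R, 0 < d & forall i x y, K x -> ball x d y -> `|W i x - W i y| < eps.
Proof.
move=> /compact_near_coveringP cK cW e0.
have e2 : 0 < eps / 2 by rewrite divr_gt0.
have := cK R (0^'+) (fun d x => forall i y, ball x d y -> `|W i x - W i y| < eps) _.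
case=> [x Kx|d /= d0 hd]; last first.
  exists (d / 2); first by rewrite divr_gt0.
  move=> i x y Kx; apply: (hd (d / 2)) => //=; last by rewrite divr_gt0.
  by rewrite sub0r normrN gtr0_norm ?divr_gt0 // ltr_pdivrMr // ltr_pMr // ltr1n.
have : \forall y \near x, forall i, `|W i x - W i y| < eps / 2.
  apply: filter_forall => i; by have /cvgrPdist_lt/(_ _ e2) := cW i x.
move=> /nbhs_ballP[r /= r0 hr].
have r2 : 0 < r / 2 by rewrite divr_gt0.
exists (ball x (r / 2), [set d | 0 < d < r / 2]) => /=.
  split; first exact: nbhsx_ballx.
  by near=> d; apply/andP; split; near: d; [exact: nbhs_right_gt|exact: nbhs_right_lt].
move=> [z d] [/= hz /andP[d0 dr]] i y hy.
have hz' : `|W i x - W i z| < eps / 2.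
  by apply: hr; apply: le_ball hz; rewrite ler_pdivrMr // ler_pMr // ler1n.
have hy' : `|W i x - W i y| < eps / 2.
  apply: hr; rewrite -ball_normE /= (_ : x - y = (x - z) + (z - y)); last by rewrite addrA subrK.
  apply: le_lt_trans (ler_normD _ _) _; rewrite [ltRHS]splitr; apply: ltrD.
    by move: hz; rewrite -ball_normE.
  by apply: lt_trans dr; move: hy; rewrite -ball_normE.
rewrite (_ : _ - _ = (W i x - W i y) - (W i x - W i z)); last by ring.
by apply: le_lt_trans (ler_normB _ _) _; rewrite [ltRHS]splitr; apply: ltrD.
Unshelve. all: by end_near.
Qed.

Lemma near_nat_dist n i j : near_nat n i j -> `|i%:R - j%:R| <= 1 :> R.
Proof.
case/and4P => _ _ hi hj; rewrite ler_norml; apply/andP; split.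
  by rewrite lerBrDr addrC lerBlDr natr1 ler_nat.
by rewrite lerBlDr addrC natr1 ler_nat.
Qed.

(** The retraction of the line onto [0, 1], written with absolute values so that continuity is
    immediate. It extends a homotopy to parameters in a normed space. *)
Definition clamp_fun (x : R) := (`|x| - `|x - 1| + 1) / 2.

Lemma clamp_funP x : clamp_fun x \in `[0 : R, 1]%classic.
Proof.
rewrite inE /= in_itv /= /clamp_fun; apply/andP.
by case: (ger0P x) => ?; case: (ger0P (x - 1)) => ?; split; lra.
Qed.

Definition clamp (x : R) : unit_interval R := exist _ (clamp_fun x) (clamp_funP x).

Lemma clampE x : 0 <= x <= 1 -> set_val (clamp x) = x.
Proof.
move=> /andP[x0 x1]; have -> : set_val (clamp x) = clamp_fun x by [].
rewrite /clamp_fun ger0_norm // ler0_norm; lra.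
Qed.

Lemma continuous_clamp : continuous clamp.
Proof.
have H : continuous (fun x : R => (`|x| - `|x - 1| + 1) / 2).
  move=> x; apply: (@continuousM R R (fun x => `|x| - `|x - 1| + 1) (fun _ => 2^-1)); last exact: cvg_cst.
  apply: (@continuousD _ _ _ (fun x : R => `|x| - `|x - 1|) (fun _ => 1)); last exact: cvg_cst.
  apply: (@continuousB _ _ _ (fun x : R => `|x|) (fun x => `|x - 1|)); first exact: norm_continuous.
  apply: (@continuous_comp _ _ _ (fun x : R => x - 1) (fun x => `|x|)); last exact: norm_continuous.
  by apply: (@continuousB R R R (fun x => x) (fun _ => 1)); [exact: cvg_id|exact: cvg_cst].
exact: continuous_to_set_type.
Qed.

Lemma clamp0 : clamp 0 = zero.
Proof. by apply: val_inj; rewrite -set_valE clampE // lexx ler01. Qed.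

Lemma clamp1 : clamp 1 = one.
Proof. by apply: val_inj; rewrite -set_valE clampE // lexx ler01. Qed.

End Mesh.

(** * The rotation loops and their pairwise inequivalence *)

Section Loops.
Variable R : realType.
Local Notation S2xS3 := (S2xS3 R).
Local Notation embed := (@embed R).
Local Notation I := (unit_interval R).

Definition polar_row (al be : R) : 'rV[R]_(2 + 1) :=
  \row_i match val i with 0%N => sin al * cos be | 1%N => sin al * sin be | _ => cos al end.

Definition one_row : 'rV[R]_(3 + 1) := \row_i (val i == 3)%:R.

Lemma polar_rowP al be : polar_row al be \in @sphere R 2.
Proof.
rewrite inE /sphere /= sum3 !mxE /=.
rewrite (_ : _ + _ = sin al ^+ 2 * (cos be ^+ 2 + sin be ^+ 2) + cos al ^+ 2); last by ring.
by rewrite cos2Dsin2 mulr1 addrC cos2Dsin2.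
Qed.

Lemma one_rowP : one_row \in @sphere R 3.
Proof. by rewrite inE /sphere /= sum4 !mxE /=; ring. Qed.

Definition probe (ab : R * R) : S2xS3 :=
  (exist _ (polar_row ab.1 ab.2) (polar_rowP ab.1 ab.2), exist _ one_row one_rowP).

Lemma continuous_probe : continuous probe.
Proof.
have cM (f g : R * R -> R) : continuous f -> continuous g -> continuous (fun x => f x * g x).
  by move=> cf cg x; apply: continuousM; [exact: cf|exact: cg].
have cc (f : R * R -> R) (g : R -> R) : continuous f -> continuous g -> continuous (fun x => g (f x)).
  by move=> cf cg x; apply: continuous_comp; [exact: cf|exact: cg].
have c1 : continuous (fst : R * R -> R) by move=> x; exact: cvg_fst.
have c2 : continuous (snd : R * R -> R) by move=> x; exact: cvg_snd.
have cs := @continuous_sin R; have cco := @continuous_cos R.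
apply: continuous_into_manifold => -[] i.
  under eq_fun do rewrite /= mxE.
  case: i => [[|[|i]] hi] /=.
  - by apply: cM; exact: cc.
  - by apply: cM; exact: cc.
  - exact: cc.
under eq_fun do rewrite /= mxE.
by move=> x; exact: cvg_cst.
Qed.

Lemma embed_rot_probe th al be i : (i < 4)%N ->
  embed (inr (inord i)) (rot th (probe (al, be))) = suspend th al be i.
Proof.
move=> i4; rewrite embed_rot /= !mxE /= inordK // add0r.
case: i i4 => [|[|[|[|//]]]] _ /=; rewrite ?eqxx /=; ring.
Qed.

Lemma probe_eq al be be' : sin al * cos be = sin al * cos be' -> sin al * sin be = sin al * sin be' ->
  probe (al, be) = probe (al, be').
Proof.
move=> hc hs; congr (_, _); apply: val_inj => /=; apply/rowP => i; rewrite !mxE /=.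
by case: (val i) => [|[|]].
Qed.

Lemma unit4_embed (p : S2xS3) : unit4 (fun i => embed (inr (inord i)) p).
Proof.
have := valP p.2; rewrite inE /sphere /= sum4 /unit4 /= set_valE => <-.
by do ![congr (_ + _)]; congr (_ ^+ 2); congr (\val p.2 0 _); apply: val_inj; rewrite /= inordK.
Qed.

Variable s : nat.
Local Notation T := (set_type (Diff R s)).
Local Notation e := (@rot_diff R s 0).

Definition rot_loop_fun (k : nat) (t : I) : T := @rot_diff R s (2 * k%:R * pi * set_val t).

Lemma continuous_rot_loop k : continuous (rot_loop_fun k).
Proof.
apply: continuous_to_set_type => t.
apply: (@continuous_comp _ _ _ (fun t : I => 2 * k%:R * pi * set_val t) (@rot_map R s)); last exact: continuous_rot_map.
have hs : continuous (fun t : I => (set_val t : R)) by exact: initial_continuous.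
by apply: (@continuousM R I (fun _ => 2 * k%:R * pi) (fun t => set_val t)); [by apply: cst_continuous|exact: hs].
Qed.

Lemma rot_loop0 k : rot_loop_fun k zero = e.
Proof. by rewrite /rot_loop_fun -clamp0 clampE ?lexx ?ler01 // mulr0. Qed.

Lemma cos_sin_period k : cos (2 * k%:R * pi) = 1 :> R /\ sin (2 * k%:R * pi) = 0 :> R.
Proof.
elim: k => [|k [hc hs]]; first by rewrite mulr0 mul0r cos0 sin0.
have -> : 2 * k.+1%:R * pi = 2 * k%:R * pi + pi *+ 2 :> R by rewrite -natr1; ring.
by rewrite cosD2pi sinD2pi.
Qed.

Lemma rot_loop1 k : rot_loop_fun k one = e.
Proof.
rewrite /rot_loop_fun -clamp1 clampE ?lexx ?ler01 // mulr1.
by have [hc hs] := cos_sin_period k; apply: rot_diff_eq; rewrite ?cos0 ?sin0.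
Qed.

Definition rot_loop k : {path I from e to e in T} :=
  mk_path (@continuous_rot_loop k) (rot_loop0 k) (rot_loop1 k).

Lemma near_nat_scaled (M nt n i j : nat) (d : R) : (0 < M)%N -> 2 / d < M%:R -> 0 < d -> (M <= nt)%N -> near_nat n i j ->
  `|i%:R / nt%:R - j%:R / nt%:R| < d / 2 :> R.
Proof.
move=> M0 hM d0 hn /(near_nat_dist R) h.
have Mp : 0 < M%:R :> R by rewrite ltr0n.
have np : 0 < nt%:R :> R by rewrite ltr0n; exact: leq_trans hn.
rewrite -mulrBl normrM [X in _ * X]ger0_norm ?invr_ge0 ?(ltW np) // ltr_pdivrMr //.
apply: le_lt_trans h _; rewrite -(@ltr_pM2r _ 2^-1^-1) ?invr_gt0 ?invrK //.
move: hM; rewrite ltr_pdivrMr // => hM.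
have : M%:R * d <= nt%:R * d by rewrite ler_pM2r // ler_nat.
by move: hM; set a := M%:R * d; rewrite mul1r (_ : d / 2 * nt%:R * 2 = nt%:R * d); [lra|field].
Qed.

Lemma rot_loop_inj j k : (5 <= s)%N -> (0 < j)%N -> (0 < k)%N ->
  loop_homotopic (rot_loop j) (rot_loop k) -> j = k.
Proof.
move=> s5 j0 k0 [H [cH H0 H1 He]].
pose V : normedModType R := (R * R * R * R)%type.
(* The variables are, in this order, loop time, homotopy time and the two spherical coordinates. *)
pose W (i : 'I_4) (z : V) := embed (inr (i : 'I_(3 + 1)))
  (set_val (H (clamp z.1.1.1, clamp z.1.1.2)) (probe (z.1.2, z.2))).
have cW i : continuous (W i).
  have cF : continuous (fun y : I * I => set_val (H y)).
    move=> y; apply: (@continuous_comp _ _ _ H set_val); [exact: cH|exact: initial_continuous].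
  have cE := @continuous_evaluation R s _ _ s5 cF (inr (i : 'I_(3 + 1))).
  have c1 (A B C : topologicalType) (f : A -> B * C) : continuous f -> continuous (fun x => (f x).1).
    by move=> cf x; apply: (@continuous_comp _ _ _ f fst); [exact: cf|exact: cvg_fst].
  have c2 (A B C : topologicalType) (f : A -> B * C) : continuous f -> continuous (fun x => (f x).2).
    by move=> cf x; apply: (@continuous_comp _ _ _ f snd); [exact: cf|exact: cvg_snd].
  have cc (A B C : topologicalType) (f : A -> B) (g : B -> C) : continuous f -> continuous g ->
      continuous (fun x => g (f x)).
    by move=> cf cg x; apply: continuous_comp; [exact: cf|exact: cg].
  have cid : continuous (fun z : V => z) by move=> z; exact: cvg_id.
  have cG : continuous (fun z : V => ((clamp z.1.1.1, clamp z.1.1.2), probe (z.1.2, z.2))).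
    have p1 : continuous (fun z : V => z.1.1.1) := c1 _ _ _ _ (c1 _ _ _ _ (c1 _ _ _ _ cid)).
    have p2 : continuous (fun z : V => z.1.1.2) := c2 _ _ _ _ (c1 _ _ _ _ (c1 _ _ _ _ cid)).
    have p3 : continuous (fun z : V => z.1.2) := c2 _ _ _ _ (c1 _ _ _ _ cid).
    have p4 : continuous (fun z : V => z.2) := c2 _ _ _ _ cid.
    exact: (continuous_pair (continuous_pair (cc _ _ _ _ _ p1 (@continuous_clamp R)) (cc _ _ _ _ _ p2 (@continuous_clamp R)))
      (cc _ _ _ _ _ (continuous_pair p3 p4) continuous_probe)).
  exact: (cc _ _ _ _ _ cG cE).
pose K : set V := `[0 : R, 1]%classic `*` `[0 : R, 1]%classic `*` `[0 : R, pi]%classic `*` `[0 : R, 2 * pi]%classic.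
have cK : compact K by do ![apply: compact_setX]; exact: segment_compact.
(* The tolerance 1 is the one under which [tucker] labels of unit vectors cannot be antipodal. *)
have [d d0 hd] := uniform_mesh cK cW (ltr01 : 0 < (1 : R)).
(* Time steps are then below d / 2, and angle steps below d because pi / 2 < 2. *)
have [M M0 hM] : exists2 M : nat, (0 < M)%N & 2 / d < M%:R.
  exists (Num.bound (2 / d)).+1 => //.
  by apply: lt_trans (archi_boundP _) _; rewrite ?ltr_nat // divr_ge0 ?(ltW d0).
(* A common number of time steps: loop j makes j turns of 4 k M steps and loop k makes k turns of 4
   j M steps, so both ends of the homotopy are instances of [labelling]. *)
pose nt := (4 * j * (k * M))%N.
have ntE : nt = (4 * k * (j * M))%N by rewrite /nt; lia.
pose pnt u t a b : V := (t%:R / nt%:R, u%:R / M%:R, ang R M a, ang R M b).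
pose L u t a b := tucker (fun i => W (inord i) (pnt u t a b)).
have nt0 : (0 < nt)%N by rewrite /nt !muln_gt0 j0 k0 M0.
have Mnt : (M <= nt)%N by rewrite /nt mulnA leq_pmull // !muln_gt0 j0 k0.
have pi0 := pi_gt0 R.
have frac n i : (0 < n)%N -> (i <= n)%N -> 0 <= (i%:R / n%:R : R) <= 1.
  move=> n0 hi; rewrite divr_ge0 ?ler0n //= ler_pdivrMr ?ltr0n // mul1r ler_nat //.
have angle q i : (i <= q * M)%N -> ang R M i \in `[0, q%:R / 2 * pi].
  move=> hi; rewrite in_itv /= /ang mulr_ge0 ?divr_ge0 ?ler0n ?(ltW pi0) //=.
  rewrite [leRHS](_ : _ = q%:R * (pi / 2)); last by field.
  rewrite ler_pM2r ?divr_gt0 // ler_pdivrMr ?ltr0n // -natrM ler_nat //.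
have inK u t a b : (u <= M)%N -> (t <= nt)%N -> (a <= 2 * M)%N -> (b <= 4 * M)%N -> K (pnt u t a b).
  move=> hu ht ha hb; split; first split; first split.
  - by rewrite /= in_itv /=; exact: frac.
  - by rewrite /= in_itv /=; exact: frac.
  - by rewrite /= -[pi]mul1r -(divff (_ : 2 != 0 :> R)) ?pnatr_eq0 //; exact: (angle 2).
  - by rewrite /= (_ : 2 = 4 / 2 :> R); [exact: (angle 4)|field].
have tL : tame4 M nt (2 * M) (4 * M) L.
  split=> [u t a b|u u' t t' a a' b b' hu ht ha hb]; first exact: tucker_lt4.
  apply: tucker_near; [exact: unit4_embed|exact: unit4_embed|move=> i _].
  apply: hd; first by apply: inK; [case/and4P: hu|case/and4P: ht|case/and4P: ha|case/and4P: hb].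
  have angd n x y : near_nat n x y -> `|ang R M x - ang R M y| < d.
    move=> h; rewrite /ang -mulrBl normrM [X in _ * X]ger0_norm ?divr_ge0 ?(ltW pi0) //.
    rewrite -[ltRHS](@divfK _ 2) ?pnatr_eq0 //; apply: ltr_pM; rewrite ?divr_ge0 ?(ltW pi0) ?pihalf_lt2 //.
    exact: (near_nat_scaled M0 hM d0 (leqnn M) h).
  have half : d / 2 < d by rewrite ltr_pdivrMr // ltr_pMr // ltr1n.
  split; first split; first split.
  - by rewrite -ball_normE; exact: (lt_trans (near_nat_scaled M0 hM d0 Mnt ht) half).
  - by rewrite -ball_normE; exact: (lt_trans (near_nat_scaled M0 hM d0 (leqnn M) hu) half).
  - by rewrite -ball_normE; exact: angd ha.
  - by rewrite -ball_normE; exact: angd hb.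
have [[_ _ c2 s2] [_ _ c4 s4]] := @trig_value R M M0.
have LE u t a b th : H (clamp (t%:R / nt%:R), clamp (u%:R / M%:R)) = @rot_diff R s th ->
    L u t a b = tucker (suspend th (ang R M a) (ang R M b)).
  move=> h; apply: eq_tucker => i i4; rewrite /W /pnt /= h; exact: embed_rot_probe.
(* At both ends of loop time the homotopy stays at the identity, the S^3-component is the point 1,
   and the labels depend on neither a nor b. *)
have end0 u : H (clamp (0%:R / nt%:R), clamp (u%:R / M%:R)) = e.
  by rewrite mul0r clamp0; have [] := He (clamp (u%:R / M%:R)).
have end1 u : H (clamp (nt%:R / nt%:R), clamp (u%:R / M%:R)) = e.
  by rewrite divff ?pnatr_eq0 ?gtn_eqF // clamp1; have [] := He (clamp (u%:R / M%:R)).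
have pole a b : tucker (suspend 0 (ang R M a) (ang R M b)) = tucker (suspend 0 (ang R M 0) (ang R M 0)) :> label.
  by apply: eq_tucker => i i4; rewrite /suspend sin0 !mul0r.
have t0 u a b : L u 0 a b = L u 0 0 0 by rewrite !(LE _ _ _ _ _ (end0 u)) pole.
have t1 u a b : L u nt a b = L u nt 0 0 by rewrite !(LE _ _ _ _ _ (end1 u)) pole.
have LP u t a b b' : probe (ang R M a, ang R M b) = probe (ang R M a, ang R M b') -> L u t a b = L u t a b'.
  by move=> h; apply: eq_tucker => i i4; rewrite /W /pnt /= h.
have a0 u t b : L u t 0 b = L u t 0 0.
  by apply: LP; apply: probe_eq; rewrite ang0 sin0 !mul0r.
have a1 u t b : L u t (2 * M)%N b = L u t (2 * M)%N 0.
  by apply: LP; apply: probe_eq; rewrite s2 !mul0r.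
have b1 u t a : L u t a (4 * M)%N = L u t a 0.
  by apply: LP; apply: probe_eq; rewrite ?c4 ?s4 ang0 ?cos0 ?sin0.
have loopE i (l : nat) t : (0 < l)%N -> nt = (4 * i * (l * M))%N -> (t <= nt)%N ->
    rot_loop i (clamp (t%:R / nt%:R)) = @rot_diff R s (ang R (l * M) t).
  move=> l0 hnt ht; rewrite /= /mk_path /rot_loop_fun clampE ?frac //; congr rot_diff.
  have i0 : (0 < i)%N by move: nt0; rewrite hnt; case: (i); rewrite ?muln0.
  rewrite hnt /ang !natrM; field.
  by rewrite !pnatr_eq0 !gtn_eqF.
have E0 t a b : (t <= nt)%N -> L 0 t a b = labelling R (k * M) M t a b.
  by move=> ht; apply: LE; rewrite mul0r clamp0 H0; exact: (loopE j k).
have E1 t a b : (t <= nt)%N -> L M t a b = labelling R (j * M) M t a b.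
  by move=> ht; apply: LE; rewrite divff ?pnatr_eq0 ?gtn_eqF // clamp1 H1; exact: (loopE k j).
have refl n i : (i <= n)%N -> near_nat n i i by rewrite /near_nat; lia.
have := deg3_homotopy tL t0 t1 a0 a1 b1.
rewrite (@eq_deg3 _ _ _ _ (labelling R (k * M) M)) => [|t a b ht _ _]; last exact: E0.
rewrite [RHS](@eq_deg3 _ _ _ _ (labelling R (j * M) M)) => [|t a b ht _ _]; last exact: E1.
have tame u (i l : nat) : nt = (4 * i * (l * M))%N -> (u <= M)%N ->
    (forall t a b, (t <= nt)%N -> L u t a b = labelling R (l * M) M t a b) ->
    tame3 (4 * i * (l * M)) (2 * M) (4 * M) (labelling R (l * M) M).
  move=> hnt hu h; split=> [t a b|t t' a a' b b' ht ha hb]; first exact: tucker_lt4.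
  rewrite -hnt in ht; rewrite -!h; [|by case/and4P: ht..].
  by apply: (tL.2 _ _ _ _ _ _ _ _ (refl _ _ hu)).
rewrite {1}/nt (deg3_labelling _ M0 (tame 0%N j k erefl (leq0n M) E0)) ?muln_gt0 ?k0 //.
rewrite ntE (deg3_labelling _ M0 (tame M k j ntE (leqnn M) E1)) ?muln_gt0 ?j0 // => /eqP.
rewrite eqr_opp eqr_nat; lia.
Qed.

End Loops.

(** * From pairwise non-homotopic loops to infinitely many classes *)

Lemma loop_homotopic_refl (R : realType) (T : topologicalType) (x : T)
    (f : {path unit_interval R from x to x in T}) : loop_homotopic f f.
Proof.
exists (fun z => f z.1); split => // [|u]; last by rewrite path_zero path_one.
by move=> z; apply: (@continuous_comp _ _ _ fst f); [exact: cvg_fst|exact: cts_fun].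
Qed.

(** Each loop lies in its own class, so equal classes make their loops homotopic, and the map from
    indices to classes is injective. *)
Lemma pi1_infinite (R : realType) (T : topologicalType) (x : T)
    (f : nat -> {path unit_interval R from x to x in T}) :
  (forall j k, loop_homotopic (f j) (f k) -> j = k) -> infinite_set (pi1 R x).
Proof.
move=> finj; pose cl k := [set g | loop_homotopic (f k) g].
move=> /(@finite_preimage _ _ _ cl) h; apply: infinite_nat.
rewrite (_ : [set: nat] = cl @^-1` pi1 R x); last first.
  by apply/seteqP; split => // k _; exists (f k).
apply: h => j k _ _ e; apply: finj.
by have : cl k (f k) := loop_homotopic_refl (f k); rewrite -e.
Qed.

Theorem mainTheorem1 (R : realType) :
  exists N : nat, forall s0 : nat, (N <= s0)%N ->
    exists e : set_type (Diff R s0),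
      (forall p : S2xS3 R, val e p = p) /\ infinite_set (pi1 R e).
Proof.
(* The bound 5 is one derivative per coordinate direction in the embedding. The shift to [k.+1]
   below leaves out the constant loop, for which the common number of time steps would be 0. *)
exists 5%N => s s5; exists (rot_diff s 0); split; first exact: rot0.
apply: (pi1_infinite (f := fun k => @rot_loop R s k.+1)) => j k.
by move=> /(rot_loop_inj s5 (ltn0Sn _) (ltn0Sn _))/eqP; rewrite eqSS => /eqP.
Qed.
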